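(* Let $D$ be a bounded convex domain in $\mathbb{C}^N$ and let $q\in\{0,\ldots,N-2\}$. Then $$\check{S}_{\mathcal{O}^\pi_q(\overline{D})}=\check{S}_{\mathcal{O}_q(\overline{D})}=\check{S}_{\mathcal{PSH}_q(\overline{D})}=bD\setminus\Gamma_{q+1}(\overline{D}),$$ where $\Gamma_{q+1}(\overline{D})$ is the set of all boundary points of $D$ which have a neighborhood $U$ in $bD$ consisting only of $(q+1)$-complex points.
   Context: $bD$ is the topological boundary of $D$. Shilov boundaries. Let $K$ be a compact Hausdorff space and $\mathcal{A}$ a set of upper semi-continuous functions $K\to[-\infty,\infty)$. Put $S(f):=\{x\in K: f(x)=\max_K f\}$. A closed set $S\subset K$ is a closed boundary for $\mathcal{A}$ if $S\cap S(f)\neq\emptyset$ for all $f\in\mathcal{A}$; the Shilov boundary $\check{S}_{\mathcal{A}}$ is the intersection of all closed boundaries. For a set $\mathcal{B}$ of complex-valued continuous functions on $K$, $\check{S}_{\mathcal{B}}$ means $\check{S}_{\log|\mathcal{B}|}$ with $\log|\mathcal{B}|=\{\log|f|: f\in\mathcal{B}\}$. $q$-plurisubharmonic functions. An upper semi-continuous $u:U\to[-\infty,\infty)$ on an open set $U$ is subpluriharmonic if for every ball $B\Subset U$ and every $h$ pluriharmonic near $\overline{B}$ with $u\le h$ on $bB$ one has $u\le h$ on $B$. It is $q$-plurisubharmonic on $U\subset\mathbb{C}^N$ ($0\le q\le N-1$) if it is subpluriharmonic on $U\cap\pi$ for every $(q+1)$-dimensional complex affine plane $\pi$. For compact $K\subset\mathbb{C}^N$,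 $\mathcal{PSH}_q(K)$ is the set of upper semi-continuous functions on $K$ which extend to a $q$-plurisubharmonic function on some open neighborhood of $K$. $q$-holomorphic functions. For open $U\subset\mathbb{C}^N$, $\mathcal{O}_q(U)$ is the set of complex-valued $f\in\mathcal{C}^2(U)$ with $\overline{\partial}f\wedge(\partial\overline{\partial}f)^q=0$. For a complex affine plane $L$ of codimension $q$, $\mathcal{O}(L,U)$ is the set of $f\in\mathcal{C}^2(U)$ which are holomorphic on $U\cap L'$ for every parallel copy $L'$ of $L$; $\mathcal{O}^\pi_q(U)$ is the union of all $\mathcal{O}(L,U)$ over all complex affine planes $L$ of codimension $q$. For compact $K$, $\mathcal{O}_q(K)$ (resp. $\mathcal{O}_q^\pi(K)$) is the set of continuous functions on $K$ having an extension in $\mathcal{O}_q(U)$ (resp. $\mathcal{O}_q^\pi(U)$) for some open neighborhood $U$ of $K$. Convexity. For a compact convex set $F$ and a point $p$ of its relative boundary, $F_{\min}(p,F)$ is the intersection of $F$ with all hyperplanes (in the real affine hull of $F$) supporting $F$ at $p$. For $p\in bD$ put $F_0=\overline{D}$ and $F_{j+1}=F_{\min}(p,F_j)$ as long as $p$ is in the relative boundary of $F_j$; the process stops at some $F_p(\overline{D}):=F_{j(p)}$ which either is $\{p\}$ or contains $p$ in its relative interior. $E_p(\overline{D})$ is the real affine plane of dimension $\dim F_p(\overline{D})$ containing $F_p(\overline{D})$; $E_p^{\mathbb{C}}(\overline{D})$ is the largest complex affine plane inside $E_p(\overline{D})$ passing through $p$, and $\nu(p):=\dim_{\mathbb{C}}E_p^{\mathbb{C}}(\overline{D})$.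 The point $p$ is complex if there are a complex affine plane $\pi$ of positive dimension and a domain $G\subset\mathbb{C}^N$ with $p\in G\cap\pi\subset bD$. For $q\in\{1,\ldots,N-1\}$, a complex point $p$ is $q$-complex if $\nu(p)\ge q$. *)

(* Defs.v *)
(* Functions "on a set" are total functions constrained only on that set. *)
From HB Require Import structures.
From mathcomp Require Import all_boot all_order all_algebra all_fingroup.
From mathcomp Require Import complex.
From mathcomp Require Import all_classical all_reals all_analysis.
Set Implicit Arguments.
Unset Strict Implicit.
Unset Printing Implicit Defensive.
Import Order.TTheory GRing.Theory Num.Theory.
Import numFieldNormedType.Exports.
Local Open Scope classical_set_scope.
Local Open Scope ring_scope.

(* R[i] wrapped as a numClosedFieldType, so that it receives the generic
   topology and normed-module instances of numeric fields. *)
Definition Cplx (R : realType) : numClosedFieldType := complex R.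

Notation "''C[' R ]^ N" := 'rV[Cplx R]_N
  (at level 0, R at level 200, N at level 2, format "''C[' R ]^ N").

Section Topology.
Context {R : realType} {T : topologicalType}.
Implicit Types (A K S : set T) (u f : T -> \bar R).

Definition bd A : set T := closure A `\` interior A.

Definition domain A : Prop := [/\ open A, A !=set0 & connected A].

Definition usc_on A u : Prop :=
  forall x, A x -> (u x < +oo)%E /\
    forall a : R, (u x < a%:E)%E ->
      \forall y \near within A (nbhs x), (u y < a%:E)%E.

Definition maxset K f : set T :=
  [set x | K x /\ forall y, K y -> (f y <= f x)%E].

(* K is meant to be compact Hausdorff, so closed in K is the same as closed. *)
Definition closed_boundary K (A : set (T -> \bar R)) S : Prop :=
  [/\ S `<=` K, closed S & forall f, A f -> S `&` maxset K f !=set0].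

Definition shilov K (A : set (T -> \bar R)) : set T :=
  \bigcap_(S in closed_boundary K A) S.

(* lne 0 = -oo *)
Definition logabs (B : set (T -> Cplx R)) : set (T -> \bar R) :=
  [set (fun z => lne (Normc.normc (f z))%:E) | f in B].

Definition shilovC K (B : set (T -> Cplx R)) : set T := shilov K (logabs B).

Definition extends_from_nbhd {Y : topologicalType} (F : set T -> set (T -> Y)) K :
    set (T -> Y) :=
  [set f | {within K, continuous f} /\
    exists U g, [/\ open U, K `<=` U, F U g & forall z, K z -> f z = g z]].

End Topology.

Section Forms.
Context {R : realType} {N : nat}.

(* Alternating forms are represented by their values on families of vectors. *)
Definition form (d : nat) := ('I_d -> 'C[R]^N) -> Cplx R.

Definition wedge {m n : nat} (a : form m) (b : form n) : form (m + n) :=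
  fun v => (m`! * n`!)%:R^-1 *
    \sum_(s : 'S_(m + n)) (-1) ^+ s *
      (a (fun i => v (s (lshift n i))) * b (fun j => v (s (rshift m j)))).

(* form (q.+1 * d) is convertible to form (d + q * d) *)
Fixpoint wedge_pow {d : nat} (b : form d) (q : nat) : form (q * d) :=
  match q return form (q * d) with
  | 0 => fun _ => 1
  | q'.+1 => wedge b (@wedge_pow d b q')
  end.

Definition dz (j : 'I_N) : form 1 := fun v => v ord0 ord0 j.
Definition dzbar (j : 'I_N) : form 1 := fun v => (v ord0 ord0 j)^*.

End Forms.
Arguments wedge_pow {R N d} b q _.

Section Calculus.
Context {R : realType} {N : nat}.
Implicit Types (v z : 'C[R]^N) (g : 'C[R]^N -> R) (f : 'C[R]^N -> Cplx R).
Implicit Type U : set 'C[R]^N.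

(* The library's derivatives on 'C[R]^N are complex-linear; real directional
   derivatives are taken along the real line t |-> z + t v. *)
Definition rline g v z : R -> R := fun t => g (z + (t%:C)%C *: v).
Definition rderivable g v z : Prop := derivable (rline g v z) 0 1.
Definition rderiv v g z : R := derive1 (rline g v z) 0.

Fixpoint Ck (k : nat) U g : Prop :=
  (forall z, U z -> {for z, continuous g}) /\
  match k with
  | 0 => True
  | k'.+1 => forall v, (forall z, U z -> rderivable g v z) /\ Ck k' U (rderiv v g)
  end.

Definition C2 U f : Prop :=
  Ck 2 U (fun z => complex.Re (f z)) /\ Ck 2 U (fun z => complex.Im (f z)).

Definition cderiv v f z : Cplx R :=
  Complex (rderiv v (fun z => complex.Re (f z)) z)
          (rderiv v (fun z => complex.Im (f z)) z).

Definition ebasis (j : 'I_N) : 'C[R]^N := delta_mx ord0 j.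

Definition wirt (j : 'I_N) f z : Cplx R :=
  2^-1 * (cderiv (ebasis j) f z - 'i * cderiv ('i *: ebasis j) f z).
Definition wirtbar (j : 'I_N) f z : Cplx R :=
  2^-1 * (cderiv (ebasis j) f z + 'i * cderiv ('i *: ebasis j) f z).

Definition dbar f z : @form R N 1 :=
  fun vs => \sum_(j < N) wirtbar j f z * dzbar j vs.
Definition ddbar f z : @form R N 2 :=
  fun vs => \sum_(k < N) \sum_(l < N)
    wirt k (wirtbar l f) z * wedge (dz k) (dzbar l) vs.

Definition pluriharmonic U (h : 'C[R]^N -> R) : Prop :=
  Ck 2 U h /\ forall z, U z -> ddbar (fun z => (h z)%:C%C) z = fun=> 0.

Definition qholo (q : nat) U : set ('C[R]^N -> Cplx R) :=
  [set f | C2 U f /\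
    forall z, U z -> wedge (dbar f z) (wedge_pow (ddbar f z) q) = fun=> 0].

(* Row-free A : 'M_(N - q, N) is a basis of the direction of a plane L of
   codimension q; the parallel copies of L are the planes p + L. *)
Definition holo_along {k : nat} (A : 'M[Cplx R]_(k, N)) U f : Prop :=
  forall (p : 'C[R]^N) (w : 'C[R]^k), U (p + w *m A) ->
    differentiable (fun w : 'C[R]^k => f (p + w *m A)) w.

Definition qholo_plane (q : nat) U : set ('C[R]^N -> Cplx R) :=
  [set f | C2 U f /\
    exists A : 'M[Cplx R]_(N - q, N), row_free A /\ holo_along A U f].

(* The norm of the library on 'C[R]^N is the sup norm, hence this definition. *)
Definition eball (c : 'C[R]^N) (r : R) : set 'C[R]^N :=
  [set z | \sum_(j < N) Normc.normc (z 0 j - c 0 j) ^+ 2 < r ^+ 2].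

Definition subpluriharmonic U (u : 'C[R]^N -> \bar R) : Prop :=
  usc_on U u /\
  forall (c : 'C[R]^N) (r : R) (h : 'C[R]^N -> R) (W : set 'C[R]^N),
    0 < r -> closure (eball c r) `<=` U ->
    open W -> closure (eball c r) `<=` W -> pluriharmonic W h ->
    (forall z, bd (eball c r) z -> (u z <= (h z)%:E)%E) ->
    forall z, eball c r z -> (u z <= (h z)%:E)%E.

End Calculus.

Section QPsh.
Context {R : realType} {N : nat}.

(* A (q+1)-dimensional plane is identified with 'C[R]^(q.+1) through an
   isometry w |-> p + w A (A has orthonormal rows), so that balls of the plane
   are balls of 'C[R]^(q.+1). *)
Definition qpsh (q : nat) (U : set 'C[R]^N) : set ('C[R]^N -> \bar R) :=
  [set u | usc_on U u /\
    forall (p : 'C[R]^N) (A : 'M[Cplx R]_(q.+1, N)), A \is unitarymx ->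
      subpluriharmonic [set w : 'C[R]^(q.+1) | U (p + w *m A)]
                       (fun w => u (p + w *m A))].

Definition PSH (q : nat) (K : set 'C[R]^N) : set ('C[R]^N -> \bar R) :=
  [set u | usc_on K u /\
    exists U g, [/\ open U, K `<=` U, qpsh q U g & forall z, K z -> u z = g z]].

End QPsh.

Section Convexity.
Context {R : realType} {N : nat}.
Implicit Types (F E pi D : set 'C[R]^N) (p z a : 'C[R]^N).

Definition raff F : set 'C[R]^N :=
  [set z | exists n (x : 'I_n -> 'C[R]^N) (t : 'I_n -> R),
    [/\ forall i, F (x i), \sum_i t i = 1 & z = \sum_i ((t i)%:C)%C *: x i]].

Definition relint F : set 'C[R]^N :=
  [set z | F z /\ within (raff F) (nbhs z) F].
Definition relbd F : set 'C[R]^N := closure F `\` relint F.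

(* Every real-linear form on C^N is of this shape for a unique a. *)
Definition rform a z : R := complex.Re (\sum_(j < N) a 0 j * z 0 j).

(* Hyperplanes live in the real affine hull of F: H is the zero set there of
   a real affine form that is not identically zero on it. *)
Definition supporting_hyperplane F p (H : set 'C[R]^N) : Prop :=
  exists a, [/\ H = [set z | raff F z /\ rform a (z - p) = 0],
                exists2 z, raff F z & rform a (z - p) <> 0,
                H p
              & forall z, F z -> rform a (z - p) <= 0].

Definition Fmin p F : set 'C[R]^N :=
  F `&` \bigcap_(H in supporting_hyperplane F p) H.

Definition face_seq D p (j : nat) : set 'C[R]^N := iter j (Fmin p) (closure D).

Definition face_index D p : nat :=
  get [set j | (forall i, (i < j)%N -> relbd (face_seq D p i) p) /\
               ~ relbd (face_seq D p j) p].

Definition face D p : set 'C[R]^N := face_seq D p (face_index D p).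

Definition Eplane D p : set 'C[R]^N := raff (face D p).

Definition cplane (k : nat) pi : Prop :=
  exists p (A : 'M[Cplx R]_(k, N)),
    row_free A /\ pi = [set z | (z - p <= A)%MS].

Definition cdim pi : nat := get [set k | cplane k pi].

Definition ECplane D p : set 'C[R]^N :=
  get [set pi | let inner pi := [/\ exists k, cplane k pi, pi p
                                  & pi `<=` Eplane D p] in
                inner pi /\ forall pi', inner pi' -> pi' `<=` pi].

Definition nu D p : nat := cdim (ECplane D p).

Definition complex_point D p : Prop :=
  bd D p /\ exists k pi (G : set 'C[R]^N),
    [/\ (0 < k)%N, cplane k pi, domain G, (G `&` pi) p & G `&` pi `<=` bd D].

Definition qcomplex (q : nat) D p : Prop :=
  complex_point D p /\ (q <= nu D p)%N.

Definition Gamma (q : nat) D : set 'C[R]^N :=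
  [set p | bd D p /\ \forall z \near within (bd D) (nbhs p), qcomplex q D z].

End Convexity.

(* Main.v *)
(** Let B be the right-hand side.  The inclusions
    B <= S(O^pi_q) <= S(O_q) <= S(PSH_q) <= B are proved in turn.

    If p is a boundary point with nu(p) <= q, let V be the real direction of its
    minimal face.  With complex coordinates x on the maximal complex subspace of
    V and further complex coordinates y that are real on V, the quadratic form
    |x|^2 + Re (y.y) is positive on V \ 0.  Going up the chain of faces, a real
    linear form Re L, a sum of supporting forms, can be added so that
    Re g < 0 on the closure of D minus a given neighborhood of p, where
    g = L - |x|^2 - y.y is taken at z - p.  Then 1 + e g, for small e > 0, peaks
    near p, and it is holomorphic along the planes x = const, whose codimension
    is at most q.

    A function holomorphic along the translates of a plane of codimension q has
    its antilinear derivatives in a q-dimensional space, so the form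
    dbar f /\ (d dbar f)^q vanishes.

    The restriction of a q-holomorphic f to a (q+1)-plane has at each point a
    direction in which both dbar f and the Levi form of f degenerate; along it
    log |f| is harmonic to second order, so |f| e^(-h) with h pluriharmonic,
    perturbed by a small multiple of |z|^2, has no interior maximum, whence
    log |f| is q-plurisubharmonic.

    If u is q-plurisubharmonic, take among its maximum points on the closure of
    D one of largest norm.  If it were outside B, a complex (q+1)-disc centered
    at it would lie in the closure of D; the norm being strictly plurisubharmonic
    on that disc, comparison with an affine function gives a contradiction. *)

Require Import Defs.
From HB Require Import structures.
From mathcomp Require Import all_boot all_order all_algebra all_fingroup.
From mathcomp Require Import complex ring lra zify.
From mathcomp Require Import all_classical all_reals all_analysis.
Set Implicit Arguments.
Unset Strict Implicit.
Unset Printing Implicit Defensive.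
Import Order.TTheory GRing.Theory Num.Theory.
Import numFieldNormedType.Exports.
Local Open Scope classical_set_scope.
Local Open Scope ring_scope.

(** * Complex numbers and the real inner product *)

(** A minimal face need not be exposed: a single supporting hyperplane of the closure of [D] may
    fail to cut it out. This is why the separating form is built one face at a time, compactness
    giving a finite sum of supporting forms at each stage. In the exponent [g] the term [y.y] stands
    for [|y|^2]: it is holomorphic, and the two agree on real directions. The term [|x|^2] may stay,
    as [x] is frozen on the planes.

    For a q-holomorphic function the difficulty is to read a common null direction off the vanishing
    of a form of degree [2q + 1] on a (q+1)-dimensional space. The form is a sum of determinants
    over tuples of indices, known only at the real points [(v, conj v)]; polarization makes the two
    entries independent. If there were no null direction, there would be a dual basis on which each
    determinant is 0 or 1 and one of them is 1, so that the sum could not vanish.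

    Maximum arguments are run on [|f|^2 e^(-2h)], where the zeros of [f] are harmless. *)

Lemma cvg_bigsum {K : numFieldType} {V : pseudoMetricNormedZmodType K}
    (T I : Type) (F : set_system T) {FF : Filter F} (r : seq I) (P : pred I)
    (f : I -> T -> V) (l : I -> V) :
  (forall i, f i x @[x --> F] --> l i) ->
  (\sum_(i <- r | P i) f i x) @[x --> F] --> \sum_(i <- r | P i) l i.
Proof.
move=> fl; elim: r => [|i r IH].
  by rewrite big_nil; under eq_cvg do rewrite big_nil; exact: cvg_cst.
rewrite big_cons; under eq_cvg do rewrite big_cons.
by case: ifP => // _; apply: cvgD.
Qed.

Section ComplexNumbers.
Context {R : realType}.
Implicit Types (x y : Cplx R) (s t : R).

Lemma cReD x y : complex.Re (x + y) = complex.Re x + complex.Re y.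
Proof. by case: x y => [a b] [c d]. Qed.
Lemma cImD x y : complex.Im (x + y) = complex.Im x + complex.Im y.
Proof. by case: x y => [a b] [c d]. Qed.
Lemma cReN x : complex.Re (- x) = - complex.Re x.
Proof. by case: x. Qed.
Lemma cImN x : complex.Im (- x) = - complex.Im x.
Proof. by case: x. Qed.
Lemma cReM x y : complex.Re (x * y) =
  complex.Re x * complex.Re y - complex.Im x * complex.Im y.
Proof. by case: x y => [a b] [c d]. Qed.
Lemma cImM x y : complex.Im (x * y) =
  complex.Re x * complex.Im y + complex.Im x * complex.Re y.
Proof. by case: x y => [a b] [c d]; rewrite /= addrC. Qed.
Lemma cRe_sum I (r : seq I) (P : pred I) (F : I -> Cplx R) :
  complex.Re (\sum_(i <- r | P i) F i) = \sum_(i <- r | P i) complex.Re (F i).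
Proof. by apply: (big_morph _ cReD). Qed.
Lemma cIm_sum I (r : seq I) (P : pred I) (F : I -> Cplx R) :
  complex.Im (\sum_(i <- r | P i) F i) = \sum_(i <- r | P i) complex.Im (F i).
Proof. by apply: (big_morph _ cImD). Qed.
Lemma cRe_i : complex.Re ('i : Cplx R) = 0. Proof. by rewrite -complexiE. Qed.
Lemma cIm_i : complex.Im ('i : Cplx R) = 1. Proof. by rewrite -complexiE. Qed.
Lemma cRe_conj x : complex.Re x^* = complex.Re x.
Proof. by case: x. Qed.
Lemma cIm_conj x : complex.Im x^* = - complex.Im x.
Proof. by case: x. Qed.
Lemma eqCplx x y : complex.Re x = complex.Re y -> complex.Im x = complex.Im y -> x = y.
Proof. by case: x y => [a b] [c d] /= -> ->. Qed.
Lemma cconjD x y : (x + y)^* = x^* + y^*.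
Proof. by apply: eqCplx; rewrite !(cRe_conj, cIm_conj, cReD, cImD) //; ring. Qed.
Lemma cconjN x : (- x)^* = - x^*.
Proof. by apply: eqCplx; rewrite !(cRe_conj, cIm_conj, cReN, cImN). Qed.
Lemma cconjM x y : (x * y)^* = x^* * y^*.
Proof. by apply: eqCplx; rewrite !(cRe_conj, cIm_conj, cReM, cImM) //; ring. Qed.
Lemma cconjK x : x^*^* = x.
Proof. by apply: eqCplx; rewrite !(cRe_conj, cIm_conj) // opprK. Qed.
Lemma cconj_i : ('i : Cplx R)^* = - 'i.
Proof. by apply: eqCplx; rewrite !(cRe_conj, cIm_conj, cReN, cImN, cRe_i, cIm_i) // oppr0. Qed.
Lemma normcE2 x : Normc.normc x ^+ 2 = complex.Re x ^+ 2 + complex.Im x ^+ 2.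
Proof. by case: x => a b /=; rewrite sqr_sqrtr // addr_ge0 // sqr_ge0. Qed.
Lemma normE x : `|x| = ((Normc.normc x)%:C)%C.
Proof. by []. Qed.
Lemma normc_ge0' x : 0 <= Normc.normc x.
Proof. by case: x => a b; rewrite /= sqrtr_ge0. Qed.
Lemma Re_le_normc x : `|complex.Re x| <= Normc.normc x.
Proof.
by have := normc_ge_Re x; rewrite normE lecR.
Qed.
Lemma Im_le_normc x : `|complex.Im x| <= Normc.normc x.
Proof.
rewrite -(@ler_pXn2r _ 2) ?nnegrE ?normc_ge0' //.
by rewrite normcE2 real_normK ?num_real // lerDr sqr_ge0.
Qed.
Lemma normc_le x : Normc.normc x <= `|complex.Re x| + `|complex.Im x|.
Proof.
rewrite -(@ler_pXn2r _ 2) ?nnegrE ?addr_ge0 ?normc_ge0' //.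
rewrite normcE2 sqrrD !real_normK ?num_real //.
rewrite -addrA lerD2l addrC lerDl.
by rewrite mulrn_wge0 // mulr_ge0.
Qed.

Lemma Cgt0 (e : Cplx R) : 0 < e -> exists2 r : R, 0 < r & e = (r%:C)%C.
Proof.
case: e => a b; rewrite ltcE /= => /andP[/eqP -> a0]; by exists a.
Qed.

Lemma continuous_Re : continuous (fun x : Cplx R => complex.Re x).
Proof.
move=> x; have FF : Filter (nbhs x) by typeclasses eauto.
apply/cvgrPdist_lt => e e0.
have He : 0 < (e%:C)%C :> Cplx R by rewrite ltcR.
apply: filterS (nbhsx_ballx x _ He) => y; rewrite /ball /= normE ltcR.
by rewrite -cReN -cReD; apply: le_lt_trans; exact: Re_le_normc.
Qed.

Lemma continuous_Im : continuous (fun x : Cplx R => complex.Im x).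
Proof.
move=> x; have FF : Filter (nbhs x) by typeclasses eauto.
apply/cvgrPdist_lt => e e0.
have He : 0 < (e%:C)%C :> Cplx R by rewrite ltcR.
apply: filterS (nbhsx_ballx x _ He) => y; rewrite /ball /= normE ltcR.
by rewrite -cImN -cImD; apply: le_lt_trans; exact: Im_le_normc.
Qed.

Lemma cvg_Complex (T : Type) (F : set_system T) {FF : Filter F} (f g : T -> R) a b :
  f x @[x --> F] --> a -> g x @[x --> F] --> b ->
  (Complex (f x) (g x) : Cplx R) @[x --> F] --> (Complex a b : Cplx R).
Proof.
move=> /cvgrPdist_lt fa /cvgrPdist_lt gb; apply/cvgrPdist_lt => e /Cgt0[r r0 ->].
have r20 : 0 < r / 2 by rewrite divr_gt0.
near=> x; rewrite normE ltcR.
apply: (le_lt_trans (normc_le _)); rewrite /= [ltRHS]splitr.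
by apply: ltrD; near: x; [exact: fa | exact: gb].
Unshelve. all: by end_near. Qed.

Lemma continuous_RtoC : continuous ((fun t => (t%:C)%C) : R -> Cplx R).
Proof. by move=> t; apply: cvg_Complex; [exact: cvg_id | exact: cvg_cst]. Qed.

End ComplexNumbers.

Lemma conjRC {R : realType} (t : R) : ((t%:C)%C : Cplx R)^* = (t%:C)%C.
Proof. by apply: eqCplx; rewrite ?cRe_conj ?cIm_conj //= oppr0. Qed.

Section Hermitian.
Context {R : realType} {N : nat}.
Implicit Types (u v w z : 'C[R]^N) (s t : R).

(** The Euclidean inner product of the underlying real space of dimension [2 N]; projections,
    normals and Laplacians need it in place of the sup norm. *)
Definition dotr u z : R :=
  \sum_(j < N) (complex.Re (u 0 j) * complex.Re (z 0 j)
                + complex.Im (u 0 j) * complex.Im (z 0 j)).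
Definition nsq z : R := dotr z z.

Lemma cReZ t (x : Cplx R) : complex.Re ((t%:C)%C * x) = t * complex.Re x.
Proof. by rewrite cReM /= mul0r subr0. Qed.
Lemma cImZ t (x : Cplx R) : complex.Im ((t%:C)%C * x) = t * complex.Im x.
Proof. by rewrite cImM /= mul0r addr0. Qed.

Lemma dotrC u z : dotr u z = dotr z u.
Proof. by apply: eq_bigr => j _; ring. Qed.
Lemma dotrDr u v z : dotr u (v + z) = dotr u v + dotr u z.
Proof. by rewrite -big_split; apply: eq_bigr => j _; rewrite mxE cReD cImD /=; ring. Qed.
Lemma dotrDl u v z : dotr (u + v) z = dotr u z + dotr v z.
Proof. by rewrite dotrC dotrDr !(dotrC z). Qed.
Lemma dotrZr t u z : dotr u ((t%:C)%C *: z) = t * dotr u z.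
Proof. by rewrite mulr_sumr; apply: eq_bigr => j _; rewrite mxE cReZ cImZ /=; ring. Qed.
Lemma dotrZl t u z : dotr ((t%:C)%C *: u) z = t * dotr u z.
Proof. by rewrite dotrC dotrZr dotrC. Qed.
Lemma dotrNr u z : dotr u (- z) = - dotr u z.
Proof.
by rewrite -sumrN; apply: eq_bigr => j _; rewrite mxE cReN cImN; ring.
Qed.
Lemma dotrNl u z : dotr (- u) z = - dotr u z.
Proof. by rewrite dotrC dotrNr dotrC. Qed.
Lemma dotr0 u : dotr u 0 = 0.
Proof. by rewrite /dotr big1 // => j _; rewrite mxE /=; ring. Qed.

Lemma nsq_sum z : nsq z = \sum_(j < N) Normc.normc (z 0 j) ^+ 2.
Proof. by apply: eq_bigr => j _; rewrite normcE2; ring. Qed.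
Lemma nsq_ge0 z : 0 <= nsq z.
Proof. by rewrite nsq_sum sumr_ge0 // => j _; rewrite sqr_ge0. Qed.
Lemma nsqD u v : nsq (u + v) = nsq u + 2 * dotr u v + nsq v.
Proof. by rewrite /nsq dotrDr !dotrDl (dotrC v u); ring. Qed.
Lemma nsqN z : nsq (- z) = nsq z.
Proof. by rewrite /nsq dotrNr dotrNl opprK. Qed.
Lemma nsqB u v : nsq (u - v) = nsq u - 2 * dotr u v + nsq v.
Proof. by rewrite nsqD nsqN dotrNr; ring. Qed.
Lemma nsqZ t z : nsq ((t%:C)%C *: z) = t ^+ 2 * nsq z.
Proof. by rewrite /nsq dotrZr dotrZl; ring. Qed.
Lemma nsq0 : nsq 0 = 0. Proof. exact: dotr0. Qed.
Lemma normc_le_nsq z j : Normc.normc (z 0 j) ^+ 2 <= nsq z.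
Proof.
rewrite nsq_sum (bigD1 j) //= lerDl sumr_ge0 // => i _; exact: sqr_ge0.
Qed.
Lemma nsq_eq0 z : nsq z = 0 -> z = 0.
Proof.
move=> z0; apply/rowP => j; rewrite mxE; apply: Normc.eq0_normc.
apply/eqP; rewrite -sqrf_eq0 eq_le sqr_ge0 andbT -z0; exact: normc_le_nsq.
Qed.
Lemma nsq_gt0 z : z != 0 -> 0 < nsq z.
Proof.
by move=> z0; rewrite lt_def nsq_ge0 andbT; apply: contra z0 => /eqP/nsq_eq0->.
Qed.

Lemma eballE (c : 'C[R]^N) (r : R) : eball c r = [set z | nsq (z - c) < r ^+ 2].
Proof.
rewrite predeqE => z; rewrite /eball /= nsq_sum.
by under [in X in _ <-> X]eq_bigr => j _ do rewrite !mxE.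
Qed.

Lemma rformE (a z : 'C[R]^N) :
  rform a z = dotr (map_mx (fun x => x^*) a) z.
Proof.
rewrite /rform cRe_sum; apply: eq_bigr => j _.
by rewrite mxE cReM cRe_conj cIm_conj; ring.
Qed.
Lemma dotr_rform (u z : 'C[R]^N) :
  dotr u z = rform (map_mx (fun x => x^*) u) z.
Proof.
by rewrite rformE; congr dotr; apply/rowP => j; rewrite !mxE conjCK.
Qed.
Lemma rformD a u v : rform a (u + v) = rform a u + rform a v.
Proof. by rewrite !rformE dotrDr. Qed.
Lemma rformN a u : rform a (- u) = - rform a u.
Proof. by rewrite !rformE dotrNr. Qed.
Lemma rformB a u v : rform a (u - v) = rform a u - rform a v.
Proof. by rewrite rformD rformN. Qed.
Lemma rformZ a t u : rform a ((t%:C)%C *: u) = t * rform a u.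
Proof. by rewrite !rformE dotrZr. Qed.
Lemma rform0 (a : 'C[R]^N) : rform a 0 = 0.
Proof. by rewrite rformE dotr0. Qed.
Lemma rform_sum a I (r : seq I) P (F : I -> 'C[R]^N) :
  rform a (\sum_(i <- r | P i) F i) = \sum_(i <- r | P i) rform a (F i).
Proof. apply: (big_morph _ (rformD a)); exact: rform0. Qed.
Lemma rformDl a b z : rform (a + b) z = rform a z + rform b z.
Proof.
rewrite !rformE -dotrDl; congr dotr; apply/rowP => j; by rewrite !mxE rmorphD.
Qed.
Lemma rformZl a t z : rform ((t%:C)%C *: a) z = t * rform a z.
Proof.
rewrite !rformE -dotrZl; congr dotr; apply/rowP => j; rewrite !mxE rmorphM /=.
congr (_ * _); exact: conjRC.
Qed.

Lemma continuous_coordRe j : continuous (fun z : 'C[R]^N => complex.Re (z 0 j)).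
Proof.
move=> z; apply: (@continuous_comp _ _ _ (fun z : 'C[R]^N => z 0 j) (fun x : Cplx R => complex.Re x)).
  exact: coord_continuous.
exact: continuous_Re.
Qed.
Lemma continuous_coordIm j : continuous (fun z : 'C[R]^N => complex.Im (z 0 j)).
Proof.
move=> z; apply: (@continuous_comp _ _ _ (fun z : 'C[R]^N => z 0 j) (fun x : Cplx R => complex.Im x)).
  exact: coord_continuous.
exact: continuous_Im.
Qed.

Lemma cvg_row (T : Type) (F : set_system T) {FF : Filter F}
    (f : T -> 'C[R]^N) (l : 'C[R]^N) :
  (forall j, f x 0 j @[x --> F] --> l 0 j) -> f x @[x --> F] --> l.
Proof.
move=> fl A [P lP sPA].
have : \forall x \near F, forall j, P 0 j (f x 0 j).
  by apply: filter_forall => j; exact: (fl j _ (lP 0 j)).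
by apply: filterS => x Px; apply: sPA => i j; rewrite ord1.
Qed.

Lemma cvg_dotr (T : Type) (F : set_system T) {FF : Filter F}
    (f g : T -> 'C[R]^N) (k l : 'C[R]^N) :
  f x @[x --> F] --> k -> g x @[x --> F] --> l ->
  dotr (f x) (g x) @[x --> F] --> dotr k l.
Proof.
move=> fk gl; rewrite /dotr.
have cR (h : T -> 'C[R]^N) (m : 'C[R]^N) j : h x @[x --> F] --> m ->
   complex.Re (h x 0 j) @[x --> F] --> complex.Re (m 0 j).
  by move=> hm; exact: (cvg_comp h (fun z : 'C[R]^N => complex.Re (z 0 j)) hm (@continuous_coordRe j m)).
have cI (h : T -> 'C[R]^N) (m : 'C[R]^N) j : h x @[x --> F] --> m ->
   complex.Im (h x 0 j) @[x --> F] --> complex.Im (m 0 j).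
  by move=> hm; exact: (cvg_comp h (fun z : 'C[R]^N => complex.Im (z 0 j)) hm (@continuous_coordIm j m)).
apply: cvg_bigsum => j; apply: cvgD; apply: cvgM; [exact: cR|exact: cR|exact: cI|exact: cI].
Qed.

Lemma cvg_nsq (T : Type) (F : set_system T) {FF : Filter F}
    (f : T -> 'C[R]^N) (k : 'C[R]^N) :
  f x @[x --> F] --> k -> nsq (f x) @[x --> F] --> nsq k.
Proof. by move=> fk; exact: cvg_dotr. Qed.

Lemma continuous_dotr u : continuous (dotr u).
Proof. by move=> z; apply: (@cvg_dotr _ (nbhs z) _ (fun=> u) id); [exact: cvg_cst|exact: cvg_id]. Qed.
Lemma continuous_rform (a : 'C[R]^N) : continuous (rform a).
Proof.
have -> : rform a = dotr (map_mx (fun x => x^*) a) by apply/funext => z; rewrite rformE.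
exact: continuous_dotr.
Qed.
Lemma continuous_nsqB c : continuous (fun z => nsq (z - c)).
Proof.
move=> z; apply: (@cvg_nsq _ (nbhs z) _ (fun z => z - c)).
by apply: (@cvgB _ _ _ (nbhs z) _ id (fun=> c)); [exact: cvg_id|exact: cvg_cst].
Qed.
Lemma continuous_nsq : continuous nsq.
Proof. by move=> z; exact: (@cvg_nsq _ (nbhs z) _ id). Qed.

Lemma open_eball (c : 'C[R]^N) (r : R) : open (eball c r).
Proof.
rewrite eballE; apply: (@open_comp _ _ (fun z => nsq (z - c)) [set x | x < r ^+ 2]).
  by move=> z _; exact: continuous_nsqB.
exact: open_lt.
Qed.

Lemma nbhsE_eball z (A : set 'C[R]^N) :
  nbhs z A <-> exists2 r, 0 < r & eball z r `<=` A.
Proof.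
split=> [/nbhs_ballP[_ /Cgt0[r r0 ->] sA]|[r r0 sA]].
  exists r => // y; rewrite eballE => /= yr; apply: sA.
  split=> [|i j]; first by rewrite ltcR.
  rewrite ord1 /ball /= normE ltcR -(@ltr_pXn2r _ 2) ?nnegrE ?normc_ge0' ?(ltW r0) //.
  apply: le_lt_trans yr; rewrite -nsqN opprB.
  by have := normc_le_nsq (z - y) j; rewrite !mxE.
apply: filterS sA _; apply: open_nbhs_nbhs; split; first exact: open_eball.
by rewrite eballE /= subrr nsq0 exprn_gt0.
Qed.

Lemma sub_closure_eball (c : 'C[R]^N) (r : R) : closure (eball c r) `<=` [set z | nsq (z - c) <= r ^+ 2].
Proof.
have clS : closed [set z | nsq (z - c) <= r ^+ 2].
  apply: (@closed_comp _ _ (fun z => nsq (z - c)) [set x | x <= r ^+ 2]).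
    by move=> z _; exact: continuous_nsqB.
  exact: closed_le.
rewrite ((closure_id _).1 clS); apply: closureS.
by rewrite eballE => z /= /ltW.
Qed.

Lemma closure_eballE (c : 'C[R]^N) (r : R) : 0 < r -> closure (eball c r) = [set z | nsq (z - c) <= r ^+ 2].
Proof.
move=> r0; apply/seteqP; split; first exact: sub_closure_eball.
move=> z /= zr A /nbhsE_eball[e e0 eA].
(* Shrinking [z - c] by the factor [1 - t] moves [z] by at most [t * r <= e / 2]. *)
pose t := Num.min 1 (e / (r * 2)).
have t0 : 0 < t by rewrite lt_min ltr01 divr_gt0 // mulr_gt0.
have t1 : t <= 1 by rewrite ge_min lexx.
have te : t * (r * 2) <= e.
  by rewrite -ler_pdivlMr ?mulr_gt0 // ge_min lexx orbT.
exists (c + (((1 - t)%:C)%C) *: (z - c)); split.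
  rewrite eballE /= addrAC subrr add0r nsqZ.
  have [->|n0] := eqVneq (nsq (z - c)) 0; first by rewrite mulr0 exprn_gt0.
  have n1 : 0 < nsq (z - c) by rewrite lt_def n0 nsq_ge0.
  apply: lt_le_trans zr; rewrite gtr_pMl //.
  by rewrite expr_lt1 // ?subr_ge0 //; lra.
apply: eA; rewrite eballE /=.
have -> : c + (((1 - t)%:C)%C) *: (z - c) - z = - ((t%:C)%C *: (z - c)).
  rewrite rmorphB /= scalerBl scale1r addrA [c + (z - c)]addrC subrK.
  by rewrite addrAC subrr add0r.
rewrite nsqN nsqZ.
have : t ^+ 2 * nsq (z - c) <= (t * r) ^+ 2.
  by rewrite exprMn ler_wpM2l // sqr_ge0.
move/le_lt_trans; apply; rewrite ltr_pXn2r // ?nnegrE ?mulr_ge0 ?ltW //.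
by apply: lt_le_trans te; rewrite mulrA ltr_pMr ?mulr_gt0 // ltr1n.
Qed.

Lemma bd_eballE (c : 'C[R]^N) (r : R) : 0 < r -> bd (eball c r) = [set z | nsq (z - c) = r ^+ 2].
Proof.
move=> r0; rewrite /bd (interior_id _).1; last exact: open_eball.
rewrite closure_eballE // eballE; apply/seteqP; split=> z /=.
  by move=> [zr /negP]; rewrite -leNgt => rz; apply/eqP; rewrite eq_le zr.
by move=> zr; split; [rewrite zr | rewrite zr ltxx].
Qed.

Lemma compact_nsq_le (M : R) : compact [set z | nsq z <= M].
Proof.
(* [1 + M] dominates the square root of [M], hence each coordinate. *)
pose A (j : 'I_N) : set (Cplx R) :=
  (fun x : R * R => (Complex x.1 x.2 : Cplx R)) @`
     (`[- (1 + M), 1 + M] `*` `[- (1 + M), 1 + M]).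
have cA j : compact (A j).
  apply: continuous_compact; last first.
    by apply: compact_setX; exact: segment_compact.
  apply: continuous_subspaceT => x; apply: cvg_Complex; [exact: cvg_fst|exact: cvg_snd].
apply: subclosed_compact (rV_compact cA) _.
  apply: (@closed_comp _ _ nsq [set x | x <= M]); last exact: closed_le.
  by move=> z _; exact: continuous_nsq.
move=> z /= zM j; exists (complex.Re (z 0 j), complex.Im (z 0 j)); last by case: (z 0 j).
have nM : Normc.normc (z 0 j) <= 1 + M.
  have M0 : 0 <= M := le_trans (nsq_ge0 z) zM.
  rewrite -(@ler_pXn2r _ 2) ?nnegrE ?normc_ge0' ?addr_ge0 //.
  apply: (le_trans (normc_le_nsq z j)); apply: (le_trans zM); nra.
by split; rewrite /= in_itv /= -ler_norml; apply: le_trans nM; [exact: Re_le_normc | exact: Im_le_normc].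
Qed.

Lemma compact_bounded_closed (A : set 'C[R]^N) (M : R) :
  closed A -> (forall z, A z -> nsq z <= M) -> compact A.
Proof. by move=> cA AM; apply: (subclosed_compact cA (@compact_nsq_le M)) => z; exact: AM. Qed.

Lemma bounded_nsq (A : set 'C[R]^N) : bounded_set A ->
  exists M : R, forall z, A z -> nsq z <= M.
Proof.
move=> [M [Mr /(_ (M + 1))]]; rewrite ltrDl ltr01 => /(_ isT) AM.
have M1r : M + 1 \is Num.real by rewrite realD // real1.
have [m mE] := complex_realP _ M1r.
exists (\sum_(j < N) m ^+ 2) => z /AM; rewrite /= mE => zm.
have m0 : 0 <= m by rewrite -ler0c; apply: le_trans zm; exact: normr_ge0.
rewrite nsq_sum; apply: ler_sum => j _; rewrite ler_pXn2r ?nnegrE ?normc_ge0' //.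
rewrite -lecR -normE; apply: le_trans zm.
rewrite (_ : `|z| = mx_norm z) // mx_normE.
rewrite (_ : `|z 0 j| = (`|z 0 j|%:nng)%:num) // num_le.
exact: (@le_bigmax _ _ _ _ (fun i : 'I_1 * 'I_N => `|z i.1 i.2|%:nng) (0, j)).
Qed.

Lemma cvg_rline z v (x : R) :
  z + (t%:C)%C *: v @[t --> x] --> z + (x%:C)%C *: v.
Proof.
apply: cvg_row => j.
have -> : (fun t : R => (z + (t%:C)%C *: v) 0 j) = (fun t : R => z 0 j + (t%:C)%C * v 0 j).
  by apply/funext => t; rewrite !mxE.
rewrite !mxE; apply: cvgD; first exact: cvg_cst.
apply: cvgM; [exact: continuous_RtoC|exact: cvg_cst].
Qed.

End Hermitian.

Lemma cvg_affine {R : realType} {k N : nat} (p : 'C[R]^N) (A : 'M[Cplx R]_(k, N))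
    (T : Type) (F : set_system T) {FF : Filter F} (f : T -> 'C[R]^k) (l : 'C[R]^k) :
  f x @[x --> F] --> l -> (p + f x *m A) @[x --> F] --> p + l *m A.
Proof.
move=> fl; apply: cvg_row => j.
under eq_cvg do rewrite !mxE; rewrite !mxE; apply: cvgD; first exact: cvg_cst.
apply: cvg_bigsum => i; apply: cvgM; last exact: cvg_cst.
exact: (cvg_comp f (fun M : 'C[R]^k => M 0 i) fl (@coord_continuous _ _ _ 0 i l)).
Qed.

Lemma continuous_affine {R : realType} {k N : nat} (p : 'C[R]^N) (A : 'M[Cplx R]_(k, N)) :
  continuous (fun w : 'C[R]^k => p + w *m A).
Proof. by move=> w; exact: (@cvg_affine _ _ _ p A _ (nbhs w) _ id). Qed.

(** * Forms and determinants *)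

Section DetForms.
Context {R : realType} {N : nat}.
Local Notation C := (Cplx R).
Local Notation V := ('C[R]^N).

(** The wedge product of the 1-forms [g 0], ..., [g (n - 1)], when these are linear. *)
Definition detform (n : nat) (g : nat -> V -> C) : @Defs.form R N n :=
  fun v => \det (\matrix_(i < n, j < n) g i (v j)).
Arguments detform : clear implicits.

(** The sign is read off the determinant of a block diagonal permutation matrix. *)
Lemma block_permP (m n : nat) (s : 'S_m) (t : 'S_n) :
  exists p : 'S_(m + n),
    [/\ forall i, p (lshift n i) = lshift n (s i),
        forall j, p (rshift m j) = rshift m (t j)
      & (-1) ^+ p = (-1) ^+ s * (-1) ^+ t :> C].
Proof.
pose f (k : 'I_(m + n)) :=
  match fintype.split k with inl i => lshift n (s i) | inr j => rshift m (t j) end.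
have fl i : f (lshift n i) = lshift n (s i).
  by rewrite /f; case: split_ordP => [i' /lshift_inj ->|j /eqP] //; rewrite eq_lrshift.
have fr j : f (rshift m j) = rshift m (t j).
  by rewrite /f; case: split_ordP => [i /eqP|j' /rshift_inj ->] //; rewrite eq_rlshift.
have f_inj : injective f.
  move=> x y; case: (split_ordP x) => i ->; case: (split_ordP y) => j ->; rewrite ?fl ?fr.
  - by move/lshift_inj/perm_inj ->.
  - by move/eqP; rewrite eq_lrshift.
  - by move/eqP; rewrite eq_rlshift.
  - by move/rshift_inj/perm_inj ->.
exists (perm f_inj); split=> [i|j|]; rewrite ?permE //.
rewrite -!det_perm -(det_ublock _ 0); congr (\det _).
apply/matrixP => x y; rewrite [LHS]mxE [LHS]mxE permE.
case: (split_ordP x) => i ->; rewrite ?fl ?fr;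
  case: (split_ordP y) => j ->;
  rewrite ?block_mxEul ?block_mxEur ?block_mxEdl ?block_mxEdr;
  by rewrite ?eq_lshift ?eq_rshift ?eq_lrshift ?eq_rlshift !mxE.
Qed.

(** Once both determinants are expanded, each pair of permutations of the two blocks contributes the
    full determinant, by the substitution [s -> p * s] with [p] the block permutation. There are
    [m! n!] pairs, which cancels the normalization of [wedge]. *)
Lemma wedge_detform (m n : nat) (g h : nat -> V -> C) v :
  Defs.wedge (detform m g) (detform n h) v =
  detform (m + n) (fun k => if (k < m)%N then g k else h (k - m)%N) v.
Proof.
rewrite /Defs.wedge /detform.
set G := fun k : nat => if (k < m)%N then g k else h (k - m)%N.
have E (s : 'S_(m + n)) (a : 'S_m) (b : 'S_n) (p : 'S_(m + n)) :
    [/\ forall i, p (lshift n i) = lshift n (a i),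
        forall j, p (rshift m j) = rshift m (b j)
      & (-1) ^+ p = (-1) ^+ a * (-1) ^+ b :> C] ->
    (-1) ^+ s * (((-1) ^+ a * \prod_(i < m) g i (v (s (lshift n (a i))))) *
      ((-1) ^+ b * \prod_(j < n) h j (v (s (rshift m (b j)))))) =
    (-1) ^+ (p * s)%g * \prod_(i < m + n) G i (v ((p * s)%g i)) :> C.
  move=> [pl pr ps]; rewrite big_split_ord /= odd_permM signr_addb ps.
  have -> : \prod_(i < m) G (lshift n i) (v ((p * s)%g (lshift n i))) =
            \prod_(i < m) g i (v (s (lshift n (a i)))).
    by apply: eq_bigr => i _; rewrite permM pl /G /= ltn_ord.
  have -> : \prod_(i < n) G (rshift m i) (v ((p * s)%g (rshift m i))) =
            \prod_(j < n) h j (v (s (rshift m (b j)))).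
    by apply: eq_bigr => j _; rewrite permM pr /G /= ltnNge leq_addr addKn.
  by move: ((-1) ^+ s) ((-1) ^+ a) ((-1) ^+ b) (\prod_(i < m) _) (\prod_(i < n) _) => x1 x2 x3 x4 x5; ring.
have -> : \sum_(s : 'S_(m + n)) (-1) ^+ s *
   (\det (\matrix_(i < m, j < m) g i (v (s (lshift n j)))) *
    \det (\matrix_(i < n, j < n) h i (v (s (rshift m j))))) =
   \sum_(a : 'S_m) \sum_(b : 'S_n) \det (\matrix_(i < m + n, j < m + n) G i (v j)).
  under eq_bigr => s _.
    rewrite /determinant big_distrl mulr_sumr /=.
    under eq_bigr => a _.
      rewrite mulr_sumr mulr_sumr /=.
      under eq_bigr => b _.
        under eq_bigr => i _ do rewrite mxE.
        under [X in _ * (_ * (_ * X))]eq_bigr => i _ do rewrite mxE.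
        over.
      over.
    over.
  rewrite exchange_big /=; apply: eq_bigr => a _.
  rewrite exchange_big /=; apply: eq_bigr => b _.
  have [p Hp] := block_permP a b.
  under eq_bigr => s _ do rewrite (E s a b p Hp).
  rewrite /determinant [RHS](reindex_inj (mulgI p)) /=.
  apply: eq_bigr => s _; congr (_ * _).
  by apply: eq_bigr => i _; rewrite mxE.
rewrite !big_const !card_Sn !iter_addr_0 -mulrnA mulrnAr mulnC -mulr_natr mulrAC.
by rewrite mulVf ?mul1r // pnatr_eq0 -lt0n muln_gt0 !fact_gt0.
Qed.

Lemma wedge_suml m n (I : Type) (r : seq I) (P : pred I) (c : I -> C)
    (a : I -> @Defs.form R N m) (b : @Defs.form R N n) v :
  Defs.wedge (fun w => \sum_(i <- r | P i) c i * a i w) b v =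
  \sum_(i <- r | P i) c i * Defs.wedge (a i) b v.
Proof.
rewrite /Defs.wedge; under [RHS]eq_bigr => i _ do rewrite mulrCA mulr_sumr.
rewrite -mulr_sumr exchange_big /=; congr (_ * _); apply: eq_bigr => s _.
rewrite big_distrl mulr_sumr /=; apply: eq_bigr => i _; move: ((-1) ^+ s) => x1; ring.
Qed.

Lemma wedge_sumr m n (I : Type) (r : seq I) (P : pred I) (c : I -> C)
    (a : @Defs.form R N m) (b : I -> @Defs.form R N n) v :
  Defs.wedge a (fun w => \sum_(i <- r | P i) c i * b i w) v =
  \sum_(i <- r | P i) c i * Defs.wedge a (b i) v.
Proof.
rewrite /Defs.wedge; under [RHS]eq_bigr => i _ do rewrite mulrCA mulr_sumr.
rewrite -mulr_sumr exchange_big /=; congr (_ * _); apply: eq_bigr => s _.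
rewrite !mulr_sumr /=; apply: eq_bigr => i _; move: ((-1) ^+ s) => x1; ring.
Qed.

End DetForms.
Arguments detform {R N} n g v.

Lemma eq_detform {R : realType} {N : nat} m (g h : nat -> 'C[R]^N -> Cplx R) v :
  (forall i w, (i < m)%N -> g i w = h i w) -> detform m g v = detform m h v.
Proof.
by move=> gh; congr (\det _); apply/matrixP => i j; rewrite !mxE gh.
Qed.

Section TypedForms.
Context {R : realType} {n : nat}.
Local Notation C := (Cplx R).
Local Notation V := ('C[R]^(n.+1)).
Variables (a : 'I_n.+1 -> C) (b : 'I_n.+1 -> 'I_n.+1 -> C).

Definition form01 : @Defs.form R n.+1 1 := fun vs => \sum_l a l * dzbar l vs.
Definition form11 : @Defs.form R n.+1 2 :=
  fun vs => \sum_k \sum_l b k l * Defs.wedge (dz k) (dzbar l) vs.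

Definition acoef (x : V) : C := \sum_l a l * x 0 l.
Definition bcoef k (x : V) : C := \sum_l b k l * x 0 l.
Definition conjv (v : V) : V := map_mx (fun x => x^*) v.

(** The rows of the determinant of the product of the [dz_k /\ eta_k] for [k] in [kappa], where
    [eta_k] is the sum of the [b k l dzbar_l]: even rows carry [dz], odd rows [eta]. The argument is
    a pair whose second entry stands for the conjugate of the first, so that all rows are complex
    linear and can be polarized. *)
Definition prow (kappa : seq 'I_n.+1) (i : nat) (z : V * V) : C :=
  if odd i then bcoef (nth ord0 kappa i./2) z.2
  else z.1 0 (nth ord0 kappa i./2).
Definition orow (kappa : seq 'I_n.+1) (i : nat) (z : V * V) : C :=
  if i is i'.+1 then prow kappa i' z else acoef z.2.

Definition realpt (v : V) : V * V := (v, conjv v).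

Lemma form11E vs : form11 vs =
  \sum_k detform 2 (fun i v => prow [:: k] i (realpt v)) vs.
Proof.
apply: eq_bigr => k _.
transitivity (Defs.wedge (dz k) (fun w => \sum_l b k l * dzbar l w) vs).
  by rewrite wedge_sumr.
have -> : @dz R n.+1 k = detform 1 (fun _ v => v 0 k).
  by apply/funext => v; rewrite /detform det_mx11 mxE.
have -> : (fun w => \sum_l b k l * dzbar l w) =
          detform 1 (fun _ v => bcoef k (conjv v)).
  apply/funext => v; rewrite /detform det_mx11 mxE.
  by apply: eq_bigr => l _; rewrite mxE.
rewrite wedge_detform; by apply: eq_detform => -[|[|i]].
Qed.

Lemma big_tuple_cons q (F : seq 'I_n.+1 -> C) :
  \sum_(t : q.+1.-tuple 'I_n.+1) F t =
  \sum_k \sum_(t : q.-tuple 'I_n.+1) F (k :: t).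
Proof.
rewrite pair_bigA /= (reindex (fun p : 'I_n.+1 * q.-tuple 'I_n.+1 => [tuple of p.1 :: p.2])) //=.
exists (fun t : q.+1.-tuple _ => (thead t, [tuple of behead t])) => [[k t] _|t _] /=.
  by congr (_, _); apply: val_inj.
by rewrite [RHS]tuple_eta; apply: val_inj.
Qed.

(** [form11] is the sum of the [dz_k /\ eta_k], so its power is the sum over all tuples of indices;
    those with a repetition give zero determinants. *)
Lemma wedge_pow_form11 q vs : wedge_pow form11 q vs =
  \sum_(t : q.-tuple 'I_n.+1) detform (q * 2) (fun i v => prow t i (realpt v)) vs.
Proof.
elim: q vs => [|q IH] vs.
  rewrite (eq_bigr (fun=> 1)) => [|t _]; last by rewrite /detform det_mx00.
  by rewrite sumr_const card_tuple expn0.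
rewrite /= (_ : wedge_pow form11 q = fun w => \sum_(t : q.-tuple 'I_n.+1)
   1 * detform (q * 2) (fun i v => prow t i (realpt v)) w); last first.
  by apply/funext => w; rewrite IH; apply: eq_bigr => t _; rewrite mul1r.
rewrite wedge_sumr (_ : form11 = fun w => \sum_k
   1 * detform 2 (fun i v => prow [:: k] i (realpt v)) w); last first.
  by apply/funext => w; rewrite form11E; apply: eq_bigr => t _; rewrite mul1r.
rewrite (big_tuple_cons q (fun t => detform (q.+1 * 2) (fun i v => prow t i (realpt v)) vs)).
rewrite exchange_big /=; apply: eq_bigr => t _; rewrite mul1r wedge_suml.
apply: eq_bigr => k _; rewrite mul1r wedge_detform; apply: eq_detform => i v _; case: ltnP => [|i2]; first by case: i => [|[|i]].
by rewrite -(subnKC i2) addKn /prow !addSn add0n /= negbK.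
Qed.

Lemma omegaE q vs : Defs.wedge form01 (wedge_pow form11 q) vs =
  \sum_(t : q.-tuple 'I_n.+1) detform (1 + q * 2) (fun i v => orow t i (realpt v)) vs.
Proof.
rewrite (_ : wedge_pow form11 q = fun w => \sum_(t : q.-tuple 'I_n.+1)
   1 * detform (q * 2) (fun i v => prow t i (realpt v)) w); last first.
  by apply/funext => w; rewrite wedge_pow_form11; apply: eq_bigr => t _; rewrite mul1r.
rewrite wedge_sumr; apply: eq_bigr => t _; rewrite mul1r.
have -> : form01 = detform 1 (fun _ v => acoef (conjv v)).
  apply/funext => v; rewrite /detform det_mx11 mxE.
  by apply: eq_bigr => l _; rewrite mxE.
rewrite wedge_detform; by apply: eq_detform => -[|i] v _ //=; rewrite subSS subn0.
Qed.

(* The rows of each determinant of omegaE with antilinear entries (alpha and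
   the eta's, q + 1 of them) live in a q-dimensional space. *)
Lemma omega_vanish q (A : 'M[C]_(n.+1 - q, n.+1)) : (q <= n.+1)%N -> row_free A ->
  (forall i, acoef (conjv (row i A)) = 0) ->
  (forall i k, bcoef k (conjv (row i A)) = 0) ->
  forall vs, Defs.wedge form01 (wedge_pow form11 q) vs = 0.
Proof.
move=> qn Afree aA bA vs; rewrite omegaE big1 // => t _; rewrite /detform.
set M := \matrix_(i, j) _; apply/eqP; rewrite -[_ == 0]negbK -unitfE -unitmxE.
apply/negP => /mxrank_unit Mrank.
pose Ac : 'M[C]_(n.+1, n.+1 - q) := map_mx (fun x => x^*) A^T.
pose W : 'M[C]_(n.+1, 1 + q * 2) := \matrix_(l, j) (conjv (vs j)) 0 l.
pose X : 'M[C]_(q, 1 + q * 2) := \matrix_(i, j) vs j 0 (tnth t i).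
have rAc : \rank Ac = (n.+1 - q)%N.
  by rewrite mxrank_map mxrank_tr; apply/eqP.
have rk : (\rank (kermx Ac *m W) <= q)%N.
  apply: leq_trans (mxrankM_maxl _ _) _; rewrite mxrank_ker rAc; lia.
have anti (c : 'rV[C]_n.+1) : c *m Ac = 0 ->
    (c *m W <= X + kermx Ac *m W)%MS.
  move=> cA; apply: submx_trans (addsmxSr _ _); apply: submxMr.
  by apply/sub_kermxP.
have MS : (M <= X + kermx Ac *m W)%MS.
  apply/row_subP => i.
  case: i => -[|i] Hi.
    rewrite (_ : row _ M = (\row_l a l) *m W); last first.
      apply/rowP => j; rewrite !mxE /=; apply: eq_bigr => l _; by rewrite !mxE.
    apply: anti; apply/rowP => j; rewrite !mxE -[RHS](aA j).
    by apply: eq_bigr => l _; rewrite !mxE.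
  have iq : (i./2 < q)%N by move: Hi; rewrite add1n ltnS; lia.
  have tE : nth ord0 t i./2 = tnth t (Ordinal iq) by rewrite (tnth_nth ord0).
  case Hodd: (odd i).
    rewrite (_ : row _ M = (\row_l b (tnth t (Ordinal iq)) l) *m W); last first.
      apply/rowP => j; rewrite !mxE /= /prow Hodd tE.
      by apply: eq_bigr => l _; rewrite !mxE.
    apply: anti; apply/rowP => j; rewrite !mxE -[RHS](bA j (tnth t (Ordinal iq))).
    by apply: eq_bigr => l _; rewrite !mxE.
  rewrite (_ : row _ M = row (Ordinal iq) X).
    by apply: submx_trans (addsmxSl _ _); exact: row_sub.
  by apply/rowP => j; rewrite !mxE /= /prow Hodd tE.
(* The [q] rows carrying [dz] and the antilinear ones span at most [q + q] dimensions, one fewer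
   than the size of [M]. *)
have := mxrankS MS; rewrite Mrank => /leq_trans/(_ (mxrank_adds_leqif _ _)).
have := rank_leq_row X; lia.
Qed.

End TypedForms.

Lemma det_col_lin (K : comPzRingType) m (A B E : 'M[K]_m) j0 (b c : K) :
  (forall i, A i j0 = b * B i j0 + c * E i j0) ->
  (forall i j, j != j0 -> A i j = B i j) -> (forall i j, j != j0 -> A i j = E i j) ->
  \det A = b * \det B + c * \det E.
Proof.
move=> Aj AB AE; rewrite -(det_tr A) -(det_tr B) -(det_tr E).
apply: (determinant_multilinear (i0 := j0)).
- by apply/rowP => i; rewrite !mxE Aj.
- by apply/matrixP => k i; rewrite !mxE AB // eq_sym neq_lift.
- by apply/matrixP => k i; rewrite !mxE AE // eq_sym neq_lift.
Qed.

Section Polarization.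
Context {R : realType} {n : nat}.
Local Notation C := (Cplx R).
Local Notation V := ('C[R]^(n.+1)).
Variables (a : 'I_n.+1 -> C) (b : 'I_n.+1 -> 'I_n.+1 -> C).

Lemma orow_lin t i (z z' : V * V) (c : C) :
  orow a b t i (z.1 + c *: z'.1, z.2 + c *: z'.2) = orow a b t i z + c * orow a b t i z'.
Proof.
have lin (f : 'I_n.+1 -> C) (x y : V) : \sum_l f l * (x + c *: y) 0 l =
    \sum_l f l * x 0 l + c * \sum_l f l * y 0 l.
  by rewrite mulr_sumr -big_split; apply: eq_bigr => l _; rewrite !mxE /=; ring.
case: i => [|i] /=; first exact: lin.
by rewrite /prow; case: ifP => _; [exact: lin | rewrite !mxE].
Qed.

(* (x, y) = (v, conj v) + i (w, conj w), so a family of C-multilinear functions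
   vanishing on the real points (v, conj v) vanishes. *)
Lemma polarize q :
  (forall vs, \sum_(t : q.-tuple 'I_n.+1)
     \det (\matrix_(i < 1 + q * 2, j < 1 + q * 2) orow a b t i (realpt (vs j))) = 0) ->
  forall zs, \sum_(t : q.-tuple 'I_n.+1)
     \det (\matrix_(i < 1 + q * 2, j < 1 + q * 2) orow a b t i (zs j)) = 0.
Proof.
move=> H0.
(* Slots below [m] hold arbitrary pairs and the others real points; the induction on [m] polarizes
   one slot at a time. *)
suff H m : forall zs : 'I_(1 + q * 2) -> V * V,
   (forall j : 'I_(1 + q * 2), (m <= j)%N -> zs j = realpt (zs j).1) ->
   \sum_(t : q.-tuple 'I_n.+1)
     \det (\matrix_(i < 1 + q * 2, j < 1 + q * 2) orow a b t i (zs j)) = 0.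
  move=> zs; apply: (H (1 + q * 2)%N) => j; by rewrite leqNgt ltn_ord.
elim: m => [|m IH] zs Hzs.
  rewrite -[RHS](H0 (fun j => (zs j).1)); apply: eq_bigr => t _; congr (\det _).
  by apply/matrixP => i j; rewrite !mxE {1}Hzs.
have [mlt|mge] := ltnP m (1 + q * 2); last first.
  by apply: IH => j /(leq_trans mge); rewrite leqNgt ltn_ord.
pose j0 := Ordinal mlt.
pose x := (zs j0).1; pose y := (zs j0).2.
pose v := 2^-1 *: (x + conjv y); pose w := (2 * 'i)^-1 *: (x - conjv y).
pose upd (u : V) (j : 'I_(1 + q * 2)) := if j == j0 then realpt u else zs j.
have i0 : ('i : C) != 0 by exact: neq0Ci.
have zsE : zs j0 = ((realpt v).1 + 'i *: (realpt w).1, (realpt v).2 + 'i *: (realpt w).2).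
  rewrite [LHS]surjective_pairing -/x -/y; congr (_, _).
    apply/rowP => l; rewrite !mxE; field; exact: i0.
  have c1 : (2^-1 : C)^* = 2^-1 by rewrite fmorphV rmorph_nat.
  have c2 : ((2 * 'i)^-1 : C)^* = - (2 * 'i)^-1.
    rewrite fmorphV -invrN; congr (_^-1).
    by apply: eqCplx; rewrite ?cRe_conj ?cIm_conj ?cReN ?cImN ?cReM ?cImM ?cRe_i ?cIm_i /=; ring.
  apply/rowP => l; rewrite !mxE !cconjM c1 c2 !cconjD cconjN cconjK.
  by field; exact: i0.
clearbody v w.
have updR (u : V) : \sum_(t : q.-tuple 'I_n.+1)
     \det (\matrix_(i < 1 + q * 2, j < 1 + q * 2) orow a b t i (upd u j)) = 0.
  apply: IH => j mj; rewrite /upd; case: eqP => // /eqP jj0; apply: Hzs.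
  by rewrite ltn_neqAle mj andbT; apply: contra jj0 => /eqP mE; apply/eqP/val_inj.
pose M (t : seq 'I_n.+1) (u : V) :=
  \matrix_(i < 1 + q * 2, j < 1 + q * 2) orow a b t i (upd u j).
have ME t u i j : M t u i j = orow a b t i (upd u j) by rewrite mxE.
have updj u : upd u j0 = realpt u by rewrite /upd eqxx.
have updn u j : j != j0 -> upd u j = zs j by move=> /negbTE jj0; rewrite /upd jj0.
move: M ME => M ME.
transitivity (\sum_(t : q.-tuple 'I_n.+1) \det (M t v) +
              'i * \sum_(t : q.-tuple 'I_n.+1) \det (M t w)).
  rewrite mulr_sumr -big_split /=; apply: eq_bigr => t _.
  rewrite -[X in _ = X + _]mul1r; apply: (det_col_lin (j0 := j0)) => [i|i j jj0|i j jj0].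
  - rewrite !ME !updj mxE zsE mul1r.
    exact: (orow_lin t i (realpt v) (realpt w)).
  - by rewrite ME mxE updn.
  - by rewrite ME mxE updn.
have updR' u : \sum_(t : q.-tuple 'I_n.+1) \det (M t u) = 0.
  rewrite -[RHS](updR u); apply: eq_bigr => t _; congr (\det _).
  by apply/matrixP => i j; rewrite ME mxE.
by rewrite !updR' mulr0 addr0.
Qed.

(** Multiplication by [cokermx ar] is the passage to the quotient by the line of [ar]. There [E] has
    rank [n], and [n] independent rows of the image lift to rows completing [ar]. *)
Lemma complete_row (ar : V) (E : 'M[C]_n.+1) : ar != 0 -> row_full (col_mx ar E) ->
  exists2 k0 : 'I_n -> 'I_n.+1, injective k0 & col_mx ar (rowsub k0 E) \in unitmx.
Proof.
move=> a0 full; pose E' := E *m cokermx ar.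
have rE' : \rank E' = n.
  have rc : \rank (cokermx ar) = n.
    by rewrite mxrank_coker rank_rV a0 subn1.
  have : \rank (col_mx ar E *m cokermx ar) = \rank (cokermx ar).
    by rewrite (eqmxMfull _ full).
  rewrite mul_col_mx mulmx_coker rc => H; rewrite -[RHS]H.
  by rewrite -addsmxE adds0mx.
have := maxrowsub_free E'; have := @maxrankfun_inj _ _ _ E'.
move: (maxrankfun E'); rewrite rE' => k0 k0inj k0free.
exists k0 => //; rewrite -row_free_unit.
rewrite -kermx_eq0 -submx0; apply/row_subP => i; set c := row i _.
have : c *m col_mx ar (rowsub k0 E) = 0.
  by apply/sub_kermxP; exact: row_sub.
rewrite -[c]hsubmxK mul_row_col => cE.
have c2 : rsubmx c = 0.
  apply: (row_free_inj k0free); rewrite mul0mx.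
  have : (lsubmx c *m ar + rsubmx c *m rowsub k0 E) *m cokermx ar = 0.
    by rewrite cE mul0mx.
  rewrite mulmxDl -mulmxA mulmx_coker mulmx0 add0r -mulmxA => <-.
  congr (_ *m _); apply/matrixP => r s; rewrite !mxE.
  by apply: eq_bigr => l _; rewrite [rowsub k0 E r l]mxE.
move: cE; rewrite c2 mul0mx addr0 [lsubmx c]mx11_scalar mul_scalar_mx => /eqP.
by rewrite scaler_eq0 (negbTE a0) orbF => /eqP ->; rewrite raddf0 row_mx0 sub0mx.
Qed.

End Polarization.

(** * Common kernel of the coefficients of a vanishing top product *)

Section Kernel.
Context {R : realType} {n : nat}.
Local Notation C := (Cplx R).
Local Notation V := ('C[R]^(n.+1)).
Variables (a : 'I_n.+1 -> C) (b : 'I_n.+1 -> 'I_n.+1 -> C).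

Let D (zs : 'I_(1 + n * 2) -> V * V) (t : seq 'I_n.+1) : C :=
  \det (\matrix_(i < 1 + n * 2, j < 1 + n * 2) orow a b t i (zs j)).

Fact slot_lt (e : bool) (r : 'I_n) : (1 + (e + r.*2) < 1 + n * 2)%N.
Proof. by case: r => r rn; case: e => /=; lia. Qed.
(** The row that holds [dz] ([e] false) or [eta] ([e] true) of the [r]-th index; row 0 is taken by
    the (0,1)-form. *)
Definition slot (e : bool) (r : 'I_n) : 'I_(1 + n * 2) := Ordinal (slot_lt e r).

Lemma slotP (i : 'I_(1 + n * 2)) : i = ord0 \/ exists e r, i = slot e r.
Proof.
case: i => -[|i] Hi; first by left; apply: val_inj.
have rn : (i./2 < n)%N by lia.
by right; exists (odd i), (Ordinal rn); apply: val_inj; rewrite /= odd_double_half.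
Qed.

Lemma orow_slot (t : n.-tuple 'I_n.+1) e r z : orow a b t (slot e r) z =
  if e then bcoef b (tnth t r) z.2 else z.1 0 (tnth t r).
Proof.
have H1 : odd (e + r.*2) = e by rewrite oddD odd_double addbF; case: e.
have H2 : (e + r.*2)./2 = r by rewrite half_bit_double.
change (orow a b t (slot e r) z) with (prow b t (e + r.*2) z).
by rewrite /prow H1 H2 (tnth_nth ord0).
Qed.

Lemma slot_eq e e' r r' : (slot e r == slot e' r') = (e == e') && (r == r').
Proof.
apply/eqP/andP => [/(congr1 val) /= [H]|[/eqP-> /eqP->] //].
have Heo : e = e' by move/(congr1 odd): H; rewrite !oddD !odd_double !addbF; case: e e' => [] [].
by subst e'; rewrite eqxx; split=> //; apply/eqP/val_inj => /=; lia.
Qed.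

Lemma slot_neq0 e r : (slot e r == ord0) = false.
Proof. by apply/eqP => /(congr1 val). Qed.

Lemma det_xrow m (M : 'M[C]_m) i1 i2 : i1 != i2 -> \det (xrow i1 i2 M) = - \det M.
Proof. by move=> i12; rewrite xrowE det_mulmx det_perm odd_tperm i12 expr1 mulN1r. Qed.

(* Two exchanges of rows, hence no sign. *)
Lemma D_tperm zs (t : n.-tuple 'I_n.+1) (r s : 'I_n) : r != s ->
  D zs [tuple tnth t (tperm r s i) | i < n] = D zs t.
Proof.
move=> rs; rewrite /D; set M := \matrix_(i, j) orow a b t i (zs j).
rewrite -[RHS]opprK -(det_xrow M (i1 := slot false r) (i2 := slot false s)); last first.
  by rewrite slot_eq (negbTE rs) andbF.
rewrite -(det_xrow _ (i1 := slot true r) (i2 := slot true s)); last first.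
  by rewrite slot_eq (negbTE rs) andbF.
congr (\det _); apply/matrixP => i j; rewrite ![in RHS]mxE [LHS]mxE.
have tpn (e : bool) (k : 'I_(1 + n * 2)) : k != slot e r -> k != slot e s ->
    tperm (slot e r) (slot e s) k = k.
  by move=> k1 k2; rewrite tpermD // eq_sym.
case: (slotP i) => [->|[e [u ->]]].
  by rewrite !tpn // eq_sym slot_neq0.
have sE : tperm (slot false r) (slot false s) (tperm (slot true r) (slot true s) (slot e u))
    = slot e (tperm r s u).
  have tp f : tperm (slot f r) (slot f s) (slot f u) = slot f (tperm r s u).
    by rewrite !permE /= !slot_eq !eqxx /=; case: ifP => // _; case: ifP.
  case: e; first by rewrite (tp true) tpn // slot_eq.
  by rewrite [X in tperm _ _ X]tpn ?slot_eq // (tp false).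
by rewrite sE !orow_slot !tnth_mktuple.
Qed.

Lemma D_perm zs (t : n.-tuple 'I_n.+1) (s : 'S_n) :
  D zs [tuple tnth t (s i) | i < n] = D zs t.
Proof.
have [ts -> {s}] := prod_tpermP s.
elim: ts t => [|[r s] ts IH] t.
  move=> _; suff -> : [tuple tnth t ((\prod_(j <- [::]) tperm j.1 j.2)%g i) | i < n] = t by [].
  by apply: eq_from_tnth => i; rewrite big_nil tnth_mktuple perm1.
case/andP => rs Hts.
set t' := [tuple tnth t ((\prod_(j <- ts) tperm j.1 j.2)%g i) | i < n].
rewrite -(IH t Hts) -/t' -(D_tperm zs t' rs).
suff -> : [tuple tnth t ((\prod_(j <- (r, s) :: ts) tperm j.1 j.2)%g i) | i < n] =
          [tuple tnth t' (tperm r s i) | i < n] by [].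
by apply: eq_from_tnth => i; rewrite big_cons !tnth_mktuple permM.
Qed.

(** If the kernel were trivial, [n] rows of [b] would complete [a] to a basis. On vectors dual to
    it, the determinant of a tuple is 1 if the tuple permutes the chosen rows and 0 otherwise, so
    the sum of the determinants is positive. *)
Lemma omega_kernel :
  (forall vs, Defs.wedge (form01 a) (wedge_pow (form11 b) n) vs = 0) ->
  (exists l, a l != 0) ->
  exists2 y : V, y != 0 & acoef a y = 0 /\ forall k, bcoef b k y = 0.
Proof.
move=> H0 [l0 al0].
have /polarize HP : forall vs, \sum_(t : n.-tuple 'I_n.+1)
     \det (\matrix_(i < 1 + n * 2, j < 1 + n * 2) orow a b t i (realpt (vs j))) = 0.
  by move=> vs; rewrite -[RHS](H0 vs) omegaE.
pose ar : V := \row_l a l; pose E : 'M[C]_n.+1 := \matrix_(k, l) b k l.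
have ar0 : ar != 0 by apply: contra al0 => /eqP/rowP/(_ l0); rewrite !mxE => ->.
have [full|notfull] := boolP (row_full (col_mx ar E)); last first.
  have : kermx (col_mx ar E)^T != 0.
    by rewrite kermx_eq0 -row_leq_rank mxrank_tr -ltnNge ltn_neqAle notfull rank_leq_col.
  case/rowV0Pn => y /sub_kermxP yK y0; exists y => //.
  move: yK; rewrite tr_col_mx mul_mx_row -(row_mx0 C 1 1 n.+1) => /eq_row_mx[y1 y2].
  split=> [|k].
    have /rowP/(_ 0) := y1; rewrite !mxE => <-.
    by apply: eq_bigr => l _; rewrite !mxE mulrC.
  have /rowP/(_ k) := y2; rewrite !mxE => <-.
  by apply: eq_bigr => l _; rewrite !mxE mulrC.
have [k0 k0inj] := complete_row ar0 full.
set U := col_mx _ _ => Uunit.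
pose Y : 'M[C]_n.+1 := invmx (U : 'M[C]_n.+1).
have UY : (U : 'M[C]_n.+1) *m Y = 1%:M by rewrite mulmxV.
pose yc (i : 'I_n.+1) : V := (col i Y)^T.
have Ua l : (U : 'M[C]_n.+1) ord0 l = a l.
  have e0 : (ord0 : 'I_(1 + n)) = @lshift 1 n 0 by apply: val_inj.
  by rewrite e0 [LHS]col_mxEu mxE.
have Ub r l : (U : 'M[C]_n.+1) (lift ord0 r) l = b (k0 r) l.
  have e0 : (lift ord0 r : 'I_(1 + n)) = @rshift 1 n r by apply: val_inj.
  by rewrite e0 [LHS]col_mxEd mxE mxE.
have aY i : acoef a (yc i) = (ord0 == i)%:R.
  have /matrixP/(_ ord0 i) := UY; rewrite mxE [in RHS]mxE => <-.
  by apply: eq_bigr => l _; rewrite Ua !mxE.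
have bY r i : bcoef b (k0 r) (yc i) = (lift ord0 r == i)%:R.
  have /matrixP/(_ (lift ord0 r) i) := UY; rewrite mxE [in RHS]mxE => <-.
  by apply: eq_bigr => l _; rewrite Ub !mxE.
pose K0 := [tuple k0 i | i < n].
(* Each slot receives the vector dual to its own row, in the entry which that row reads and with 0
   in the other one; polarization is what makes such pairs admissible. The default [(0, 0)] is never
   reached. *)
pose zs (j : 'I_(1 + n * 2)) : V * V :=
  if j == ord0 then (0, yc ord0) else
  match [pick er : bool * 'I_n | j == slot er.1 er.2] with
  | Some er => if er.1 then (0, yc (lift ord0 er.2)) else (delta_mx 0 (k0 er.2), 0)
  | None => (0, 0)
  end.
have zsS e r : zs (slot e r) = if e then (0, yc (lift ord0 r)) else (delta_mx 0 (k0 r), 0).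
  rewrite /zs slot_neq0; case: pickP => [[e' r'] /=|/(_ (e, r))]; last by rewrite /= eqxx.
  by rewrite slot_eq => /andP[/eqP <- /eqP <-].
have zs0 : zs ord0 = (0, yc ord0) by [].
have a0 : acoef a 0 = 0 by rewrite /acoef big1 // => l _; rewrite mxE mulr0.
have b0 k : bcoef b k 0 = 0 by rewrite /bcoef big1 // => l _; rewrite mxE mulr0.
have D1 : D zs K0 = 1.
  rewrite -(det1 C (1 + n * 2)); congr (\det _); apply/matrixP => i j; rewrite !mxE.
  case: (slotP i) => [->|[e [r ->]]]; case: (slotP j) => [->|[e' [r' ->]]].
  - by rewrite zs0 /= aY.
  - rewrite zsS eq_sym slot_neq0 /=; case: e' => /=; last by rewrite a0.
    by rewrite aY.
  - rewrite slot_neq0 zs0 orow_slot tnth_mktuple /=; case: e; last by rewrite mxE.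
    by rewrite bY.
  - rewrite orow_slot tnth_mktuple slot_eq zsS; case: e; case: e' => /=.
    + by rewrite bY (inj_eq lift_inj).
    + by rewrite b0.
    + by rewrite mxE.
    + by rewrite mxE eqxx /= (inj_eq k0inj).
have K0uniq : uniq K0 by rewrite map_inj_uniq ?enum_uniq.
have D01 (t : n.-tuple 'I_n.+1) : D zs t = (perm_eq t K0)%:R.
  case: (boolP (perm_eq t K0)) => [/tuple_permP[s ts]|Nperm] /=.
    by rewrite -D1 -(D_perm zs K0 s) ts.
  have [tu|/(uniqPn ord0)[r [s [rs st trs]]]] := boolP (uniq t); last first.
    rewrite size_tuple in st; have rn := ltn_trans rs st.
    apply: (determinant_alternate (i1 := slot false (Ordinal rn)) (i2 := slot false (Ordinal st))).
      by rewrite slot_eq -(inj_eq val_inj) /= ltn_eqF.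
    by move=> j; rewrite mxE [RHS]mxE !orow_slot !(tnth_nth ord0) /= trs.
  (* An index outside [K0] makes its [dz] row vanish at every [zs j]. *)
  have [r Hr] : exists r, tnth t r \notin K0.
    apply: contrapT => /forallNP H; case/negP: Nperm.
    have tK : {subset t <= K0}.
      by move=> x /tnthP[r ->]; apply/negPn/negP; exact: H.
    have [_ eqtK] := uniq_min_size tu tK (eq_leq (etrans (size_tuple K0) (esym (size_tuple t)))).
    exact: uniq_perm.
  rewrite /D (expand_det_row _ (slot false r)) big1 // => j _; rewrite mxE orow_slot.
  suff -> : (zs j).1 0 (tnth t r) = 0 by rewrite mul0r.
  case: (slotP j) => [->|[e' [r' ->]]]; first by rewrite zs0 mxE.
  rewrite zsS; case: e'; rewrite mxE //=.
  case: eqP => // trE; case/negP: Hr; rewrite trE.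
  by apply/tnthP; exists r'; rewrite tnth_mktuple.
have : D zs K0 = 0.
  apply: (psumr_eq0P (P := xpredT) (F := fun t : n.-tuple 'I_n.+1 => D zs t)) => //.
    by move=> t _; rewrite D01 ler0n.
  exact: HP.
by move=> D0; move: (etrans (esym D0) D1) => /eqP; rewrite eq_sym oner_eq0.
Qed.

End Kernel.

(** * Real differential calculus *)

Section OneVariable.
Context {R : realType}.
Implicit Types (f g : R -> R).

Lemma is_derive_quot f (x l : R) : is_derive x (1 : R) f l ->
  forall e, 0 < e -> exists2 d, 0 < d &
    forall t, `|t| < d -> `|f (x + t) - f x - t * l| <= e * `|t|.
Proof.
move=> [df <-] e e0.
have /cvgrPdist_le/(_ _ e0) : (fun h : R => h^-1 *: ((f \o shift x) (h *: 1) - f x)) @ 0^' --> 'D_1 f x.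
  exact: df.
case=> d /= d0 H; exists d => // t td.
have [->|t0] := eqVneq t 0; first by rewrite addr0 subrr mul0r subrr normr0 mulr0.
have := H t; rewrite /ball_ /= sub0r normrN => /(_ td t0).
rewrite [t *: 1]mulr1 [t + x]addrC => Ht.
have -> : f (x + t) - f x - t * 'D_1 f x = - (t * ('D_1 f x - t^-1 *: (f (x + t) - f x))).
  rewrite mulrBr [_ *: _]/(_ * _) mulrA divff // mul1r; ring.
by rewrite normrN normrM mulrC ler_wpM2r.
Qed.

Lemma second_derivative_max f (df : R -> R) (l d : R) : 0 < d ->
  (forall t : R, `|t| < d -> is_derive t (1 : R) f (df t)) ->
  is_derive (0 : R) (1 : R) df l ->
  (forall t, `|t| < d -> f t <= f 0) -> df 0 = 0 /\ l <= 0.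
Proof.
move=> d0 fdf dfl fmax.
have in_d t : t \in `]- d, d[%R -> `|t| < d by rewrite in_itv /= ltr_norml.
have df0 : df 0 = 0.
  have dd : - d <= d by rewrite ge0_cp // ltW.
  have c0 : (0 : R) \in `](- d), d[%R by rewrite in_itv /= oppr_lt0 d0.
  have H1 : forall t, t \in `](- d), d[%R -> derivable f t 1.
    by move=> t /in_d /fdf [].
  have H2 : forall t, t \in `](- d), d[%R -> f t <= f 0 by move=> t /in_d /fmax.
  have [_ E0] := derive1_at_max dd H1 c0 H2.
  by have := fdf 0; rewrite normr0 => /(_ d0)[_ <-].
(* If [l > 0] then [df c >= l / 2 * c > 0] just to the right of 0, and by the mean value theorem [f]
   rises above [f 0]. *)
split=> //; rewrite leNgt; apply/negP => l0.
have [e e0 He] := is_derive_quot dfl (divr_gt0 l0 (ltr0n R 2)).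
pose t := Num.min (d / 2) (e / 2).
have t0 : 0 < t by rewrite lt_min !divr_gt0.
have td : t < d by rewrite gt_min ltr_pdivrMr // mulr_natr mulr2n ltrDl d0.
have te : t < e by rewrite gt_min; apply/orP; right; rewrite ltr_pdivrMr // mulr_natr mulr2n ltrDl.
have [c] : exists2 c, c \in `]0, t[%R & f t - f 0 = df c * (t - 0).
  apply: MVT => // [x|].
    rewrite in_itv /= => /andP[x0 xt]; apply: fdf.
    by rewrite gtr0_norm // (lt_trans xt).
  apply: derivable_within_continuous => x; rewrite in_itv /= => /andP[x0 xt].
  have [] := fdf x _ => //.
  by rewrite ger0_norm // (le_lt_trans xt).
rewrite in_itv /= subr0 => /andP[c0 ct] fE.
have : f t - f 0 <= 0 by rewrite subr_le0 fmax // gtr0_norm.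
rewrite fE pmulr_lle0 // leNgt => /negP; apply.
have := He c; rewrite gtr0_norm // => /(_ (lt_trans ct te)).
rewrite add0r df0 subr0 ler_norml => /andP[H _]; nra.
Qed.

End OneVariable.

Section RealCalculus.
Context {R : realType} {N : nat}.
Local Notation V := ('C[R]^N).
Implicit Types (u v w z : V) (f g h : V -> R) (U : set V) (s t : R).

Definition hasd v g z (l : R) : Prop := is_derive (0 : R) (1 : R) (rline g v z) l.

Lemma hasdP v g z : rderivable g v z -> hasd v g z (rderiv v g z).
Proof. by move=> dg; apply: (DeriveDef dg); rewrite -derive1E. Qed.

Lemma hasd_rderivable v g z l : hasd v g z l -> rderivable g v z.
Proof. by case. Qed.

Lemma hasd_rderiv v g z l : hasd v g z l -> rderiv v g z = l.
Proof. by case=> _ H; rewrite /rderiv derive1E. Qed.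

Lemma is_derive_rline g v z t l : hasd v g (z + (t%:C)%C *: v) l ->
  is_derive t (1 : R) (rline g v z) l.
Proof.
move=> H; have <- : rline g v (z + (t%:C)%C *: v) \o (fun s => s - t) = rline g v z.
  apply/funext => s; rewrite /rline /= -addrA -scalerDl -rmorphD /=.
  by rewrite [t + _]addrC subrK.
rewrite -[l]mulr1; apply: is_derive1_comp; first by rewrite subrr.
by rewrite -[X in is_derive _ _ _ X]subr0; apply: is_deriveB.
Qed.

Lemma nbhs_line z v (A : set V) : nbhs z A ->
  exists2 d : R, 0 < d & forall t, `|t| < d -> A (z + (t%:C)%C *: v).
Proof.
move=> zA; have := @cvg_rline _ _ z v 0; rewrite scale0r addr0 => /(_ A zA).
case=> d /= d0 H; exists d => // t td; apply: H.
by rewrite /ball_ /= sub0r normrN.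
Qed.

Lemma nbhs_plane z u v (A : set V) : nbhs z A ->
  exists2 d : R, 0 < d & forall s t, `|s| < d -> `|t| < d ->
    A (z + (s%:C)%C *: u + (t%:C)%C *: v).
Proof.
move=> /nbhsE_eball[r r0 rA].
(* [K] is at least 1, [nsq u] and [nsq v], so [K ^+ 2] bounds both squared lengths and no square
   root is needed. *)
pose K := 1 + nsq u + nsq v.
have K1 : 1 <= K by rewrite /K -addrA lerDl addr_ge0 // nsq_ge0.
have K0 : 0 < K := lt_le_trans ltr01 K1.
exists (r / (2 * K)) => [|s t sd td]; first by rewrite divr_gt0 // mulr_gt0.
apply: rA; rewrite eballE /=.
rewrite (_ : _ - z = (s%:C)%C *: u + (t%:C)%C *: v); last first.
  by rewrite -[z + _ + _]addrA addrAC subrr add0r.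
have H (x y : V) : nsq (x + y) <= 2 * nsq x + 2 * nsq y.
  have := nsq_ge0 (x - y); rewrite nsqB nsqD; lra.
apply: le_lt_trans (H _ _) _; rewrite !nsqZ.
have dK : r / (2 * K) * (2 * K) = r by rewrite divfK // mulf_neq0 ?gt_eqF.
have sq (x : R) : `|x| < r / (2 * K) -> x ^+ 2 * (4 * K ^+ 2) < r ^+ 2.
  move=> xd; rewrite -[X in _ < X ^+ 2]dK exprMn [X in _ * X](_ : _ = (2 * K) ^+ 2); last by ring.
  rewrite ltr_pM2r ?exprn_gt0 ?mulr_gt0 // -real_normK ?num_real //.
  by rewrite ltr_pXn2r // nnegrE ?normr_ge0 // divr_ge0 ?mulr_ge0 // ltW.
have Ku : nsq u <= K by rewrite /K; have := nsq_ge0 v; lra.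
have Kv : nsq v <= K by rewrite /K; have := nsq_ge0 u; lra.
have Kq : K <= K ^+ 2 by rewrite expr2 ler_peMl // ltW.
have A1 : s ^+ 2 * nsq u <= s ^+ 2 * K ^+ 2.
  by rewrite ler_wpM2l ?sqr_ge0 // (le_trans Ku).
have A2 : t ^+ 2 * nsq v <= t ^+ 2 * K ^+ 2.
  by rewrite ler_wpM2l ?sqr_ge0 // (le_trans Kv).
have := sq s sd; have := sq t td; lra.
Qed.

Lemma hasd_ext U v f g z l : open U -> U z -> (forall y, U y -> f y = g y) ->
  hasd v f z l -> hasd v g z l.
Proof.
move=> oU Uz fg; apply: near_eq_is_derive.
have [d d0 H] := nbhs_line v (open_nbhs_nbhs (conj oU Uz)).
exists d => // t /=; rewrite sub0r normrN => td; rewrite /rline; apply: fg.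
exact: H.
Qed.

Lemma rderiv_ext U v f g z : open U -> U z -> (forall y, U y -> f y = g y) ->
  rderivable f v z -> rderiv v f z = rderiv v g z.
Proof.
move=> oU Uz fg /hasdP H.
by rewrite (hasd_rderiv (hasd_ext oU Uz fg H)).
Qed.

Lemma hasd_cst v z (c : R) : hasd v (fun=> c) z 0.
Proof. exact: is_derive_cst. Qed.
Lemma hasdD v f g z k l : hasd v f z k -> hasd v g z l ->
  hasd v (fun y => f y + g y) z (k + l).
Proof. by move=> fk gl; apply: is_deriveD. Qed.
Lemma hasdN v f z k : hasd v f z k -> hasd v (fun y => - f y) z (- k).
Proof. by move=> fk; apply: is_deriveN. Qed.
Lemma hasdM v f g z k l : hasd v f z k -> hasd v g z l ->
  hasd v (fun y => f y * g y) z (f z * l + g z * k).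
Proof.
move=> fk gl; have := is_deriveM fk gl.
by rewrite /rline scale0r addr0.
Qed.
Lemma hasd_comp v (F : R -> R) f z k l :
  is_derive (f z) (1 : R) F l -> hasd v f z k -> hasd v (fun y => F (f y)) z (l * k).
Proof.
move=> Fl fk; apply: (@is_derive1_comp _ F (rline f v z) 0 l k _ fk).
by rewrite /rline scale0r addr0.
Qed.

Lemma Ck_cont k U g z : Ck k U g -> U z -> {for z, continuous g}.
Proof. by case: k => [|k] [H _]; exact: H. Qed.
Lemma Ck_hasd k U g z v : Ck k.+1 U g -> U z -> hasd v g z (rderiv v g z).
Proof. by case=> _ /(_ v)[H _] Uz; apply: hasdP; exact: H. Qed.
Lemma Ck_rderiv k U g v : Ck k.+1 U g -> Ck k U (rderiv v g).
Proof. by case=> _ /(_ v)[]. Qed.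
Lemma CkS k U g : Ck k.+1 U g -> Ck k U g.
Proof.
elim: k g => [|k IH] g /=; first by case.
move=> [cg H]; split=> // v; have [H1 H2] := H v; split=> //.
exact: IH.
Qed.
Lemma Ck_sub k U (W : set V) g : W `<=` U -> Ck k U g -> Ck k W g.
Proof.
move=> WU; elim: k g => [|k IH] g /= [cg H]; split=> //; first by move=> z /WU /cg.
  by move=> z /WU /cg.
by move=> v; have [H1 H2] := H v; split; [move=> z /WU/H1 | exact: IH].
Qed.

Lemma cont_ext U f g z : open U -> U z -> (forall y, U y -> f y = g y) ->
  {for z, continuous f} -> {for z, continuous g}.
Proof.
move=> oU Uz fg fc; rewrite /prop_for /continuous_at -(fg z Uz).
apply: cvg_trans fc; apply: (@near_eq_cvg _ _ (nbhs z)).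
by apply: filterS (open_nbhs_nbhs (conj oU Uz)) => y /fg.
Qed.

Lemma Ck_ext k U f g : open U -> (forall y, U y -> f y = g y) -> Ck k U f -> Ck k U g.
Proof.
move=> oU; elim: k f g => [|k IH] f g fg [cf H]; split=> //.
- by move=> z Uz; apply: (cont_ext oU Uz fg); exact: cf.
- by move=> z Uz; apply: (cont_ext oU Uz fg); exact: cf.
move=> v; have [H1 H2] := H v; split.
  by move=> z Uz; apply: hasd_rderivable; apply: (hasd_ext oU Uz fg); apply: hasdP; exact: H1.
by apply: IH H2 => y Uy; apply: (rderiv_ext oU Uy fg); exact: H1.
Qed.

(** Derivatives may be given by a formula valid on [U] alone, where it has to agree with the total
    function [rderiv]. *)
Lemma Ck_intro k U g (dg : V -> V -> R) : open U ->
  (forall z, U z -> {for z, continuous g}) ->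
  (forall v z, U z -> hasd v g z (dg v z)) ->
  (forall v, Ck k U (dg v)) -> Ck k.+1 U g.
Proof.
move=> oU cg H1 H2; split=> // v; split=> [z Uz|].
  exact: hasd_rderivable (H1 v z Uz).
by apply: Ck_ext (H2 v) => // y Uy; rewrite (hasd_rderiv (H1 v y Uy)).
Qed.

Lemma Ck_cst k U (c : R) : open U -> Ck k U (fun=> c).
Proof.
move=> oU; elim: k c => [|k IH] c; first by split=> // z _; exact: cst_continuous.
apply: (@Ck_intro _ _ _ (fun _ _ => 0)) => // [z _|v z _]; first exact: cst_continuous.
exact: hasd_cst.
Qed.

Lemma CkD k U f g : open U -> Ck k U f -> Ck k U g -> Ck k U (fun y => f y + g y).
Proof.
move=> oU; elim: k f g => [|k IH] f g Hf Hg.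
  split=> // z Uz; apply: continuousD; [exact: Ck_cont Hf Uz|exact: Ck_cont Hg Uz].
apply: (@Ck_intro _ _ _ (fun v y => rderiv v f y + rderiv v g y)) => //.
- by move=> z Uz; apply: continuousD; [exact: Ck_cont Hf Uz|exact: Ck_cont Hg Uz].
- by move=> v z Uz; apply: hasdD; [exact: Ck_hasd Hf Uz|exact: Ck_hasd Hg Uz].
- by move=> v; apply: IH; exact: Ck_rderiv.
Qed.

Lemma CkN k U f : open U -> Ck k U f -> Ck k U (fun y => - f y).
Proof.
move=> oU; elim: k f => [|k IH] f Hf.
  split=> // z Uz; apply: continuousN; exact: Ck_cont Hf Uz.
apply: (@Ck_intro _ _ _ (fun v y => - rderiv v f y)) => //.
- by move=> z Uz; apply: continuousN; exact: Ck_cont Hf Uz.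
- by move=> v z Uz; apply: hasdN; exact: Ck_hasd Hf Uz.
- by move=> v; apply: IH; exact: Ck_rderiv.
Qed.

Lemma CkM k U f g : open U -> Ck k U f -> Ck k U g -> Ck k U (fun y => f y * g y).
Proof.
move=> oU; elim: k f g => [|k IH] f g Hf Hg.
  split=> // z Uz; apply: continuousM; [exact: Ck_cont Hf Uz|exact: Ck_cont Hg Uz].
apply: (@Ck_intro _ _ _ (fun v y => f y * rderiv v g y + g y * rderiv v f y)) => //.
- by move=> z Uz; apply: continuousM; [exact: Ck_cont Hf Uz|exact: Ck_cont Hg Uz].
- by move=> v z Uz; apply: hasdM; [exact: Ck_hasd Hf Uz|exact: Ck_hasd Hg Uz].
- by move=> v; apply: CkD => //; apply: IH; (exact: Ck_rderiv || exact: CkS).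
Qed.

Lemma CkZ k U c f : open U -> Ck k U f -> Ck k U (fun y => c * f y).
Proof. by move=> oU; apply: CkM => //; exact: Ck_cst. Qed.

Lemma CkB k U f g : open U -> Ck k U f -> Ck k U g -> Ck k U (fun y => f y - g y).
Proof. by move=> oU Hf Hg; apply: CkD => //; exact: CkN. Qed.

Lemma Ck_sum k U (I : Type) (r : seq I) (P : pred I) (f : I -> V -> R) : open U ->
  (forall i, Ck k U (f i)) -> Ck k U (fun y => \sum_(i <- r | P i) f i y).
Proof.
move=> oU Hf; elim: r => [|i r IH].
  by apply: Ck_ext (Ck_cst k 0 oU) => // y _; rewrite big_nil.
case Pi: (P i).
  by apply: Ck_ext (CkD oU (Hf i) IH) => // y _; rewrite big_cons Pi.
by apply: Ck_ext IH => // y _; rewrite big_cons Pi.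
Qed.

Lemma hasd_rform (a v z : V) : hasd v (rform a) z (rform a v).
Proof.
have -> : rform a v = rform a v * 1 by rewrite mulr1.
rewrite /hasd; have -> : rline (rform a) v z = cst (rform a z) + (rform a v \*: id).
  by apply/funext => t; rewrite /rline rformD rformZ /= mulrC.
by rewrite -[X in is_derive _ _ _ X]add0r; apply: is_deriveD; exact: is_deriveZ.
Qed.

Lemma Ck_rform k U (a : V) : open U -> Ck k U (rform a).
Proof.
move=> oU; case: k => [|k].
  by split=> // z _; exact: continuous_rform.
apply: (@Ck_intro _ _ _ (fun v _ => rform a v)) => // [z _|v z _|v].
- exact: continuous_rform.
- exact: hasd_rform.
- exact: Ck_cst.
Qed.

Lemma Ck_exp k U f : open U -> Ck k U f -> Ck k U (fun y => expR (f y)).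
Proof.
move=> oU; elim: k f => [|k IH] f Hf.
  by split=> // z Uz; apply: (@continuous_comp _ _ _ f expR); [exact: Ck_cont Hf Uz|exact: continuous_expR].
apply: (@Ck_intro _ _ _ (fun v y => expR (f y) * rderiv v f y)) => //.
- by move=> z Uz; apply: (@continuous_comp _ _ _ f expR); [exact: Ck_cont Hf Uz|exact: continuous_expR].
- by move=> v z Uz; apply: hasd_comp; exact: Ck_hasd Hf Uz.
- by move=> v; apply: CkM => //; [apply: IH; exact: CkS | exact: Ck_rderiv].
Qed.

Lemma hasdZ_dir (s : R) v g z l : hasd v g z l -> hasd ((s%:C)%C *: v) g z (s * l).
Proof.
move=> H; rewrite /hasd.
have -> : rline g ((s%:C)%C *: v) z = rline g v z \o (s \*: id).
  apply/funext => t; rewrite /rline /= scalerA -rmorphM /=.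
  by rewrite (mulrC t).
rewrite mulrC; apply: is_derive1_comp; first by rewrite /= [_ *: _]mulr0.
by rewrite -[X in is_derive _ _ _ X]mulr1; exact: is_deriveZ.
Qed.

Lemma mvt_rline U g w y t : (forall z, U z -> rderivable g w z) ->
  0 < t -> (forall s, 0 <= s <= t -> U (y + (s%:C)%C *: w)) ->
  exists2 s, 0 < s < t & g (y + (t%:C)%C *: w) - g y = t * rderiv w g (y + (s%:C)%C *: w).
Proof.
move=> dg t0 Us.
have H s : 0 <= s <= t -> is_derive s (1 : R) (rline g w y) (rderiv w g (y + (s%:C)%C *: w)).
  by move=> /Us /dg /hasdP; exact: is_derive_rline.
have [s] : exists2 s, s \in `]0, t[%R & rline g w y t - rline g w y 0 =
    rderiv w g (y + (s%:C)%C *: w) * (t - 0).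
  apply: (MVT t0) => [x|].
    by rewrite in_itv /= => /andP[x0 xt]; apply: H; rewrite !ltW.
  apply: derivable_within_continuous => x; rewrite in_itv /= => /H.
  by case.
rewrite in_itv /= subr0 /rline scale0r addr0 => st E; exists s => //.
by rewrite E mulrC.
Qed.

End RealCalculus.

Section SecondOrder.
Context {R : realType} {N : nat}.
Local Notation V := ('C[R]^N).
Implicit Types (u v w z : V) (f g h : V -> R) (U : set V) (s t : R).

Lemma small_eq0 (x c : R) : 0 < c -> (forall e, 0 < e -> `|x| <= c * e) -> x = 0.
Proof.
move=> c0 H; apply/eqP; rewrite -normr_eq0 eq_le normr_ge0 andbT leNgt; apply/negP => x0.
have := H (`|x| / (2 * c)); rewrite divr_gt0 ?mulr_gt0 // => /(_ isT).
rewrite (_ : c * _ = `|x| / 2); first by lra.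
by field; rewrite gt_eqF.
Qed.

(** Directional derivatives alone are not additive in the direction. Here [z + t (v + w)] is reached
    through [z + t v]; on the second leg the mean value theorem and the continuity of [rderiv w g]
    apply. *)
Lemma rderivD_dir U v w g z : open U -> U z -> Ck 1 U g ->
  rderiv (v + w) g z = rderiv v g z + rderiv w g z.
Proof.
move=> oU Uz Cg; apply/eqP; rewrite -subr_eq0; apply/eqP.
(* Three errors of at most [e * t]: two first-order expansions and the variation of [rderiv w g]. *)
apply: (@small_eq0 _ 3) => // e e0.
have [d1 d10 H1] := is_derive_quot (Ck_hasd (v + w) Cg Uz) e0.
have [d2 d20 H2] := is_derive_quot (Ck_hasd v Cg Uz) e0.
have /cvgrPdist_le/(_ _ e0) Hc : {for z, continuous (rderiv w g)}.
  exact: Ck_cont (Ck_rderiv w Cg) Uz.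
have [d3 d30 H3] := nbhs_plane v w (filterI Hc (open_nbhs_nbhs (conj oU Uz))).
pose t := Num.min d1 (Num.min d2 d3) / 2.
have m0 : 0 < Num.min d1 (Num.min d2 d3) by rewrite !lt_min d10 d20 d30.
have t0 : 0 < t by rewrite divr_gt0.
have tm : t < Num.min d1 (Num.min d2 d3) by rewrite ltr_pdivrMr // mulr_natr mulr2n ltrDl.
have /and3P[t1 t2 t3] : [&& t < d1, t < d2 & t < d3] by move: tm; rewrite !lt_min.
have tE : `|t| = t by rewrite gtr0_norm.
have L1 := H1 t; have L2 := H2 t; move: L1 L2; rewrite tE => /(_ t1) + /(_ t2).
rewrite /rline !add0r !scale0r !addr0 scalerDr addrA.
set G1 := g (_ + _ + _); set G2 := g (_ + _) => L1 L2.
have [||s /andP[s0 st] E] := @mvt_rline _ _ U g w (z + (t%:C)%C *: v) t _ t0.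
- by move=> y Uy; exact: hasd_rderivable (Ck_hasd w Cg Uy).
- move=> s /andP[s0 st]; apply: (H3 t s _ _).2; rewrite ?tE // ger0_norm //.
  exact: le_lt_trans t3.
have L3 : `|rderiv w g z - rderiv w g (z + (t%:C)%C *: v + (s%:C)%C *: w)| <= e.
  by apply: (H3 t s _ _).1; rewrite ?tE // gtr0_norm // (lt_trans st).
rewrite -/G1 -/G2 in E.
move: E L1 L2 L3; move: (rderiv w g (_ + _ + _)) (rderiv _ g z) (rderiv v g z) (rderiv w g z).
move=> b' c a b E; rewrite !ler_norml => /andP[A1 A2] /andP[B1 B2] /andP[C1 C2].
have C1' : - (e * t) <= t * (b - b') by rewrite -mulNr mulrC ler_wpM2l // ltW.
have C2' : t * (b - b') <= e * t by rewrite [leRHS]mulrC ler_wpM2l // ltW.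
suff : - (3 * e) * t <= (c - (a + b)) * t <= (3 * e) * t by rewrite !ler_pM2r.
by apply/andP; split; lra.
Qed.

Lemma schwarz U u v g z : open U -> U z -> Ck 2 U g ->
  rderiv u (rderiv v g) z = rderiv v (rderiv u g) z.
Proof.
move=> oU Uz Cg; apply/eqP; rewrite -subr_eq0; apply/eqP.
apply: (@small_eq0 _ 2) => // e e0.
have ct a b : {for z, continuous (rderiv a (rderiv b g))}.
  exact: Ck_cont (Ck_rderiv a (Ck_rderiv b Cg)) Uz.
have /cvgrPdist_le/(_ _ e0) Hc1 := ct u v.
have /cvgrPdist_le/(_ _ e0) Hc2 := ct v u.
have [d d0 H] := nbhs_plane u v (filterI (filterI Hc1 Hc2) (open_nbhs_nbhs (conj oU Uz))).
pose t := d / 2.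
have t0 : 0 < t by rewrite divr_gt0.
have td : t < d by rewrite ltr_pdivrMr // mulr_natr mulr2n ltrDl.
clearbody t.
have sd s : 0 <= s <= t -> `|s| < d by move=> /andP[s0 st]; rewrite ger0_norm // (le_lt_trans st).
have td' : `|t| < d by rewrite gtr0_norm.
have zd : `|0 : R| < d by rewrite normr0.
(* The second difference of g over the parallelogram spanned by t a and t b is
   t^2 times a mixed second derivative at an intermediate point. *)
have key a b : (forall s s', `|s| < d -> `|s'| < d -> U (z + (s%:C)%C *: a + (s'%:C)%C *: b)) ->
    exists s s', [/\ 0 < s < t, 0 < s' < t &
      g (z + (t%:C)%C *: a + (t%:C)%C *: b) - g (z + (t%:C)%C *: a) -
        (g (z + (t%:C)%C *: b) - g z) =
      t * (t * rderiv b (rderiv a g) (z + (s%:C)%C *: a + (s'%:C)%C *: b))].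
  move=> Uab; pose f y := g (y + (t%:C)%C *: b) - g y.
  have fd y : U y -> U (y + (t%:C)%C *: b) ->
      hasd a f y (rderiv a g (y + (t%:C)%C *: b) - rderiv a g y).
    move=> Uy Uy'; apply: hasdD; last by apply: hasdN; exact: Ck_hasd Cg Uy.
    have := Ck_hasd a Cg Uy'; rewrite /hasd.
    rewrite (_ : rline g a (y + (t%:C)%C *: b) =
        rline (fun y0 => g (y0 + (t%:C)%C *: b)) a y) //.
    by apply/funext => r; rewrite /rline addrAC.
  have [||s /andP[s0 st] E] := @mvt_rline _ _ (U `&` [set y | U (y + (t%:C)%C *: b)]) f a z t _ t0.
  - by move=> y [Uy Uy']; exact: hasd_rderivable (fd y Uy Uy').
  - move=> s /sd s_d; split; last exact: Uab.
    by have := Uab s 0 s_d zd; rewrite scale0r addr0.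
  have s_d : `|s| < d by apply: sd; rewrite !ltW.
  have Us : U (z + (s%:C)%C *: a) by have := Uab s 0 s_d zd; rewrite scale0r addr0.
  have Us' : U (z + (s%:C)%C *: a + (t%:C)%C *: b) by exact: Uab.
  have [||s' s't E'] := @mvt_rline _ _ U (rderiv a g) b (z + (s%:C)%C *: a) t _ t0.
  - by move=> y Uy; exact: hasd_rderivable (Ck_hasd b (Ck_rderiv a Cg) Uy).
  - by move=> r /sd rd; exact: Uab.
  exists s, s'; split=> //; first by rewrite s0.
  by rewrite -E' -(hasd_rderiv (fd _ Us Us')) -E.
have [|s1 [s1' [h1 h1' E1]]] := key u v; first by move=> s s' hs hs'; exact: (H s s' hs hs').2.
have [|s2 [s2' [h2 h2' E2]]] := key v u.
  by move=> s s' hs hs'; rewrite addrAC; exact: (H s' s hs' hs).2.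
have sd' s : 0 < s < t -> `|s| < d by move=> /andP[s0 st]; apply: sd; rewrite !ltW.
have [_ L2] := (H s1 s1' (sd' _ h1) (sd' _ h1')).1.
have [L1 _] := (H s2' s2 (sd' _ h2') (sd' _ h2)).1.
rewrite /= in L1 L2.
have E : rderiv v (rderiv u g) (z + (s1%:C)%C *: u + (s1'%:C)%C *: v) =
         rderiv u (rderiv v g) (z + (s2'%:C)%C *: u + (s2%:C)%C *: v).
  apply: (mulfI (lt0r_neq0 t0)); apply: (mulfI (lt0r_neq0 t0)).
  rewrite (addrAC z ((s2'%:C)%C *: u)); apply: etrans (esym E1) (etrans _ E2).
  rewrite (addrAC z ((t%:C)%C *: v)).
  by ring.
move: L1 L2; rewrite E; set x := rderiv u (rderiv v g) (z + _ + _).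
clearbody x. move=> L1 L2. apply: (le_trans (ler_distD x _ _)).
rewrite mulr_natl mulr2n. apply: (lerD L1). rewrite distrC. exact: L2.
Qed.

End SecondOrder.

(** * Wirtinger derivatives and Laplacians *)

Section ComplexDerivatives.
Context {R : realType} {N : nat}.
Local Notation V := ('C[R]^N).
Local Notation C := (Cplx R).
Implicit Types (u v w z : V) (f g : V -> C) (U : set V) (s t : R).

Definition Ckc k U f : Prop :=
  Ck k U (fun z => complex.Re (f z)) /\ Ck k U (fun z => complex.Im (f z)).

Lemma Ckc_cvg k U f z : Ckc k U f -> U z -> f y @[y --> z] --> f z.
Proof.
move=> [H1 H2] Uz.
have -> : f = (fun y => Complex (complex.Re (f y)) (complex.Im (f y)) : C).
  by apply/funext => y; case: (f y).
exact: (@cvg_Complex _ _ (nbhs z) _ _ _ _ _ (Ck_cont H1 Uz) (Ck_cont H2 Uz)).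
Qed.

(** The (1,0) and (0,1) parts of the differential at an arbitrary vector; for C1 functions they are
    linear and antilinear in that vector, and at basis vectors they are the Wirtinger
    derivatives. *)
Definition del u f z : C := 2^-1 * (cderiv u f z - 'i * cderiv ('i *: u) f z).
Definition delb v f z : C := 2^-1 * (cderiv v f z + 'i * cderiv ('i *: v) f z).

Lemma wirtE k f z : wirt k f z = del (ebasis k) f z.
Proof. by []. Qed.
Lemma Re_half (x : C) : complex.Re (2^-1 * x) = 2^-1 * complex.Re x.
Proof.
have -> : (2^-1 : C) = ((2^-1 : R)%:C)%C by rewrite fmorphV rmorph_nat.
exact: cReZ.
Qed.
Lemma Im_half (x : C) : complex.Im (2^-1 * x) = 2^-1 * complex.Im x.
Proof.
have -> : (2^-1 : C) = ((2^-1 : R)%:C)%C by rewrite fmorphV rmorph_nat.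
exact: cImZ.
Qed.
Lemma Re_imul (x : C) : complex.Re ('i * x) = - complex.Im x.
Proof. by rewrite cReM cRe_i cIm_i; ring. Qed.
Lemma Im_imul (x : C) : complex.Im ('i * x) = complex.Re x.
Proof. by rewrite cImM cRe_i cIm_i; ring. Qed.

Lemma Re_del u f z : complex.Re (del u f z) =
  2^-1 * (rderiv u (fun z => complex.Re (f z)) z +
          rderiv ('i *: u) (fun z => complex.Im (f z)) z).
Proof. by rewrite Re_half cReD cReN Re_imul /= opprK. Qed.
Lemma Im_del u f z : complex.Im (del u f z) =
  2^-1 * (rderiv u (fun z => complex.Im (f z)) z -
          rderiv ('i *: u) (fun z => complex.Re (f z)) z).
Proof. by rewrite Im_half cImD cImN Im_imul. Qed.
Lemma Re_delb u f z : complex.Re (delb u f z) =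
  2^-1 * (rderiv u (fun z => complex.Re (f z)) z -
          rderiv ('i *: u) (fun z => complex.Im (f z)) z).
Proof. by rewrite Re_half cReD Re_imul. Qed.
Lemma Im_delb u f z : complex.Im (delb u f z) =
  2^-1 * (rderiv u (fun z => complex.Im (f z)) z +
          rderiv ('i *: u) (fun z => complex.Re (f z)) z).
Proof. by rewrite Im_half cImD Im_imul. Qed.

Lemma Ckc_delb k U v f : open U -> Ckc k.+1 U f -> Ckc k U (delb v f).
Proof.
move=> oU [H1 H2]; split.
  apply: (Ck_ext oU (fun z _ => esym (Re_delb v f z))); apply: CkZ => //.
  by apply: CkB => //; exact: Ck_rderiv.
apply: (Ck_ext oU (fun z _ => esym (Im_delb v f z))); apply: CkZ => //.
by apply: CkD => //; exact: Ck_rderiv.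
Qed.

Section AtPoint.
Variables (U : set V) (z : V).
Hypotheses (oU : open U) (Uz : U z).

Lemma cderivD_dir v w f : Ckc 1 U f ->
  cderiv (v + w) f z = cderiv v f z + cderiv w f z.
Proof.
by move=> [H1 H2]; apply: eqCplx => /=; rewrite !(rderivD_dir v w oU Uz).
Qed.

Lemma cderivZ_dir (s : R) v f : Ckc 1 U f ->
  cderiv ((s%:C)%C *: v) f z = (s%:C)%C * cderiv v f z.
Proof.
move=> [H1 H2]; apply: eqCplx; rewrite ?cReZ ?cImZ /=; apply: hasd_rderiv.
  apply: hasdZ_dir; exact: Ck_hasd H1 Uz.
apply: hasdZ_dir; exact: Ck_hasd H2 Uz.
Qed.

Lemma cderivN_dir v f : Ckc 1 U f -> cderiv (- v) f z = - cderiv v f z.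
Proof.
move=> Hf; rewrite -scaleN1r -[RHS]mulN1r.
have -> : (-1 : C) = ((-1 : R)%:C)%C by rewrite rmorphN1.
exact: cderivZ_dir.
Qed.

Lemma scale_ii v : 'i *: ('i *: v) = - v.
Proof. by rewrite scalerA -expr2 sqrCi scaleN1r. Qed.

Lemma scale_iR (s : R) v : 'i *: ((s%:C)%C *: v) = (s%:C)%C *: ('i *: v).
Proof. by rewrite !scalerA mulrC. Qed.

Lemma delD_dir v w f : Ckc 1 U f -> del (v + w) f z = del v f z + del w f z.
Proof. by move=> Hf; rewrite /del scalerDr !cderivD_dir // (mulrDr 'i) opprD addrACA mulrDr. Qed.
Lemma delbD_dir v w f : Ckc 1 U f -> delb (v + w) f z = delb v f z + delb w f z.
Proof. by move=> Hf; rewrite /delb scalerDr !cderivD_dir // (mulrDr 'i) addrACA mulrDr. Qed.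

Lemma ii : 'i * 'i = -1 :> C.
Proof. by rewrite -expr2 sqrCi. Qed.

Lemma delI_dir v f : Ckc 1 U f -> del ('i *: v) f z = 'i * del v f z.
Proof.
move=> Hf; rewrite /del scale_ii cderivN_dir // mulrCA; congr (_ * _).
by rewrite mulrBr mulrA ii mulN1r mulrN !opprK addrC.
Qed.
Lemma delbI_dir v f : Ckc 1 U f -> delb ('i *: v) f z = - 'i * delb v f z.
Proof.
move=> Hf; rewrite /delb scale_ii cderivN_dir // mulrCA; congr (_ * _).
by rewrite mulrDr [- 'i * ('i * _)]mulrA (mulNr 'i 'i) ii opprK mul1r mulrN mulNr addrC.
Qed.

Lemma delR_dir (s : R) v f : Ckc 1 U f -> del ((s%:C)%C *: v) f z = (s%:C)%C * del v f z.
Proof.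
move=> Hf; rewrite /del scale_iR !cderivZ_dir //.
by rewrite (mulrCA 'i) -mulrBr mulrCA.
Qed.
Lemma delbR_dir (s : R) v f : Ckc 1 U f -> delb ((s%:C)%C *: v) f z = (s%:C)%C * delb v f z.
Proof.
move=> Hf; rewrite /delb scale_iR !cderivZ_dir //.
by rewrite (mulrCA 'i) -mulrDr mulrCA.
Qed.

Lemma delZ_dir (c : C) v f : Ckc 1 U f -> del (c *: v) f z = c * del v f z.
Proof.
move=> Hf; rewrite [c in LHS]complexE [c in RHS]complexE complexiE !scalerDl delD_dir //.
by rewrite -scalerA delI_dir // !delR_dir // mulrDl -(mulrA 'i).
Qed.
Lemma delbZ_dir (c : C) v f : Ckc 1 U f -> delb (c *: v) f z = c^* * delb v f z.
Proof.
move=> Hf; rewrite [c in LHS]complexE [c in RHS]complexE complexiE !scalerDl delbD_dir //.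
by rewrite -scalerA delbI_dir // !delbR_dir // cconjD cconjM !conjRC cconj_i mulrDl -(mulrA (- 'i)).
Qed.

Lemma delE u f : Ckc 1 U f -> del u f z = \sum_k u 0 k * wirt k f z.
Proof.
move=> Hf; rewrite {1}[u]row_sum_delta.
rewrite (big_morph (fun u => del u f z) (id1 := 0) (op1 := +%R)).
- by apply: eq_bigr => k _; rewrite delZ_dir.
- by move=> x y; exact: delD_dir.
- by rewrite -[X in del X _ _](scale0r 0) delZ_dir // mul0r.
Qed.
Lemma delbE v f : Ckc 1 U f -> delb v f z = \sum_l wirtbar l f z * (v 0 l)^*.
Proof.
move=> Hf; rewrite {1}[v]row_sum_delta.
rewrite (big_morph (fun u => delb u f z) (id1 := 0) (op1 := +%R)).
- by apply: eq_bigr => k _; rewrite delbZ_dir // mulrC.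
- by move=> x y; exact: delbD_dir.
- by rewrite -[X in delb X _ _](scale0r 0) delbZ_dir // conjC0 mul0r.
Qed.

Lemma cderiv_ext v f g : Ckc 1 U f -> (forall y, U y -> f y = g y) ->
  cderiv v f z = cderiv v g z.
Proof.
move=> [H1 H2] fg; apply: eqCplx => /=; apply: (rderiv_ext oU Uz).
- by move=> y /fg ->.
- exact: hasd_rderivable (Ck_hasd v H1 Uz).
- by move=> y /fg ->.
- exact: hasd_rderivable (Ck_hasd v H2 Uz).
Qed.

Lemma del_ext v f g : Ckc 1 U f -> (forall y, U y -> f y = g y) -> del v f z = del v g z.
Proof. by move=> Hf fg; rewrite /del !(cderiv_ext _ Hf fg). Qed.

Lemma cderivD v f g : Ckc 1 U f -> Ckc 1 U g ->
  cderiv v (fun y => f y + g y) z = cderiv v f z + cderiv v g z.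
Proof.
move=> [f1 f2] [g1 g2]; apply: eqCplx => /=; apply: hasd_rderiv.
  have := hasdD (Ck_hasd v f1 Uz) (Ck_hasd v g1 Uz).
  by congr hasd; apply/funext => y; rewrite cReD.
have := hasdD (Ck_hasd v f2 Uz) (Ck_hasd v g2 Uz).
by congr hasd; apply/funext => y; rewrite cImD.
Qed.

Lemma cderivZ v f (c : C) : Ckc 1 U f ->
  cderiv v (fun y => c * f y) z = c * cderiv v f z.
Proof.
move=> [f1 f2]; apply: eqCplx; rewrite ?cReM ?cImM /=; apply: hasd_rderiv.
  have := hasdD (hasdM (hasd_cst v z (complex.Re c)) (Ck_hasd v f1 Uz))
     (hasdN (hasdM (hasd_cst v z (complex.Im c)) (Ck_hasd v f2 Uz))).
  rewrite !mulr0 !addr0; by congr hasd; apply/funext => y; rewrite cReM.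
have := hasdD (hasdM (hasd_cst v z (complex.Re c)) (Ck_hasd v f2 Uz))
   (hasdM (hasd_cst v z (complex.Im c)) (Ck_hasd v f1 Uz)).
rewrite !mulr0 !addr0; by congr hasd; apply/funext => y; rewrite cImM.
Qed.

Lemma delD u f g : Ckc 1 U f -> Ckc 1 U g ->
  del u (fun y => f y + g y) z = del u f z + del u g z.
Proof.
move=> Hf Hg; rewrite /del (cderivD u Hf Hg) (cderivD _ Hf Hg).
by rewrite (mulrDr 'i) opprD addrACA mulrDr.
Qed.
Lemma delZ u f (c : C) : Ckc 1 U f -> del u (fun y => c * f y) z = c * del u f z.
Proof.
move=> Hf; rewrite /del (cderivZ u c Hf) (cderivZ _ c Hf).
by rewrite (mulrCA 'i) -mulrBr (mulrCA _ c).
Qed.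

Lemma CkcD k f g : Ckc k U f -> Ckc k U g -> Ckc k U (fun y => f y + g y).
Proof.
move=> [f1 f2] [g1 g2]; split.
  by apply: (Ck_ext oU (fun y _ => esym (cReD (f y) (g y)))); exact: CkD.
by apply: (Ck_ext oU (fun y _ => esym (cImD (f y) (g y)))); exact: CkD.
Qed.
Lemma CkcZ k f c : Ckc k U f -> Ckc k U (fun y => c * f y).
Proof.
move=> [f1 f2]; split.
  by apply: (Ck_ext oU (fun y _ => esym (cReM c (f y)))); apply: CkB => //; exact: CkZ.
by apply: (Ck_ext oU (fun y _ => esym (cImM c (f y)))); apply: CkD => //; exact: CkZ.
Qed.
Lemma Ckc0 k : Ckc k U (fun=> 0).
Proof. by split; exact: Ck_cst. Qed.

Lemma del_sum u (I : Type) (r : seq I) (c : I -> C) (F : I -> V -> C) :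
  (forall i, Ckc 1 U (F i)) ->
  Ckc 1 U (fun y => \sum_(i <- r) c i * F i y) /\
  del u (fun y => \sum_(i <- r) c i * F i y) z = \sum_(i <- r) c i * del u (F i) z.
Proof.
move=> HF; elim: r => [|i r [IH1 IH2]].
  have E : (fun y => \sum_(i <- [::]) c i * F i y) = fun=> 0.
    by apply/funext => y; rewrite big_nil.
  rewrite E big_nil; split; first exact: Ckc0.
  have c0 v : cderiv v (fun=> 0) z = 0.
    by apply: eqCplx => /=; apply: hasd_rderiv; exact: hasd_cst.
  by rewrite /del !c0 mulr0 subr0 mulr0.
have E : (fun y => \sum_(j <- i :: r) c j * F j y) =
         fun y => c i * F i y + \sum_(j <- r) c j * F j y.
  by apply/funext => y; rewrite big_cons.
have H1 := CkcZ (c i) (HF i).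
rewrite E big_cons; split; first exact: CkcD.
by rewrite (delD u H1 IH1) (delZ u (c i) (HF i)) IH2.
Qed.

Lemma CkcS k f : Ckc k.+1 U f -> Ckc k U f.
Proof. by move=> [H1 H2]; split; exact: CkS. Qed.

End AtPoint.

(** The left-hand side is the Levi form of [f] at [(u, v)], free of coordinates. *)
Lemma del_delbE U z u v f : open U -> U z -> Ckc 2 U f ->
  del u (delb v f) z = \sum_k \sum_l wirt k (wirtbar l f) z * u 0 k * (v 0 l)^*.
Proof.
move=> oU Uz Hf; have Hb w : Ckc 1 U (delb w f) by exact: Ckc_delb.
rewrite (delE oU Uz) //; apply: eq_bigr => k _.
have Hw l : Ckc 1 U (wirtbar l f) by exact: Hb.
have [Hs Es] := del_sum oU Uz (ebasis k) (index_enum 'I_N) (fun l => (v 0 l)^* ) Hw.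
transitivity (u 0 k * del (ebasis k) (fun y => \sum_l (v 0 l)^* * wirtbar l f y) z).
  congr (_ * _); apply: (del_ext oU Uz _ (Hb v)) => y Uy.
  rewrite (delbE oU Uy v (CkcS Hf)); apply: eq_bigr => l _; exact: mulrC.
rewrite Es mulr_sumr; apply: eq_bigr => l _.
rewrite -wirtE (mulrC (wirt _ _ _)) -mulrA; congr (_ * _); exact: mulrC.
Qed.

End ComplexDerivatives.

Lemma det2 (K : comNzRingType) (M : 'M[K]_2) :
  \det M = M ord0 ord0 * M (lift ord0 ord0) (lift ord0 ord0)
         - M ord0 (lift ord0 ord0) * M (lift ord0 ord0) ord0.
Proof.
rewrite (expand_det_row _ ord0) !big_ord_recl big_ord0 addr0 /cofactor !det_mx11 !mxE /=.
rewrite expr0 mul1r expr1 mulN1r mulrN.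
by congr (_ * M _ _ - _ * M _ _); apply: val_inj.
Qed.

Section Laplacian.
Context {R : realType} {N : nat}.
Local Notation V := ('C[R]^N).
Local Notation C := (Cplx R).
Implicit Types (u v w z : V) (f g : V -> C) (U : set V) (s t : R).

(** The Laplacian at 0 of [g] on the complex line [zeta -> z + zeta w]. *)
Definition lap w (g : V -> R) z : R :=
  rderiv w (rderiv w g) z + rderiv ('i *: w) (rderiv ('i *: w) g) z.

Lemma rderiv_lin2 U v (g h F : V -> R) z : open U -> U z -> Ck 1 U g -> Ck 1 U h ->
  (forall y, U y -> F y = 2^-1 * (g y + h y)) ->
  rderiv v F z = 2^-1 * (rderiv v g z + rderiv v h z).
Proof.
move=> oU Uz Hg Hh FE; apply: hasd_rderiv; apply: (hasd_ext oU Uz (fun y Uy => esym (FE y Uy))).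
have := hasdM (hasd_cst v z 2^-1) (hasdD (Ck_hasd v Hg Uz) (Ck_hasd v Hh Uz)).
by rewrite mulr0 addr0.
Qed.

(** The mixed derivatives along [w] and [i w] cancel by the symmetry of second derivatives. *)
Lemma del_delb_lap U z w f : open U -> U z -> Ckc 2 U f ->
  del w (delb w f) z = Complex (4^-1 * lap w (fun y => complex.Re (f y)) z)
                               (4^-1 * lap w (fun y => complex.Im (f y)) z).
Proof.
move=> oU Uz [Ha Hb].
set a := fun y => complex.Re (f y) in Ha *; set b := fun y => complex.Im (f y) in Hb *.
pose w' : V := 'i *: w.
have Ha1 := Ck_rderiv w Ha; have Ha1' := Ck_rderiv w' Ha.
have Hb1 := Ck_rderiv w Hb; have Hb1' := Ck_rderiv w' Hb.
have Dre v : rderiv v (fun y => complex.Re (delb w f y)) z =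
   2^-1 * (rderiv v (rderiv w a) z - rderiv v (rderiv w' b) z).
  have NHb1' : Ck 1 U (fun y => - rderiv w' b y) by exact: CkN.
  rewrite (rderiv_lin2 v oU Uz Ha1 NHb1' (fun y _ => Re_delb w f y)).
  by rewrite (hasd_rderiv (hasdN (Ck_hasd v Hb1' Uz))).
have Dim v : rderiv v (fun y => complex.Im (delb w f y)) z =
   2^-1 * (rderiv v (rderiv w b) z + rderiv v (rderiv w' a) z).
  by rewrite (rderiv_lin2 v oU Uz Hb1 Ha1' (fun y _ => Im_delb w f y)).
apply: eqCplx; rewrite ?Re_del ?Im_del !Dre !Dim /= /lap -/w'.
  rewrite (schwarz w w' oU Uz Hb).
  by move: (rderiv w (rderiv w a) z) (rderiv w' (rderiv w b) z) (rderiv w' (rderiv w' a) z) => x y t; field.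
rewrite (schwarz w w' oU Uz Ha).
by move: (rderiv w (rderiv w b) z) (rderiv w' (rderiv w a) z) (rderiv w' (rderiv w' b) z) => x y t; field.
Qed.

Lemma cderiv_affine k (p : V) (A : 'M[C]_(k, N)) f (v w : 'C[R]^k) :
  cderiv v (fun w : 'C[R]^k => f (p + w *m A)) w = cderiv (v *m A) f (p + w *m A).
Proof.
have E (g : V -> R) : rline (fun w : 'C[R]^k => g (p + w *m A)) v w =
    rline g (v *m A) (p + w *m A).
  by apply/funext => t; rewrite /rline mulmxDl addrA scalemxAl.
by rewrite /cderiv /rderiv (E (fun z => complex.Re (f z))) (E (fun z => complex.Im (f z))).
Qed.

Lemma Ck_affine m k (p : V) (A : 'M[C]_(k, N)) U (g : V -> R) : Ck m U g ->
  Ck m [set w : 'C[R]^k | U (p + w *m A)] (fun w : 'C[R]^k => g (p + w *m A)).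
Proof.
have E (h : V -> R) (v w : 'C[R]^k) : rline (fun w : 'C[R]^k => h (p + w *m A)) v w =
    rline h (v *m A) (p + w *m A).
  by apply/funext => t; rewrite /rline mulmxDl addrA scalemxAl.
have cont (h : V -> R) (w : 'C[R]^k) : {for p + w *m A, continuous h} ->
    {for w, continuous (fun w : 'C[R]^k => h (p + w *m A))}.
  move=> hc; apply: (@continuous_comp _ _ _ (fun w : 'C[R]^k => p + w *m A) h) hc.
  exact: continuous_affine.
elim: m g => [|m IH] g [cg H]; split=> //; first by move=> w /cg /cont.
  by move=> w /cg /cont.
move=> v; have [H1 H2] := H (v *m A); split.
  by move=> w Uw; rewrite /rderivable E; exact: H1.
rewrite (_ : rderiv v _ = fun w : 'C[R]^k => rderiv (v *m A) g (p + w *m A)); first exact: IH.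
by apply/funext => w0; rewrite /rderiv E.
Qed.

Lemma delb_affine k (p : V) (A : 'M[C]_(k, N)) f (v w : 'C[R]^k) :
  delb v (fun w : 'C[R]^k => f (p + w *m A)) w = delb (v *m A) f (p + w *m A).
Proof. by rewrite /delb !cderiv_affine scalemxAl. Qed.
Lemma del_affine k (p : V) (A : 'M[C]_(k, N)) f (v w : 'C[R]^k) :
  del v (fun w : 'C[R]^k => f (p + w *m A)) w = del (v *m A) f (p + w *m A).
Proof. by rewrite /del !cderiv_affine scalemxAl. Qed.

Lemma wedge_dzE (k l : 'I_N) (vs : 'I_2 -> V) : Defs.wedge (dz k) (dzbar l) vs =
  vs ord0 0 k * (vs (lift ord0 ord0) 0 l)^* - vs (lift ord0 ord0) 0 k * (vs ord0 0 l)^*.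
Proof.
have -> : @dz R N k = detform 1 (fun _ v => v 0 k).
  by apply/funext => v; rewrite /detform det_mx11 mxE.
have -> : @dzbar R N l = detform 1 (fun _ v => (v 0 l)^* ).
  by apply/funext => v; rewrite /detform det_mx11 mxE.
rewrite wedge_detform /detform det2 !mxE /=; congr (_ - _); exact: mulrC.
Qed.

Lemma dbarE U z f vs : open U -> U z -> Ckc 1 U f -> dbar f z vs = delb (vs ord0) f z.
Proof. by move=> oU Uz Hf; rewrite (delbE oU Uz). Qed.

(** Without coordinates, the compatibility of [ddbar] with restriction to planes becomes visible. *)
Lemma ddbarE U z f vs : open U -> U z -> Ckc 2 U f ->
  ddbar f z vs = del (vs ord0) (delb (vs (lift ord0 ord0)) f) z
               - del (vs (lift ord0 ord0)) (delb (vs ord0) f) z.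
Proof.
move=> oU Uz Hf; rewrite !(del_delbE _ _ oU Uz Hf) /ddbar -sumrB.
apply: eq_bigr => k _; rewrite -sumrB; apply: eq_bigr => l _.
by rewrite wedge_dzE mulrBr !mulrA.
Qed.

Lemma i_cancel (x y z t : C) : x = y - z -> x = 0 -> z = 'i * t -> y = - 'i * t -> t = 0.
Proof.
move=> -> + zE yE; rewrite zE yE -mulrBl -opprD => /eqP.
by rewrite mulf_eq0 oppr_eq0 -mulr2n mulrn_eq0 /= (negbTE (neq0Ci _)) => /eqP.
Qed.

(** At the pair [(w, i w)] the form [ddbar] takes the value [- 2 i] times the Levi form at [w],
    which is a quarter of the Laplacian. *)
Lemma pluriharmonic_lap U z w (h : V -> R) : open U -> U z -> pluriharmonic U h ->
  lap w h z = 0.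
Proof.
move=> oU Uz [Hh /(_ z Uz) H0].
pose F : V -> C := fun y => (h y)%:C%C.
have Hc : Ckc 2 U F by split; [exact: Hh | exact: (Ck_cst 2 0 oU)].
have Hb v : Ckc 1 U (delb v F) by exact: Ckc_delb.
have E1 : del ('i *: w) (delb w F) z = 'i * del w (delb w F) z.
  exact: (delI_dir Uz w (Hb w)).
have E2 : del w (delb ('i *: w) F) z = - 'i * del w (delb w F) z.
  rewrite -(delZ Uz _ _ (Hb w)); apply: (del_ext oU Uz _ (Hb _)) => y Uy.
  exact: (delbI_dir Uy w (CkcS Hc)).
pose vs (i : 'I_2) := if i == ord0 then w else 'i *: w.
have D0 : ddbar F z vs = 0 by exact: (congr1 (fun f : @Defs.form R N 2 => f vs) H0).
have DE : ddbar F z vs = del w (delb ('i *: w) F) z - del ('i *: w) (delb w F) z.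
  exact: (ddbarE vs oU Uz Hc).
have := i_cancel DE D0 E1 E2; rewrite (del_delb_lap w oU Uz Hc) => /(congr1 (@complex.Re R)) H.
by apply: (mulfI (invr_neq0 (_ : (4 : R) != 0))); rewrite ?pnatr_eq0 // mulr0.
Qed.

Lemma wedge_affine k m n (A : 'M[C]_(k, N)) (a : @Defs.form R N m) (b : @Defs.form R N n) vs :
  Defs.wedge (fun x : 'I_m -> 'C[R]^k => a (fun i => x i *m A))
    (fun x : 'I_n -> 'C[R]^k => b (fun i => x i *m A)) vs =
  Defs.wedge a b (fun i => vs i *m A).
Proof. by []. Qed.

Lemma wedge_pow_affine k n q (A : 'M[C]_(k, N)) (b : @Defs.form R N n) vs :
  wedge_pow (fun x : 'I_n -> 'C[R]^k => b (fun i => x i *m A)) q vs =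
  wedge_pow b q (fun i => vs i *m A).
Proof.
elim: q vs => [|q IH] vs //=; rewrite -wedge_affine; congr (Defs.wedge _ _ vs).
by apply/funext => x; rewrite IH.
Qed.

Lemma open_affine k (p : V) (A : 'M[C]_(k, N)) U : open U ->
  open [set w : 'C[R]^k | U (p + w *m A)].
Proof.
move=> oU; apply: (@open_comp _ _ (fun w : 'C[R]^k => p + w *m A)) => // w _.
exact: continuous_affine.
Qed.

End Laplacian.

Section Pullback.
Context {R : realType} {N : nat}.
Local Notation V := ('C[R]^N).
Local Notation C := (Cplx R).
Implicit Types (f : V -> C) (U : set V).

(** [dbar], [ddbar] and wedge products commute with pullback by a complex affine map. *)
Lemma qholo_affine q k (p : V) (A : 'M[C]_(k, N)) U f : open U -> qholo q U f ->
  qholo q [set w : 'C[R]^k | U (p + w *m A)] (fun w : 'C[R]^k => f (p + w *m A)).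
Proof.
move=> oU [Hf H0]; set U' := [set w : 'C[R]^k | _].
have oU' : open U' by exact: open_affine.
have Hf' : Ckc 2 U' (fun w : 'C[R]^k => f (p + w *m A)) by split; [exact: (Ck_affine p A Hf.1) | exact: (Ck_affine p A Hf.2)].
split; first exact: Hf'.
move=> w Uw; apply/funext => vs.
have <- : Defs.wedge (dbar f (p + w *m A)) (wedge_pow (ddbar f (p + w *m A)) q)
   (fun i => vs i *m A) = 0 by rewrite H0.
rewrite -wedge_affine; congr (Defs.wedge _ _ vs); apply/funext => x.
  by rewrite (dbarE _ oU' Uw (CkcS Hf')) (dbarE _ oU Uw (CkcS Hf)) delb_affine.
rewrite -wedge_pow_affine; congr (wedge_pow _ q x); apply/funext => ws.
rewrite (ddbarE _ oU' Uw Hf') (ddbarE _ oU Uw Hf).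
have E (y : 'C[R]^k) : delb y (fun w0 : 'C[R]^k => f (p + w0 *m A)) = fun w0 : 'C[R]^k => delb (y *m A) f (p + w0 *m A).
  by apply/funext => w0; rewrite delb_affine.
by rewrite !E !del_affine.
Qed.

End Pullback.

(** * q-holomorphic functions *)

Section NullDirection.
Context {R : realType} {n : nat}.
Local Notation V := ('C[R]^(n.+1)).
Local Notation C := (Cplx R).
Implicit Types (f : V -> C) (U : set V).

Lemma cvg_prodC (T I : Type) (F : set_system T) {FF : Filter F} (r : seq I)
    (f : I -> T -> C) (l : I -> C) :
  (forall i, f i x @[x --> F] --> l i) ->
  (\prod_(i <- r) f i x) @[x --> F] --> \prod_(i <- r) l i.
Proof.
move=> fl; elim: r => [|i r IH].
  by rewrite big_nil; under eq_cvg do rewrite big_nil; exact: cvg_cst.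
rewrite big_cons; under eq_cvg do rewrite big_cons.
by apply: cvgM; [exact: fl | exact: IH].
Qed.

Lemma cvg_det (T : Type) (F : set_system T) {FF : Filter F} m
    (M : T -> 'M[C]_m) (L : 'M[C]_m) :
  (forall i j, M x i j @[x --> F] --> L i j) -> \det (M x) @[x --> F] --> \det L.
Proof.
move=> ML; rewrite /determinant; apply: cvg_bigsum => s; apply: cvgM; first exact: cvg_cst.
by apply: cvg_prodC => i; exact: ML.
Qed.

Lemma singular_right_kernel (E : 'M[C]_n.+1) : \det E = 0 ->
  exists2 y : V, y != 0 & forall k, \sum_l E k l * y 0 l = 0.
Proof.
move=> E0; have : kermx E^T != 0.
  rewrite kermx_eq0 row_free_unit unitmxE det_tr E0 unitr0 //.
case/rowV0Pn => y /sub_kermxP yK y0; exists y => // k.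
move/rowP/(_ k): yK; rewrite !mxE => yK; rewrite -[RHS]yK.
by apply: eq_bigr => l _; rewrite mxE mulrC.
Qed.

(* When dbar f vanishes at z the determinant of the Levi form vanishes there:
   it does at the points near z where dbar f is nonzero, and it does if dbar f
   vanishes near z. *)
Lemma qholo_null_direction U f z : open U -> U z -> qholo n U f ->
  exists2 w : V, w != 0 & delb w f z = 0 /\ del w (delb w f) z = 0.
Proof.
move=> oU Uz [Hf H0].
pose a z l := wirtbar l f z; pose b z k l := wirt k (wirtbar l f) z.
pose E z := \matrix_(k, l) b z k l : 'M[C]_n.+1.
have ker y : U y -> (exists l, a y l != 0) ->
    exists2 w : V, w != 0 & acoef (a y) w = 0 /\ forall k, bcoef (b y) k w = 0.
  move=> Uy; apply: omega_kernel => vs.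
  by rewrite -[LHS]/(Defs.wedge (dbar f y) (wedge_pow (ddbar f y) n) vs) H0.
have fin w : w != 0 -> acoef (a z) w = 0 -> (forall k, bcoef (b z) k w = 0) ->
    exists2 w : V, w != 0 & delb w f z = 0 /\ del w (delb w f) z = 0.
  (* The coefficients act on the conjugate of a direction, so the kernel vector is conjugated. *)
  move=> w0 aw bw; exists (conjv w).
    apply: contra w0 => /eqP/rowP w0; apply/eqP/rowP => l.
    by have := w0 l; rewrite !mxE -{2}conjC0 => /(congr1 (fun x => x^* )); rewrite !cconjK.
  have wK l : ((conjv w) 0 l)^* = w 0 l by rewrite mxE cconjK.
  split.
    rewrite (delbE oU Uz _ (CkcS Hf)) -[RHS]aw; apply: eq_bigr => l _.
    by rewrite wK.
  rewrite (del_delbE _ _ oU Uz Hf) big1 // => k _.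
  transitivity ((conjv w) 0 k * bcoef (b z) k w); last by rewrite bw mulr0.
  rewrite mulr_sumr; apply: eq_bigr => l _.
  by rewrite wK -mulrA mulrCA.
have [[l al]|a0] := pselect (exists l, a z l != 0).
  by have [w w0 [aw bw]] := ker z Uz (ex_intro _ l al); exact: (fin w).
have {}a0 l : a z l = 0.
  by apply/eqP/negPn/negP => al; apply: a0; exists l.
have detn y : U y -> (exists l, a y l != 0) -> \det (E y) = 0.
  move=> Uy /(ker y Uy)[w w0 [_ bw]]; apply/eqP; rewrite -det_tr; apply/det0P.
  exists w => //; apply/rowP => k; rewrite !mxE -[RHS](bw k).
  by apply: eq_bigr => l _; rewrite !mxE mulrC.
have Hb l : Ckc 1 U (wirtbar l f) by exact: Ckc_delb.
have Hbb k l : Ckc 0 U (wirt k (wirtbar l f)).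
  split.
    apply: (Ck_ext oU (fun y _ => esym (Re_del (ebasis k) (wirtbar l f) y))).
    by apply: CkZ => //; apply: CkD => //; apply: Ck_rderiv; case: (Hb l).
  apply: (Ck_ext oU (fun y _ => esym (Im_del (ebasis k) (wirtbar l f) y))).
  by apply: CkZ => //; apply: CkB => //; apply: Ck_rderiv; case: (Hb l).
have detz : \det (E z) = 0.
  apply/eqP/negPn/negP => dz.
  have cE : \det (E y) @[y --> z] --> \det (E z).
    apply: (@cvg_det V (nbhs z) _ n.+1 E (E z)) => k l.
    have -> : (fun y => E y k l) = (fun y => b y k l) by apply/funext => y; rewrite mxE.
    have -> : E z k l = b z k l by rewrite mxE.
    exact: (Ckc_cvg (Hbb k l) Uz).
  have nd : nbhs z [set y | \det (E y) != 0].
    apply: (cE [set x | x != 0]); apply/nbhs_ballP; exists `|\det (E z)|; first by rewrite /= normr_gt0.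
    move=> x; rewrite /ball /= => xz; apply: contraTneq xz => ->.
    by rewrite subr0 ltxx.
  pose O := [set y | \det (E y) != 0 /\ U y]°.
  have Oz : O z by apply: filterI nd (open_nbhs_nbhs (conj oU Uz)).
  have aO y l : O y -> wirtbar l f y = 0.
    move=> /interior_subset [dy Uy]; apply/eqP/negPn/negP => al.
    by move/eqP: dy; apply; apply: detn => //; exists l.
  have b0 k l : b z k l = 0.
    have oO : open O by exact: open_interior.
    have OU : O `<=` U by move=> y /interior_subset [].
    have HO : Ckc 1 O (wirtbar l f) by case: (Hb l) => h1 h2; split; exact: Ck_sub OU _.
    rewrite /b (wirtE k (wirtbar l f)) (del_ext oO Oz (ebasis k) HO (fun y Oy => aO y l Oy)).
    have c0 v : cderiv v (fun=> (0 : C)) z = 0.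
      by apply: eqCplx => /=; apply: hasd_rderiv; exact: hasd_cst.
    by rewrite /del !c0 mulr0 subr0 mulr0.
  move/eqP: dz; apply; have -> : E z = 0 by apply/matrixP => k l; rewrite !mxE b0.
  exact: det0.
have [y y0 Hy] := singular_right_kernel detz.
apply: (fin y y0) => [|k].
  by rewrite /acoef big1 // => l _; rewrite a0 mul0r.
by rewrite -[RHS](Hy k); apply: eq_bigr => l _; rewrite mxE.
Qed.

End NullDirection.

(** * Second-order conditions at a maximum of [|f|^2 e^L] *)

Section LaplacianRules.
Context {R : realType} {N : nat}.
Local Notation V := ('C[R]^N).
Local Notation C := (Cplx R).
Implicit Types (v w z : V) (g h : V -> R) (U : set V).

Lemma rderivD U v g h z : U z -> Ck 1 U g -> Ck 1 U h ->
  rderiv v (fun y => g y + h y) z = rderiv v g z + rderiv v h z.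
Proof.
by move=> Uz Hg Hh; apply: hasd_rderiv; apply: hasdD; [exact: Ck_hasd Hg Uz|exact: Ck_hasd Hh Uz].
Qed.
Lemma rderivM U v g h z : U z -> Ck 1 U g -> Ck 1 U h ->
  rderiv v (fun y => g y * h y) z = g z * rderiv v h z + h z * rderiv v g z.
Proof.
by move=> Uz Hg Hh; apply: hasd_rderiv; apply: hasdM; [exact: Ck_hasd Hg Uz|exact: Ck_hasd Hh Uz].
Qed.
Lemma rderivZ U v (c : R) g z : U z -> Ck 1 U g ->
  rderiv v (fun y => c * g y) z = c * rderiv v g z.
Proof.
move=> Uz Hg; have := hasd_rderiv (hasdM (hasd_cst v z c) (Ck_hasd v Hg Uz)).
by rewrite mulr0 addr0.
Qed.
Lemma rderiv_exp U v g z : U z -> Ck 1 U g ->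
  rderiv v (fun y => expR (g y)) z = expR (g z) * rderiv v g z.
Proof. by move=> Uz Hg; apply: hasd_rderiv; apply: hasd_comp; exact: Ck_hasd Hg Uz. Qed.

Lemma rderiv2D U v g h z : open U -> U z -> Ck 2 U g -> Ck 2 U h ->
  rderiv v (rderiv v (fun y => g y + h y)) z =
  rderiv v (rderiv v g) z + rderiv v (rderiv v h) z.
Proof.
move=> oU Uz Hg Hh.
rewrite -(rderivD v Uz (Ck_rderiv v Hg) (Ck_rderiv v Hh)).
apply: (rderiv_ext oU Uz) => [y Uy|]; first exact: (rderivD v Uy (CkS Hg) (CkS Hh)).
by apply: hasd_rderivable (Ck_hasd v (Ck_rderiv v (CkD oU Hg Hh)) Uz).
Qed.
Lemma rderiv2Z U v (c : R) g z : open U -> U z -> Ck 2 U g ->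
  rderiv v (rderiv v (fun y => c * g y)) z = c * rderiv v (rderiv v g) z.
Proof.
move=> oU Uz Hg; rewrite -(rderivZ v c Uz (Ck_rderiv v Hg)).
apply: (rderiv_ext oU Uz) => [y Uy|]; first exact: (rderivZ v c Uy (CkS Hg)).
by apply: hasd_rderivable (Ck_hasd v (Ck_rderiv v (CkZ c oU Hg)) Uz).
Qed.
Lemma rderiv2M U v g h z : open U -> U z -> Ck 2 U g -> Ck 2 U h ->
  rderiv v (rderiv v (fun y => g y * h y)) z =
  g z * rderiv v (rderiv v h) z + 2 * (rderiv v g z * rderiv v h z)
  + h z * rderiv v (rderiv v g) z.
Proof.
move=> oU Uz Hg Hh.
transitivity (rderiv v (fun y => g y * rderiv v h y + h y * rderiv v g y) z).
  apply: (rderiv_ext oU Uz) => [y Uy|]; first exact: (rderivM v Uy (CkS Hg) (CkS Hh)).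
  by apply: hasd_rderivable (Ck_hasd v (Ck_rderiv v (CkM oU Hg Hh)) Uz).
have Hg' := Ck_rderiv v Hg; have Hh' := Ck_rderiv v Hh.
rewrite (rderivD v Uz (CkM oU (CkS Hg) Hh') (CkM oU (CkS Hh) Hg')).
rewrite (rderivM v Uz (CkS Hg) Hh') (rderivM v Uz (CkS Hh) Hg').
by move: (rderiv v (rderiv v h) z) (rderiv v (rderiv v g) z) (rderiv v g z) (rderiv v h z) => x y s t; ring.
Qed.
Lemma rderiv2_exp U v g z : open U -> U z -> Ck 2 U g ->
  rderiv v (rderiv v (fun y => expR (g y))) z =
  expR (g z) * (rderiv v (rderiv v g) z + rderiv v g z ^+ 2).
Proof.
move=> oU Uz Hg; have Hg' := Ck_rderiv v Hg.
transitivity (rderiv v (fun y => expR (g y) * rderiv v g y) z).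
  apply: (rderiv_ext oU Uz) => [y Uy|]; first exact: (rderiv_exp v Uy (CkS Hg)).
  by apply: hasd_rderivable (Ck_hasd v (Ck_rderiv v (Ck_exp oU Hg)) Uz).
rewrite (rderivM v Uz (Ck_exp oU (CkS Hg)) Hg') (rderiv_exp v Uz (CkS Hg)).
by move: (rderiv v (rderiv v g) z) (rderiv v g z) => x y; ring.
Qed.

Lemma lap_lin w (c d : R) g h U z : open U -> U z -> Ck 2 U g -> Ck 2 U h ->
  lap w (fun y => c * g y + d * h y) z = c * lap w g z + d * lap w h z.
Proof.
move=> oU Uz Hg Hh.
have E v : rderiv v (rderiv v (fun y => c * g y + d * h y)) z =
    c * rderiv v (rderiv v g) z + d * rderiv v (rderiv v h) z.
  rewrite (rderiv2D v oU Uz (CkZ c oU Hg) (CkZ d oU Hh)).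
  by rewrite (rderiv2Z v c oU Uz Hg) (rderiv2Z v d oU Uz Hh).
rewrite /lap (E w) (E ('i *: w)).
move: (rderiv w (rderiv w g) z) (rderiv ('i *: w) (rderiv ('i *: w) g) z)
  (rderiv w (rderiv w h) z) (rderiv ('i *: w) (rderiv ('i *: w) h) z) => x y s t; ring.
Qed.

Lemma second_order_max U g z v : open U -> U z -> Ck 2 U g ->
  (\forall y \near z, g y <= g z) -> rderiv v g z = 0 /\ rderiv v (rderiv v g) z <= 0.
Proof.
move=> oU Uz Hg gmax.
have [d d0 Hd] := nbhs_line v (filterI gmax (open_nbhs_nbhs (conj oU Uz))).
have := @second_derivative_max R (rline g v z) (fun t => rderiv v g (z + (t%:C)%C *: v))
   (rderiv v (rderiv v g) z) d d0.
rewrite scale0r addr0; apply.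
- move=> t td; apply: is_derive_rline; apply: Ck_hasd Hg _; exact: (Hd t td).2.
- exact: (Ck_hasd v (Ck_rderiv v Hg) Uz).
- by move=> t td; rewrite /rline scale0r addr0; exact: (Hd t td).1.
Qed.

Lemma hasd_nsqB (c v z : V) : hasd v (fun y => nsq (y - c)) z (2 * dotr (z - c) v).
Proof.
rewrite /hasd.
have -> : rline (fun y => nsq (y - c)) v z =
    cst (nsq (z - c)) + ((2 * dotr (z - c) v) \*: id) + (nsq v \*: (id * id)).
  apply/funext => t; rewrite /rline addrAC (nsqD (z - c)) nsqZ dotrZr.
  transitivity (nsq (z - c) + (2 * dotr (z - c) v) * t + nsq v * (t * t)); last by [].
  by move: (nsq (z - c)) (dotr (z - c) v) (nsq v) => x y r; ring.
have H1 : is_derive (0 : R) (1 : R) (cst (nsq (z - c))) (0 : R) by exact: is_derive_cst.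
have Hid : is_derive (0 : R) (1 : R) (id : R -> R) (1 : R) by exact: is_derive_id.
have H2 := @is_deriveZ R R R id (2 * dotr (z - c) v) 0 1 1 Hid.
have H3 := @is_deriveZ R R R _ (nsq v) 0 1 _ (@is_deriveM R R id id 0 1 1 1 Hid Hid).
have := is_deriveD (is_deriveD H1 H2) H3; congr is_derive.
by rewrite add0r scale0r addr0 scaler0 addr0 [LHS]mulr1.
Qed.

Lemma rderiv_nsqB (c v : V) : rderiv v (fun y => nsq (y - c)) = fun z => 2 * dotr (z - c) v.
Proof. by apply/funext => z; exact: hasd_rderiv (hasd_nsqB c v z). Qed.

Lemma Ck_nsqB k U (c : V) : open U -> Ck k U (fun y => nsq (y - c)).
Proof.
move=> oU; case: k => [|k]; first by split=> // z _; exact: continuous_nsqB.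
apply: (@Ck_intro _ _ _ _ _ (fun v z => 2 * dotr (z - c) v)) => // [z _|v z _|v].
- exact: continuous_nsqB.
- exact: hasd_nsqB.
apply: (Ck_ext (f := fun y => 2 * (rform (map_mx (fun x => x^* ) v) y - dotr v c))) => //.
  by move=> y _; rewrite -dotr_rform -dotrNr -dotrDr dotrC.
by apply: CkZ => //; apply: CkB => //; [exact: Ck_rform | exact: Ck_cst].
Qed.

Lemma lap_nsqB (c w z : V) : lap w (fun y => nsq (y - c)) z = 4 * nsq w.
Proof.
have E v : rderiv v (rderiv v (fun y => nsq (y - c))) z = 2 * nsq v.
  rewrite rderiv_nsqB; apply: hasd_rderiv.
  have := hasdM (hasd_cst v z 2) (hasdD (hasd_rform (map_mx (fun x => x^* ) v) v z)
    (hasd_cst v z (- dotr v c))).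
  rewrite mulr0 !addr0 -dotr_rform; congr hasd; apply/funext => y.
  by rewrite -dotr_rform -dotrNr -dotrDr dotrC.
have -> : lap w (fun y => nsq (y - c)) z = 2 * nsq w + 2 * nsq ('i *: w).
  by rewrite /lap !E.
have -> : nsq ('i *: w) = nsq w.
  rewrite !nsq_sum; apply: eq_bigr => j _.
  by rewrite !normcE2 mxE Re_imul Im_imul sqrrN addrC.
by ring.
Qed.

(** Here [a + i b] is the value of [f], [L] the weight, and the suffixes denote derivatives along
    [w] and [i w]. Multiplied by [P] and simplified by the first-order conditions, the two
    second-order conditions add up to [P ^+ 2] times the Laplacian of [L]: by the Cauchy-Riemann
    equations and Lagrange's identity the first derivatives of [f] cancel. *)
Lemma log_max_algebra (a b aw bw ai bi aww bww aii bii dLw dLi d2Lw d2Li : R) :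
  let P := a ^+ 2 + b ^+ 2 in 0 < P ->
  aw = bi -> bw = - ai -> aww + aii = 0 -> bww + bii = 0 ->
  2 * (a * aw + b * bw) + P * dLw = 0 -> 2 * (a * ai + b * bi) + P * dLi = 0 ->
  2 * (aw ^+ 2 + bw ^+ 2 + a * aww + b * bww) + 2 * (a * aw + b * bw) * dLw + P * d2Lw <= 0 ->
  2 * (ai ^+ 2 + bi ^+ 2 + a * aii + b * bii) + 2 * (a * ai + b * bi) * dLi + P * d2Li <= 0 ->
  d2Lw + d2Li <= 0.
Proof.
move=> P P0 -> -> /eqP; rewrite addr_eq0 => /eqP -> /eqP; rewrite addr_eq0 => /eqP ->.
move=> /eqP; rewrite addr_eq0 => /eqP E1 /eqP; rewrite addr_eq0 => /eqP E2 I1 I2.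
have := mulr_ge0_le0 (ltW P0) I1; have := mulr_ge0_le0 (ltW P0) I2.
rewrite !mulrDr (mulrCA P _ dLi) (mulrCA P _ dLw).
have -> : P * dLi = - (2 * (a * ai + b * bi)) by rewrite E2 opprK.
have -> : P * dLw = - (2 * (a * bi + b * - ai)) by rewrite E1 opprK.
move=> J2 J1.
have : P ^+ 2 * (d2Lw + d2Li) <= 0.
  apply: le_trans (_ : _ <= _) (_ : _ <= 0); last first.
    have := lerD J1 J2; rewrite addr0; apply.
  by rewrite le_eqVlt; apply/orP; left; apply/eqP; rewrite /P; ring.
by rewrite pmulr_rle0 // exprn_gt0.
Qed.

(** To second order at [z], [f] behaves along [w] like a holomorphic function: [delb w f z = 0]
    gives the Cauchy-Riemann equations, and the vanishing Levi form makes both parts harmonic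
    there. *)
Lemma log_max_null_direction U z (f : V -> C) (L : V -> R) w :
  open U -> U z -> Ckc 2 U f -> Ck 2 U L -> f z != 0 ->
  delb w f z = 0 -> del w (delb w f) z = 0 ->
  (\forall y \near z, (complex.Re (f y) ^+ 2 + complex.Im (f y) ^+ 2) * expR (L y) <=
                      (complex.Re (f z) ^+ 2 + complex.Im (f z) ^+ 2) * expR (L z)) ->
  lap w L z <= 0.
Proof.
move=> oU Uz [Ha Hb] HL fz0 D1 D2 max.
set a := fun y => complex.Re (f y) in Ha; set b := fun y => complex.Im (f y) in Hb.
pose P y := a y * a y + b y * b y.
have HP : Ck 2 U P by exact: (CkD oU (CkM oU Ha Ha) (CkM oU Hb Hb)).
have P0 : 0 < P z.
  rewrite lt_def; apply/andP; split; last by rewrite /P -!expr2 addr_ge0 // sqr_ge0.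
  apply: contra fz0; rewrite /P -!expr2 paddr_eq0 ?sqr_ge0 // !sqrf_eq0 => /andP[/eqP az /eqP bz].
  by apply/eqP; exact: eqCplx.
have PE v : rderiv v P z = 2 * (a z * rderiv v a z + b z * rderiv v b z).
  rewrite (rderivD v Uz (CkM oU (CkS Ha) (CkS Ha)) (CkM oU (CkS Hb) (CkS Hb))).
  rewrite (rderivM v Uz (CkS Ha) (CkS Ha)) (rderivM v Uz (CkS Hb) (CkS Hb)).
  by move: (rderiv v a z) (rderiv v b z) => x y; ring.
have P2E v : rderiv v (rderiv v P) z = 2 * (rderiv v a z ^+ 2 + rderiv v b z ^+ 2 +
    a z * rderiv v (rderiv v a) z + b z * rderiv v (rderiv v b) z).
  rewrite (rderiv2D v oU Uz (CkM oU Ha Ha) (CkM oU Hb Hb)).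
  rewrite (rderiv2M v oU Uz Ha Ha) (rderiv2M v oU Uz Hb Hb).
  move: (rderiv v (rderiv v a) z) (rderiv v (rderiv v b) z) (rderiv v a z) (rderiv v b z).
  by move=> x y s t; ring.
have HeL := Ck_exp oU HL.
have key v : 2 * (a z * rderiv v a z + b z * rderiv v b z) + P z * rderiv v L z = 0 /\
   2 * (rderiv v a z ^+ 2 + rderiv v b z ^+ 2 +
    a z * rderiv v (rderiv v a) z + b z * rderiv v (rderiv v b) z) +
   2 * (a z * rderiv v a z + b z * rderiv v b z) * rderiv v L z + P z * rderiv v (rderiv v L) z <= 0.
  have [] := second_order_max v oU Uz (CkM oU HP HeL).
    by apply: filterS max => y; rewrite !expr2.
  rewrite (rderivM v Uz (CkS HP) (CkS HeL)) (rderiv2M v oU Uz HP HeL).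
  rewrite (rderiv_exp v Uz (CkS HL)) (rderiv2_exp v oU Uz HL) -PE -P2E.
  have e0 := expR_gt0 (L z); move: (expR (L z)) e0 => e e0.
  move: (rderiv v (rderiv v P) z) (rderiv v (rderiv v L) z) (rderiv v P z) (rderiv v L z) (P z).
  move=> P2 L2 P1 L1 p H1 H2.
  have E1 : P1 + p * L1 = 0.
    by apply: (mulfI (lt0r_neq0 e0)); rewrite mulr0 -[RHS]H1; ring.
  split=> //; rewrite -(pmulr_rle0 _ e0); apply: le_trans H2.
  rewrite le_eqVlt; apply/orP; left; apply/eqP.
  have -> : p * (e * (L2 + L1 ^+ 2)) + 2 * (P1 * (e * L1)) + e * P2 =
     e * (P2 + P1 * L1 + p * L2) + e * L1 * (P1 + p * L1) by ring.
  by rewrite E1 mulr0 addr0.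
have [Kw1 Kw2] := key w; have [Ki1 Ki2] := key ('i *: w).
have h2 : (2^-1 : R) != 0 by rewrite invr_eq0 pnatr_eq0.
have h4 : (4^-1 : R) != 0 by rewrite invr_eq0 pnatr_eq0.
have CR1 : rderiv w a z = rderiv ('i *: w) b z.
  have := congr1 (@complex.Re R) D1; rewrite Re_delb => /eqP.
  by rewrite mulf_eq0 (negbTE h2) /= subr_eq0 => /eqP.
have CR2 : rderiv w b z = - rderiv ('i *: w) a z.
  have := congr1 (@complex.Im R) D1; rewrite Im_delb => /eqP.
  by rewrite mulf_eq0 (negbTE h2) /= addr_eq0 => /eqP.
move: D2; rewrite (del_delb_lap w oU Uz (conj Ha Hb)) => D2.
have La : lap w a z = 0.
  by have /eqP := congr1 (@complex.Re R) D2; rewrite /= mulf_eq0 (negbTE h4) => /eqP.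
have Lb : lap w b z = 0.
  by have /eqP := congr1 (@complex.Im R) D2; rewrite /= mulf_eq0 (negbTE h4) => /eqP.
have PE2 : P z = a z ^+ 2 + b z ^+ 2 by rewrite !expr2.
rewrite PE2 in P0 Kw1 Kw2 Ki1 Ki2.
exact: (log_max_algebra P0 CR1 CR2 La Lb Kw1 Ki1 Kw2 Ki2).
Qed.

End LaplacianRules.

Section LogAbs.
Context {R : realType}.
Local Notation C := (Cplx R).
Implicit Types (x : C) (a : R).

Definition lognorm x : \bar R := lne (Normc.normc x)%:E.

Lemma lognorm_lt x a : (lognorm x < a%:E)%E = (Normc.normc x < expR a).
Proof.
rewrite /lognorm /=; case: ifPn => x0; first by rewrite ltNyr (le_lt_trans x0) // expR_gt0.
rewrite -ltNge in x0; rewrite lte_fin -(ltr_expR (ln _)) lnK //.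
Qed.
Lemma lognorm_le x a : (lognorm x <= a%:E)%E = (Normc.normc x <= expR a).
Proof.
rewrite /lognorm /=; case: ifPn => x0.
  by rewrite leNye (le_trans x0) // ltW // expR_gt0.
rewrite -ltNge in x0; rewrite lee_fin -(ler_expR (ln _)) lnK //.
Qed.

Lemma lognorm_monotone x y : (lognorm x <= lognorm y)%E = (Normc.normc x <= Normc.normc y).
Proof.
have [y0|y0] := leP (Normc.normc y) 0.
  have Ny : lognorm y = -oo%E by rewrite /lognorm /= y0.
  have yE : Normc.normc y = 0 by apply/eqP; rewrite eq_le y0 normc_ge0'.
  rewrite Ny yE /lognorm /=; case: ifP => x0; first by rewrite lexx.
  by rewrite leeNy_eq.
have -> : lognorm y = (ln (Normc.normc y))%:E by rewrite /lognorm /= leNgt y0.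
by rewrite lognorm_le lnK.
Qed.

Lemma lognorm_ltpinfty x : (lognorm x < +oo)%E.
Proof. by rewrite /lognorm /=; case: ifP => _; rewrite ?ltNyy ?ltry. Qed.

Lemma usc_lognorm (T : topologicalType) (A : set T) (f : T -> C) :
  {within A, continuous f} -> usc_on A (fun z => lognorm (f z)).
Proof.
move=> /subspace_continuousP cf x Ax; split; first exact: lognorm_ltpinfty.
move=> a; rewrite lognorm_lt => xa.
have e0 : 0 < expR a - Normc.normc (f x) by rewrite subr_gt0.
have : nbhs (f x) [set y | Normc.normc y < expR a].
  apply/nbhs_ballP; exists ((expR a - Normc.normc (f x))%:C)%C; first by rewrite /= ltcR.
  move=> y; rewrite /ball /= normE ltcR => xy.
  have := le_normcD (y - f x) (f x); rewrite subrK => /le_lt_trans; apply.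
  by rewrite -ltrBrDr -normcN opprB.
move=> /(cf x Ax) H; have {}H : within A (nbhs x) [set y | Normc.normc (f y) < expR a] by exact: H.
by apply: filterS H => y; rewrite /= lognorm_lt.
Qed.

End LogAbs.

Section LogSubpluriharmonic.
Context {R : realType} {n : nat}.
Local Notation V := ('C[R]^(n.+1)).
Local Notation C := (Cplx R).
Implicit Types (f : V -> C) (U : set V).

Lemma compact_closure_eball (c : V) (r : R) : compact (closure (eball c r)).
Proof.
apply: (@compact_bounded_closed _ _ _ (2 * r ^+ 2 + 2 * nsq c)).
  exact: closed_closure.
move=> z /sub_closure_eball /= zr.
have := nsqD (z - c) c; rewrite subrK => ->.
have := nsq_ge0 (z - c - c); rewrite (nsqB (z - c)); lra.
Qed.

Lemma open_continuous_within U f : open U ->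
  (forall z, U z -> {for z, continuous f}) -> {within U, continuous f}.
Proof. by move=> oU cf; apply: continuous_in_subspaceT => z; rewrite inE; exact: cf. Qed.

Lemma subpluriharmonic_lognorm U f : open U -> qholo n U f ->
  subpluriharmonic U (fun z => lognorm (f z)).
Proof.
move=> oU qf; have Hf : Ckc 2 U f by case: qf.
split.
  apply: usc_lognorm; apply: open_continuous_within => // z Uz; exact: Ckc_cvg Hf Uz.
move=> c r h W r0 BU oW BW [Hh Hp] ubd z Bz.
rewrite leNgt; apply/negP => hz; have {}hz : expR (h z) < Normc.normc (f z).
  by move: hz; rewrite ltNge lognorm_le -ltNge.
(* The square of [|f|] is of class C2 even at the zeros of [f]. *)
pose P y := complex.Re (f y) ^+ 2 + complex.Im (f y) ^+ 2.
have PE y : P y = Normc.normc (f y) ^+ 2 by rewrite normcE2.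
pose q0 := P z * expR (- 2 * h z).
have expN2 y : expR (- 2 * h y) = (expR (h y) ^+ 2)^-1.
  by rewrite mulNr expRN mulr_natl mulr2n expRD expr2.
have q1 : 1 < q0.
  rewrite /q0 PE expN2 ltr_pdivlMr ?exprn_gt0 ?expR_gt0 // mul1r.
  by rewrite ltr_pXn2r ?nnegrE ?normc_ge0' // ltW // expR_gt0.
have q00 : 0 < q0 := lt_trans ltr01 q1.
(* With this [eps] the factor [expR (2 * eps * r ^+ 2)] on the sphere is the square root of
   [q0 > 1]. Boundary values of [Psi] thus stay below [q0 <= Psi z], which forces an interior
   maximum. *)
pose eps := ln q0 / (4 * r ^+ 2).
have r20 : 0 < r ^+ 2 by rewrite exprn_gt0.
have eps0 : 0 < eps by rewrite divr_gt0 ?mulr_gt0 // ln_gt0.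
pose L y := - 2 * h y + (2 * eps) * nsq (y - c).
pose O := U `&` W.
have oO : open O by exact: openI.
have HhO : Ck 2 O h by apply: Ck_sub Hh => y [].
have HL : Ck 2 O L by exact: (CkD oO (CkZ (-2) oO HhO) (CkZ (2 * eps) oO (Ck_nsqB 2 c oO))).
have HfO : Ckc 2 O f by case: Hf => H1 H2; split; [apply: Ck_sub H1 | apply: Ck_sub H2] => y [].
pose Psi y := P y * expR (L y).
have HP : Ck 2 O P.
  have [H1 H2] := HfO.
  have := CkD oO (CkM oO H1 H1) (CkM oO H2 H2); apply: Ck_ext => // y _.
have HPsi : Ck 2 O Psi by exact: (CkM oO HP (Ck_exp oO HL)).
pose K := closure (eball c r).
have KO y : K y -> O y by move=> Ky; split; [exact: BU|exact: BW].
pose T := expR (2 * eps * r ^+ 2).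
have Tz : T < Psi z.
  have E : 2 * eps * r ^+ 2 < ln q0.
    rewrite /eps invfM; move: (ln q0) (ln_gt0 q1) => l l0.
    have -> : 2 * (l * (4^-1 * (r ^+ 2)^-1)) * r ^+ 2 = l / 2.
      by field; rewrite gt_eqF.
    by rewrite ltr_pdivrMr // mulr_natr mulr2n ltrDl.
  apply: (@lt_le_trans _ _ q0); first by rewrite -(lnK (x:=q0)) // ltr_expR.
  rewrite /Psi /L expRD mulrA -/q0 ler_peMr ?(ltW q00) // -expR0 ler_expR.
  by rewrite mulr_ge0 ?nsq_ge0 // mulr_ge0 // ltW.
have [z1 Kz1 max1] : exists2 c0, c0 \in K & forall t, t \in K -> Psi t <= Psi c0.
  apply: compact_EVT_max; first by exists z; exact: subset_closure.
    exact: compact_closure_eball.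
  apply: continuous_in_subspaceT => y; rewrite inE => /KO Oy; exact: Ck_cont HPsi Oy.
have Kz1' : K z1 by rewrite inE in Kz1.
have Tz1 : T < Psi z1.
  by apply: lt_le_trans Tz (max1 z _); rewrite inE; exact: subset_closure.
have B1 : eball c r z1.
  apply: contrapT => NB; have bz1 : bd (eball c r) z1.
    by split=> //; move/interior_subset.
  have nz1 : nsq (z1 - c) = r ^+ 2 by move: (bz1); rewrite bd_eballE.
  have := ubd z1 bz1; rewrite lognorm_le => f1.
  move: Tz1; rewrite /Psi /L expRD nz1 mulrA ltNge => /negP; apply.
  rewrite -[leRHS]mul1r ler_pM2r ?expR_gt0 // expN2 PE.
  rewrite ler_pdivrMr ?exprn_gt0 ?expR_gt0 // mul1r.
  by rewrite ler_pXn2r ?nnegrE ?normc_ge0' // ltW // expR_gt0.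
have fz1 : f z1 != 0.
  apply/eqP => f0; move: Tz1; rewrite /Psi PE f0 Normc.normc0 expr0n mul0r.
  by rewrite ltNge ltW // expR_gt0.
have Oz1 := KO z1 Kz1'.
have [w w0 [D1 D2]] := qholo_null_direction oU Oz1.1 qf.
have : lap w L z1 <= 0.
  apply: (log_max_null_direction oO Oz1 HfO HL fz1 D1 D2).
  have : nbhs z1 (eball c r) by apply: open_nbhs_nbhs; split=> //; exact: open_eball.
  by apply: filterS => y By; apply: max1; rewrite inE; exact: subset_closure.
have lapL : lap w L z1 = -2 * lap w h z1 + 2 * eps * lap w (fun y => nsq (y - c)) z1.
  exact: (lap_lin w (-2) (2 * eps) oO Oz1 HhO (Ck_nsqB 2 c oO)).
rewrite lapL (pluriharmonic_lap w oW Oz1.2 (conj Hh Hp)) lap_nsqB mulr0 add0r leNgt.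
by move/negP; apply; apply: mulr_gt0; apply: mulr_gt0 => //; exact: nsq_gt0.
Qed.

End LogSubpluriharmonic.

(** * From holomorphy along planes to q-holomorphy *)

Section HolomorphicLines.
Context {R : realType} {N : nat}.
Local Notation V := ('C[R]^N).
Local Notation C := (Cplx R).
Implicit Types (f : V -> C) (U : set V).

Lemma hasd_quot (v z : V) (g : V -> R) (l : R) :
  (fun t : R => t^-1 * (g (z + (t%:C)%C *: v) - g z)) @ 0^' --> l -> hasd v g z l.
Proof.
move=> H.
have E : (fun h : R => h^-1 *: ((rline g v z \o shift 0) (h *: 1) - rline g v z 0)) =
         (fun t : R => t^-1 * (g (z + (t%:C)%C *: v) - g z)).
  apply/funext => t; rewrite /rline /= addr0 [t *: 1]mulr1 scale0r addr0 //.
apply: DeriveDef.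
  by rewrite /derivable E; apply/cvg_ex; exists l.
by rewrite /derive E; apply: cvg_lim.
Qed.

Lemma cvg_line_dnbhs (c : C) : c != 0 -> (fun t : R => (t%:C)%C * c) @ 0^' --> (0 : C)^'.
Proof.
move=> c0 A HA.
have cc : (fun t : R => (t%:C)%C * c) @ (0 : R) --> (0 : C).
  rewrite -[X in _ --> X](mul0r c); apply: cvgM; last exact: cvg_cst.
  exact: continuous_RtoC.
have H := cc _ HA.
have {}H : nbhs (0 : R) [set t : R | (t%:C)%C * c != 0 -> A ((t%:C)%C * c)] by exact: H.
apply: filterS H => t H t0; apply: H; rewrite mulf_neq0 //.
by apply: contra t0 => /eqP [->].
Qed.

Lemma cderiv_line f (y v : V) (d c : C) : c != 0 ->
  (fun h : C => h^-1 * (f (y + h *: v) - f y)) @ 0^' --> d ->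
  cderiv (c *: v) f y = c * d.
Proof.
move=> c0 Hd.
have Hg : (fun t : R => ((t%:C)%C)^-1 * (f (y + (t%:C)%C *: (c *: v)) - f y)) @ 0^' --> c * d.
  have -> : (fun t : R => ((t%:C)%C)^-1 * (f (y + (t%:C)%C *: (c *: v)) - f y)) =
      (fun t : R => c * (((t%:C)%C * c)^-1 * (f (y + ((t%:C)%C * c) *: v) - f y))).
    apply/funext => t; rewrite scalerA invfM mulrA (mulrCA c) mulfV // mulr1 //.
  apply: cvgM; first exact: cvg_cst.
  exact: (cvg_comp (fun t : R => (t%:C)%C * c) (fun h : C => h^-1 * (f (y + h *: v) - f y))
    (cvg_line_dnbhs c0) Hd).
have Rinv (t : R) : ((t%:C)%C : C)^-1 = ((t^-1)%:C)%C by rewrite fmorphV.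
apply: eqCplx => /=; apply: hasd_rderiv; apply: hasd_quot.
  under eq_fun do rewrite -cReN -cReD -cReZ -Rinv.
  exact: (cvg_comp _ (fun x : C => complex.Re x) Hg (@continuous_Re R (c * d))).
under eq_fun do rewrite -cImN -cImD -cImZ -Rinv.
exact: (cvg_comp _ (fun x : C => complex.Im x) Hg (@continuous_Im R (c * d))).
Qed.

Lemma delb_holo f (y v : V) (d : C) :
  (fun h : C => h^-1 * (f (y + h *: v) - f y)) @ 0^' --> d -> delb v f y = 0.
Proof.
move=> Hd; have i0 : ('i : C) != 0 by exact: neq0Ci.
rewrite /delb (cderiv_line i0 Hd) -{1}[v]scale1r (cderiv_line (oner_neq0 C) Hd).
by rewrite mul1r mulrA ii mulN1r subrr mulr0.
Qed.

Lemma delb_holo_along k (A : 'M[C]_(k, N)) U f y i : U y -> holo_along A U f ->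
  delb (row i A) f y = 0.
Proof.
move=> Uy /(_ y 0); rewrite mul0mx addr0 => /(_ Uy) dif.
have := @diff_derivable _ _ _ _ _ (delta_mx 0 i : 'C[R]^k) dif; rewrite /derivable => /cvg_ex[d Hd].
apply: (@delb_holo _ _ _ d).
have <- : (fun h : C => h^-1 *: (((fun w : 'C[R]^k => f (y + w *m A)) \o shift 0) (h *: delta_mx 0 i)
    - f (y + 0 *m A))) = (fun h : C => h^-1 * (f (y + h *: row i A) - f y)); last exact: Hd.
by apply/funext => h /=; rewrite mul0mx !addr0 -scalemxAl -rowE.
Qed.

End HolomorphicLines.

Section PlaneHolomorphic.
Context {R : realType} {n : nat}.
Local Notation V := ('C[R]^(n.+1)).
Local Notation C := (Cplx R).
Implicit Types (f : V -> C) (U : set V).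

(** [delb (row i A) f] vanishes on all of [U], hence so do its derivatives; this is the condition on
    the second-order coefficients in [omega_vanish]. *)
Lemma qholo_plane_qholo q U f : (q <= n.+1)%N -> open U -> qholo_plane q U f -> qholo q U f.
Proof.
move=> qn oU [Hf [A [Afree HA]]]; split=> // z Uz; apply/funext => vs.
have Hf2 : Ckc 2 U f by [].
pose a l := wirtbar l f z; pose b k l := wirt k (wirtbar l f) z.
have dA i y : U y -> delb (row i A) f y = 0 by move=> Uy; exact: delb_holo_along Uy HA.
rewrite -[LHS]/(Defs.wedge (form01 a) (wedge_pow (form11 b) q) vs).
apply: (omega_vanish qn Afree) => [i|i k].
  rewrite -(dA i z Uz) (delbE oU Uz _ (CkcS Hf2)).
  by apply: eq_bigr => l _; rewrite !mxE.
have : del (ebasis k) (delb (row i A) f) z = 0.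
  have Hb : Ckc 1 U (delb (row i A) f) by exact: Ckc_delb.
  rewrite (del_ext oU Uz (ebasis k) Hb (fun y Uy => dA i y Uy)).
  have c0 v : cderiv v (fun=> (0 : C)) z = 0.
    by apply: eqCplx => /=; apply: hasd_rderiv; exact: hasd_cst.
  by rewrite /del !c0 mulr0 subr0 mulr0.
rewrite (del_delbE (ebasis k) (row i A) oU Uz Hf2) => H.
have Z j : j != k -> \sum_l wirt j (wirtbar l f) z * ebasis k 0 j * (row i A 0 l)^* = 0.
  move=> jk; apply: big1 => l _.
  by rewrite [ebasis k 0 j]mxE eqxx (negbTE jk) mulr0 mul0r.
rewrite (bigD1 k isT) in H; rewrite (big1 _ _ _ Z) Monoid.mulm1 in H.
rewrite -[RHS]H; apply: eq_bigr => l _.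
by rewrite [ebasis k 0 k]mxE !eqxx mulr1 mxE.
Qed.

End PlaneHolomorphic.

(** * Faces of convex bodies *)

Section LinearAlgebra.
Context {K : fieldType} {n : nat}.

(** A greedy extension by elements of [P] itself. In [face_coords], [P] is only a real subspace of a
    complex space, and the added vectors have to lie in it. *)
Lemma free_extension (P : set 'rV[K]_n) m0 (B0 : 'M[K]_(m0, n)) : row_free B0 ->
  exists m (B : 'M[K]_(m, n)), [/\ row_free (col_mx B0 B), forall i, P (row i B)
    & forall v, P v -> (v <= col_mx B0 B)%MS].
Proof.
move=> free0.
suff H k : forall m (B : 'M[K]_(m, n)), (n - (m0 + m) <= k)%N -> row_free (col_mx B0 B) ->
    (forall i, P (row i B)) -> exists m (B : 'M[K]_(m, n)), [/\ row_free (col_mx B0 B),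
    forall i, P (row i B) & forall v, P v -> (v <= col_mx B0 B)%MS].
  apply: (H n 0%N (0 : 'M[K]_(0, n))); first by lia.
    by rewrite -row_leq_rank -addsmxE addsmx0 addn0 row_leq_rank.
  by case.
have leqB m (B : 'M[K]_(m, n)) : row_free (col_mx B0 B) -> (m0 + m <= n)%N.
  by rewrite -row_leq_rank => /leq_trans; apply; exact: rank_leq_col.
elim: k => [|k IH] m B mk Bfree BP.
  exists m, B; split=> // v _; apply: submx_full.
  rewrite -col_leq_rank; move: Bfree; rewrite -row_leq_rank; apply: leq_trans; lia.
have Bn := leqB m B Bfree.
have [all|] := pselect (forall v, P v -> (v <= col_mx B0 B)%MS); first by exists m, B.
move=> /existsNP[v /not_implyP[Pv /negP vB]].
have m_lt : (m0 + m < n)%N.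
  rewrite ltn_neqAle Bn andbT; apply: contra vB => /eqP mn; apply: submx_full.
  by rewrite -col_leq_rank -{1}mn row_leq_rank.
apply: (IH (m + 1)%N (col_mx B v)); first by lia.
  rewrite -kermx_eq0 -submx0; apply/row_subP => i; set c := row i _.
  have : c *m col_mx B0 (col_mx B v) = 0 by apply/sub_kermxP; exact: row_sub.
  rewrite -[c]hsubmxK; move: (lsubmx c) (rsubmx c) => c0 c'.
  rewrite -[c']hsubmxK; move: (lsubmx c') (rsubmx c') => c1 c2.
  rewrite !mul_row_col [c2]mx11_scalar mul_scalar_mx addrA => cE.
  have c20 : c2 0 0 = 0.
    apply/eqP/negPn/negP => c20; case/negP: vB.
    have -> : v = - (c2 0 0)^-1 *: (row_mx c0 c1 *m col_mx B0 B).
      rewrite mul_row_col; move/eqP: cE; rewrite addr_eq0 => /eqP ->.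
      by rewrite scalerN scaleNr opprK scalerA mulVf // scale1r.
    by rewrite scalemx_sub // submxMl.
  move: cE; rewrite c20 scale0r addr0 -mul_row_col => cE.
  have : row_mx c0 c1 = 0 by apply: (row_free_inj Bfree); rewrite mul0mx.
  rewrite -(row_mx0 K 1 m0 m) => /eq_row_mx [-> ->].
  by rewrite raddf0 !row_mx0 sub0mx.
move=> i; case: (split_ordP i) => j ->; first by rewrite rowKu.
by rewrite rowKd row_id.
Qed.

Lemma subspace_basis (P : set 'rV[K]_n) : P 0 ->
  (forall a u v, P u -> P v -> P (a *: u + v)) ->
  exists m (B : 'M[K]_(m, n)), row_free B /\ forall v, P v <-> (v <= B)%MS.
Proof.
move=> P0 PD; have free0 : row_free (0 : 'M[K]_(0, n)) by rewrite -row_leq_rank.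
have [m [B [Bfree BP PB]]] := free_extension P free0.
have E : (col_mx (0 : 'M[K]_(0, n)) B :=: B)%MS.
  exact: (eqmx_trans (eqmx_sym (addsmxE _ _)) (adds0mx _ _)).
exists m, B; split; first by move: Bfree; rewrite -!row_leq_rank E.
move=> v; split=> [/PB|]; first by rewrite E.
move=> /submxP[c ->]; rewrite mulmx_sum_row.
elim: (index_enum _) => [|i r IH]; first by rewrite big_nil.
by rewrite big_cons; apply: PD.
Qed.

End LinearAlgebra.

(** * Affine hulls and their real directions *)

Section AffineHull.
Context {R : realType} {N : nat}.
Local Notation C := (Cplx R).
Implicit Types (F : set 'C[R]^N) (p z u v a : 'C[R]^N) (s t : R).

Lemma raff_sub F : F `<=` raff F.
Proof.
move=> z Fz; exists 1%N, (fun=> z), (fun=> 1); split=> //.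
  by rewrite big_ord1.
by rewrite big_ord1 /= scale1r.
Qed.

Lemma raff_comb F x y s : raff F x -> raff F y ->
  raff F (((1 - s)%:C)%C *: x + (s%:C)%C *: y).
Proof.
move=> [m [xs [ts [Fx tx ->]]]] [k [ys [us [Fy uy ->]]]].
exists (m + k)%N, (fun i => match fintype.split i with inl i => xs i | inr j => ys j end),
  (fun i => match fintype.split i with inl i => (1 - s) * ts i | inr j => s * us j end).
have sl i : fintype.split (lshift k i) = inl i :> 'I_m + 'I_k by exact: (unsplitK (inl i)).
have sr j : fintype.split (rshift m j) = inr j :> 'I_m + 'I_k by exact: (unsplitK (inr j)).
split.
- by move=> i; case: fintype.split.
- rewrite big_split_ord /=; under eq_bigr do rewrite sl.
  under [X in _ + X]eq_bigr do rewrite sr.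
  by rewrite -!mulr_sumr tx uy; ring.
- rewrite big_split_ord /= !scaler_sumr; congr (_ + _); apply: eq_bigr => i _.
    by rewrite sl scalerA -rmorphM.
  by rewrite sr scalerA -rmorphM.
Qed.

Lemma raff_rform F a (c : R) : (forall z, F z -> rform a z = c) ->
  forall z, raff F z -> rform a z = c.
Proof.
move=> Fa z [m [xs [ts [Fx tx ->]]]]; rewrite rform_sum.
under eq_bigr => i _ do rewrite rformZ (Fa _ (Fx i)).
by rewrite -mulr_suml tx mul1r.
Qed.

Lemma raff_mono F (G : set 'C[R]^N) : F `<=` G -> raff F `<=` raff G.
Proof. by move=> FG z [m [xs [ts [Fx tx ->]]]]; exists m, xs, ts; split=> // i; exact: FG. Qed.

(** The direction space of the affine hull, a real subspace once [p] lies in the hull. *)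
Definition rdir F p : set 'C[R]^N := [set v | raff F (p + v)].

Section Dir.
Variables (F : set 'C[R]^N) (p : 'C[R]^N).
Hypothesis Fp : raff F p.

Lemma rdir0 : rdir F p 0. Proof. by rewrite /rdir /= addr0. Qed.
Lemma rdirZ s v : rdir F p v -> rdir F p ((s%:C)%C *: v).
Proof.
move=> Fv; have := raff_comb s Fp Fv; rewrite /rdir /=; congr raff.
rewrite scalerDr addrA -scalerDl -rmorphD /= subrK scale1r //.
Qed.
Lemma rdirD u v : rdir F p u -> rdir F p v -> rdir F p (u + v).
Proof.
move=> Fu Fv; have := rdirZ 2 (v := ((2^-1 : R)%:C)%C *: (u + v)).
rewrite scalerA -rmorphM /= mulfV ?pnatr_eq0 // scale1r; apply.
have := raff_comb 2^-1 Fu Fv; rewrite /rdir /=; congr raff.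
have -> : 1 - 2^-1 = 2^-1 :> R by field.
rewrite -scalerDr addrACA scalerDr; congr (_ + _).
rewrite -mulr2n -[p *+ 2]scaler_nat scalerA (_ : _ * 2 = 1) ?scale1r //.
by rewrite fmorphV rmorph_nat mulVf // pnatr_eq0.
Qed.

End Dir.

(** Real coordinates, through which real subspaces and real ranks are handled by matrices over
    [R]. *)
Definition rho (z : 'C[R]^N) : 'rV[R]_(N + N) :=
  row_mx (map_mx (fun x : C => complex.Re x) z) (map_mx (fun x : C => complex.Im x) z).
Definition irho (x : 'rV[R]_(N + N)) : 'C[R]^N :=
  \row_j (Complex (lsubmx x 0 j) (rsubmx x 0 j) : C).

Lemma rhoK : cancel rho irho.
Proof.
by move=> z; apply/rowP => j; rewrite mxE row_mxKl row_mxKr !mxE; case: (z 0 j).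
Qed.
Lemma irhoD t (x y : 'rV[R]_(N + N)) : irho (t *: x + y) = (t%:C)%C *: irho x + irho y.
Proof.
apply/rowP => j; rewrite !mxE; apply: eqCplx; rewrite ?cReD ?cImD ?cReZ ?cImZ /=;
  by rewrite ?mxE.
Qed.
Lemma dotr_rho u v : dotr u v = (rho u *m (rho v)^T) 0 0.
Proof.
rewrite mxE big_split_ord /= -big_split /=; apply: eq_bigr => j _.
by rewrite ![(rho v)^T _ _]mxE /rho !row_mxEl !row_mxEr !mxE.
Qed.

Lemma continuous_rho j : continuous (fun z => rho z 0 j).
Proof.
case: (split_ordP j) => i ->.
  have -> : (fun z => rho z 0 (lshift N i)) = (fun z => complex.Re (z 0 i)).
    by apply/funext => z; rewrite row_mxEl mxE.
  exact: continuous_coordRe.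
have -> : (fun z => rho z 0 (rshift N i)) = (fun z => complex.Im (z 0 i)).
  by apply/funext => z; rewrite row_mxEr mxE.
exact: continuous_coordIm.
Qed.

(** A real subspace is cut out by finitely many linear equations, the columns of [cokermx B] in real
    coordinates. *)
Lemma closed_rdir F p : raff F p -> closed (rdir F p).
Proof.
move=> Fp; pose P : set 'rV[R]_(N + N) := [set x | rdir F p (irho x)].
have [||m [B [_ BP]]] := @subspace_basis _ _ P.
- rewrite /P /= (_ : irho 0 = 0); first exact: rdir0.
  by apply/rowP => j; rewrite !mxE.
- move=> t u v Pu Pv; rewrite /P /= irhoD; apply: rdirD => //; exact: rdirZ.
have -> : rdir F p = \bigcap_(j in [set: 'I_(N + N)]) [set v | (rho v *m cokermx B) 0 j = 0].
  rewrite predeqE => v; have -> : rdir F p v <-> P (rho v) by rewrite /P /= rhoK.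
  rewrite BP; split=> [vB j _|H].
    by move: vB; rewrite submxE => /eqP vB; rewrite /= vB mxE.
  by rewrite submxE; apply/eqP/rowP => j; rewrite (H j) // mxE.
apply: closed_bigI => j _.
apply: (@closed_comp _ _ (fun v => (rho v *m cokermx B) 0 j) [set x | x = 0]); last exact: closed_eq.
move=> v _.
have -> : (fun v => (rho v *m cokermx B) 0 j) = (fun v => \sum_i rho v 0 i * cokermx B i j).
  by apply/funext => z; rewrite mxE.
apply: (@cvg_bigsum _ _ _ _ (nbhs v)) => i.
apply: (@cvgM _ _ (nbhs v)); [exact: continuous_rho | exact: (@cvg_cst _ _ _ (nbhs v))].
Qed.

End AffineHull.

(** * Projections and supporting forms *)

Section Supporting.
Context {R : realType} {N : nat}.
Local Notation C := (Cplx R).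
Implicit Types (F : set 'C[R]^N) (p z u v a x y : 'C[R]^N) (s t : R).

Definition rconv F : Prop := forall x y t, F x -> F y -> 0 <= t <= 1 ->
  F (((1 - t)%:C)%C *: x + (t%:C)%C *: y).

Lemma nearest_point F (y : 'C[R]^N) : compact F -> F !=set0 -> rconv F ->
  exists2 x, F x & (forall z, F z -> nsq (x - y) <= nsq (z - y)) /\
                   (forall z, F z -> dotr (y - x) (z - x) <= 0).
Proof.
move=> cF F0 Fconv.
have [x xF xmin] : exists2 x, x \in F & forall z, z \in F -> nsq (x - y) <= nsq (z - y).
  apply: compact_EVT_min => //; apply: continuous_subspaceT; exact: continuous_nsqB.
have Fx : F x by rewrite inE in xF.
have {}xmin z : F z -> nsq (x - y) <= nsq (z - y) by move=> Fz; apply: xmin; rewrite inE.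
exists x => //; split=> // z Fz; rewrite leNgt; apply/negP => d0.
pose d := dotr (y - x) (z - x).
have key t : 0 <= t <= 1 -> 2 * t * d <= t ^+ 2 * nsq (z - x).
  move=> t01; have := xmin _ (Fconv x z t Fx Fz t01).
  have -> : ((1 - t)%:C)%C *: x + (t%:C)%C *: z - y = (t%:C)%C *: (z - x) - (y - x).
    by rewrite rmorphB rmorph1; apply/rowP => j; rewrite !mxE; ring.
  rewrite (nsqB _ (y - x)) nsqZ dotrZl dotrC -/d -[nsq (x - y)]nsqN opprB; lra.
have K0 := nsq_ge0 (z - x).
(* Small enough for the quadratic term [t ^+ 2 * nsq (z - x)] to fall below [2 * t * d], against
   [key]. *)
pose t := Num.min 1 (d / (nsq (z - x) + 1)).
have t0 : 0 < t by rewrite lt_min ltr01 divr_gt0 // ltr_pwDr.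
have t1 : t <= 1 by rewrite ge_min lexx.
have td : t * (nsq (z - x) + 1) <= d by rewrite -ler_pdivlMr ?ltr_pwDr // ge_min lexx orbT.
have := key t; rewrite (ltW t0) t1 => /(_ isT).
have -> : t ^+ 2 * nsq (z - x) = t * (t * nsq (z - x)) by ring.
have -> : 2 * t * d = t * (2 * d) by ring.
rewrite ler_pM2l //; rewrite -/d in d0; nra.
Qed.

(** Cauchy-Schwarz for a unit vector, from the nonnegativity of [nsq] at [2 s a - w]. *)
Lemma dotr_le_small a w s : 0 < s -> nsq a = 1 -> nsq w <= 4 * s ^+ 2 -> dotr a w <= 2 * s.
Proof.
move=> s0 a1 ws; have := nsq_ge0 (((2 * s)%:C)%C *: a - w).
rewrite nsqB nsqZ dotrZl a1 => H.
have H2 : 2 * (2 * s * dotr a w) <= 8 * s ^+ 2 by lra.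
rewrite -(@ler_pM2l _ (4 * s)) ?mulr_gt0 //; lra.
Qed.

(** Points [y] of the affine hull outside [F] tend to [p]. The unit normals from their projections
    onto [F] stay in a compact set, and a cluster point of them supports [F]. It is a unit vector of
    [rdir F p], hence not constant on the hull. *)
Lemma supporting_form F p (M : R) : closed F -> (forall z, F z -> nsq z <= M) ->
  rconv F -> F p -> ~ relint F p ->
  exists a, (exists2 z, raff F z & dotr a (z - p) <> 0) /\
            (forall z, F z -> dotr a (z - p) <= 0).
Proof.
move=> cF FM Fconv Fp Nrel; have rFp := raff_sub Fp.
have coF := compact_bounded_closed cF FM.
pose S := [set a | nsq a = 1] `&` rdir F p.
have cS : compact S.
  apply: (@compact_bounded_closed _ _ _ 1); last by move=> a [-> _].
  apply: closedI; last exact: closed_rdir.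
  apply: (@closed_comp _ _ nsq [set x | x = 1]); last exact: closed_eq.
  by move=> z _; exact: continuous_nsq.
have ex (m : nat) : exists a, S a /\ forall z, F z -> dotr a (z - p) <= 2 / m.+1%:R.
  pose s : R := m.+1%:R^-1.
  have s0 : 0 < s by rewrite invr_gt0.
  have [y [yp ry NFy]] : exists y, [/\ nsq (y - p) < s ^+ 2, raff F y & ~ F y].
    apply: contrapT => H; apply: Nrel; split=> //; rewrite /within /=.
    apply/nbhsE_eball; exists s => // y; rewrite eballE /= => yp ry.
    by apply: contrapT => NFy; apply: H; exists y.
  have [x Fx [xmin xsep]] := nearest_point y coF (ex_intro _ p Fp) Fconv.
  have yx0 : y - x != 0 by rewrite subr_eq0; apply/eqP => yx; apply: NFy; rewrite yx.
  have n0 : 0 < nsq (y - x) by exact: nsq_gt0.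
  pose r := (Num.sqrt (nsq (y - x)))^-1.
  have r0 : 0 < r by rewrite invr_gt0 sqrtr_gt0.
  exists ((r%:C)%C *: (y - x)); split.
    split; first by rewrite /= nsqZ /r exprVn sqr_sqrtr ?mulVf ?gt_eqF // ltW.
    apply: rdirZ => //.
    have -> : y - x = (y - p) + ((-1 : R)%:C)%C *: (x - p).
      by rewrite rmorphN1 scaleN1r opprB addrA subrK.
    apply: rdirD => //; first by rewrite /rdir /= addrC subrK.
    apply: rdirZ => //; rewrite /rdir /= addrC subrK; exact: raff_sub.
  move=> z Fz; have -> : z - p = (z - x) + (x - p) by rewrite addrA subrK.
  rewrite dotrDr; apply: (@le_trans _ _ (0 + 2 * s)); last by rewrite add0r.
  apply: lerD; first by rewrite dotrZl pmulr_rle0 // xsep.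
  apply: dotr_le_small => //.
    by rewrite nsqZ /r exprVn sqr_sqrtr ?mulVf ?gt_eqF // ltW.
  (* [x - p] has length at most [2 * s]: [p] lies in [F], so the nearest point [x] is no farther
     from [y] than [p] is. *)
  have -> : x - p = (x - y) + (y - p) by rewrite addrA subrK.
  have h1 := xmin p Fp; have h2 : nsq (p - y) = nsq (y - p) by rewrite -nsqN opprB.
  have h3 := nsqD (x - y) (y - p); have h4 := nsq_ge0 ((x - y) - (y - p)).
  rewrite (nsqB (x - y)) in h4; lra.
pose b m := projT1 (cid (ex m)).
have bS m : S (b m) by case: (projT2 (cid (ex m))).
have bF m z : F z -> dotr (b m) (z - p) <= 2 / m.+1%:R.
  by move=> Fz; apply: (projT2 (cid (ex m))).2.
have [|a [[a1 ra] acl]] := cS (b m @[m --> \oo]) _.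
  by exists 0%N => // m _; exact: bS.
exists a; split.
  exists (p + a); first exact: ra.
  by rewrite addrAC subrr add0r -/(nsq a) a1; apply/eqP; rewrite oner_eq0.
move=> z Fz; rewrite leNgt; apply/negP => d0.
pose d := dotr a (z - p) / 2.
have nA : nbhs a [set a' | d < dotr a' (z - p)].
  have -> : [set a' | d < dotr a' (z - p)] = dotr (z - p) @^-1` [set x | d < x].
    by rewrite predeqE => a' /=; rewrite dotrC.
  apply: (@continuous_dotr _ _ (z - p) a); apply: open_nbhs_nbhs; split; first exact: open_gt.
  by rewrite /d /= (dotrC (z - p)) ltr_pdivrMr // mulr_natr mulr2n ltrDl.
have FA : (b m @[m --> \oo]) [set a' | dotr a' (z - p) <= d].
  have d20 : 0 < d / 2 by rewrite !divr_gt0.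
  have : \forall m \near \oo, dotr (b m) (z - p) <= d.
    near=> m; apply: le_trans (bF m z Fz) _.
    have : m.+1%:R^-1 < d / 2.
      near: m; exact: (near_infty_natSinv_lt (PosNum d20)).
    by rewrite ltr_pdivlMr // mulrC => /ltW.
  exact.
have [a' [h1 h2]] := acl _ _ FA nA.
by move: h2; rewrite /= ltNge h1.
Unshelve. all: by end_near. Qed.

End Supporting.

Section Faces.
Context {R : realType} {N : nat}.
Local Notation C := (Cplx R).
Implicit Types (F D : set 'C[R]^N) (p z u v a x y : 'C[R]^N) (s t : R).

Definition supports F p a : Prop :=
  (exists2 z, raff F z & rform a (z - p) <> 0) /\ forall z, F z -> rform a (z - p) <= 0.

Lemma FminP F p z : F p -> Fmin p F z <-> F z /\ forall a, supports F p a -> rform a (z - p) = 0.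
Proof.
move=> Fp; split=> [[Fz H]|[Fz H]]; split=> //.
  move=> a [a1 a2]; pose P := [set z | raff F z /\ rform a (z - p) = 0].
  have [] // : P z; apply: H; exists a; split=> //.
  by split; [exact: raff_sub | rewrite subrr rform0].
move=> P [a [-> a1 _ a2]]; split; first exact: raff_sub.
by apply: H; split.
Qed.

(** The invariant of the sequence of faces, which makes [supporting_form] available at every
    stage. *)
Definition pointed_body F p : Prop :=
  [/\ closed F, exists M : R, forall z, F z -> nsq z <= M, rconv F & F p].

Lemma pointed_body_Fmin F p : pointed_body F p -> pointed_body (Fmin p F) p.
Proof.
move=> [cF [M FM] Fc Fp].
have E : Fmin p F = F `&` \bigcap_(a in supports F p) [set z | rform a (z - p) = 0].
  rewrite predeqE => z; rewrite FminP //.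
split.
- rewrite E; apply: closedI => //; apply: closed_bigI => a _.
  apply: (@closed_comp _ _ (fun z => rform a (z - p)) [set x | x = 0]); last exact: closed_eq.
  move=> z _; have -> : (fun z => rform a (z - p)) = (fun z => rform a z - rform a p).
    by apply/funext => y; rewrite rformB.
  apply: (@cvgB _ _ _ (nbhs z)); first exact: continuous_rform.
  exact: (@cvg_cst _ _ _ (nbhs z)).
- exists M; move=> z; rewrite FminP // => -[Fz _]; exact: FM.
- move=> x y t; rewrite !FminP // => -[Fx ax] [Fy ay] t01; split; first exact: Fc.
  move=> a sa; move: (ax a sa) (ay a sa).
  by rewrite !rformB rformD !rformZ => /eqP; rewrite subr_eq0 => /eqP -> /eqP; rewrite subr_eq0 => /eqP ->; ring.
- by rewrite FminP //; split=> // a _; rewrite subrr rform0.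
Qed.

Lemma pointed_body_relbd F p : pointed_body F p -> relbd F p <-> ~ relint F p.
Proof.
move=> [cF _ _ Fp]; split=> [[]//|H]; split=> //; exact: subset_closure.
Qed.

Lemma pointed_body_supp F p : pointed_body F p -> relbd F p -> exists a, supports F p a.
Proof.
move=> gF; have [cF [M FM] Fc Fp] := gF; rewrite (pointed_body_relbd gF) => H.
have [a [a1 a2]] := supporting_form cF FM Fc Fp H.
exists (map_mx Num.conj a); split; last by move=> z /a2; rewrite dotr_rform.
by have [z rz az] := a1; exists z => //; rewrite -dotr_rform.
Qed.

Lemma convex_set_rconv D : convex_set D -> rconv D.
Proof.
move=> cD x y t Dx Dy /andP[t0 t1].
have c0 : 0 <= (t%:C)%C :> C by rewrite ler0c.
have c1 : (t%:C)%C <= 1 :> C by rewrite -(rmorph1 (real_complex R)) lecR.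
have := cD y x (Itv01 c0 c1); rewrite !inE => /(_ Dy Dx).
by rewrite rmorphB rmorph1 addrC.
Qed.

Lemma rconv_closure D : rconv D -> rconv (closure D).
Proof.
move=> cD x y t cx cy t01 A /nbhsE_eball[r r0 rA].
have nb z : nbhs z (eball z r) by apply/nbhsE_eball; exists r.
have [x' [Dx' ]] := cx _ (nb x); have [y' [Dy']] := cy _ (nb y).
rewrite !eballE /= => yr xr.
exists (((1 - t)%:C)%C *: x' + (t%:C)%C *: y'); split; first exact: cD.
apply: rA; rewrite eballE /=.
have -> : ((1 - t)%:C)%C *: x' + (t%:C)%C *: y' - (((1 - t)%:C)%C *: x + (t%:C)%C *: y)
  = ((1 - t)%:C)%C *: (x' - x) + (t%:C)%C *: (y' - y).
  by apply/rowP => j; rewrite !mxE; ring.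
rewrite nsqD !nsqZ dotrZl dotrZr.
have := nsq_ge0 ((x' - x) - (y' - y)); rewrite (nsqB (x' - x)).
move: (nsq (x' - x)) (nsq (y' - y)) (dotr (x' - x) (y' - y)) xr yr => a b d ar br H.
case/andP: t01 => t0 t1.
have H2 : t * (1 - t) * (2 * d) <= t * (1 - t) * (a + b).
  apply: ler_wpM2l; last by lra.
  by rewrite mulr_ge0 // subr_ge0.
have : (1 - t) * a + t * b < r ^+ 2.
  have [t1'|t1'] := eqVneq t 1; first by rewrite t1' subrr mul0r mul1r add0r.
  have s0 : 0 < 1 - t by rewrite subr_gt0 lt_neqAle t1' t1.
  have h1 : (1 - t) * a < (1 - t) * r ^+ 2 by rewrite ltr_pM2l.
  have h2 : t * b <= t * r ^+ 2 by rewrite ler_wpM2l // ltW.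
  by lra.
by lra.
Qed.

(** [x] is replaced by a nearby [x'] in [D] and the error is moved to the other endpoint, around
    which the open set [D] leaves room. *)
Lemma rconv_open_segment D x z t : open D -> rconv D -> closure D x -> D z -> 0 < t <= 1 ->
  D (((1 - t)%:C)%C *: x + (t%:C)%C *: z).
Proof.
move=> oD cD cx Dz /andP[t0 t1].
have /nbhsE_eball[r r0 rD] : nbhs z D by exact: open_nbhs_nbhs.
have nb : nbhs x (eball x (r * t)) by apply/nbhsE_eball; exists (r * t) => //; rewrite mulr_gt0.
have [x' [Dx' xx']] := cx _ nb; rewrite eballE /= in xx'.
pose c := (1 - t) / t.
have -> : ((1 - t)%:C)%C *: x + (t%:C)%C *: z =
   ((1 - t)%:C)%C *: x' + (t%:C)%C *: (z + (c%:C)%C *: (x - x')).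
  rewrite [in RHS]scalerDr scalerA -rmorphM /= /c mulrCA mulfV ?gt_eqF // mulr1.
  by apply/rowP => j; rewrite !mxE; ring.
apply: cD => //; last by rewrite ltW.
apply: rD; rewrite eballE /= addrAC subrr add0r nsqZ -nsqN opprB.
have c0 : 0 <= c by rewrite /c divr_ge0 ?subr_ge0 // ltW.
have ct : c * t <= 1 by rewrite /c divfK ?gt_eqF //; lra.
clearbody c; have [->|cn] := eqVneq c 0; first by rewrite expr0n mul0r exprn_gt0.
have cp : 0 < c by rewrite lt_def cn.
apply: (@lt_le_trans _ _ (c ^+ 2 * (r * t) ^+ 2)); first by rewrite ltr_pM2l // exprn_gt0.
have h0 : 0 <= c * (r * t) by rewrite !mulr_ge0 ?(ltW r0) ?(ltW t0).
have h1 : c * (r * t) <= r by rewrite mulrCA -[leRHS]mulr1 ler_wpM2l ?(ltW r0).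
rewrite -exprMn !expr2; exact: ler_pM.
Qed.

End Faces.

Section BoundaryFaces.
Context {R : realType} {N : nat}.
Local Notation C := (Cplx R).
Implicit Types (F D : set 'C[R]^N) (p z u v a x y : 'C[R]^N) (s t : R).

Lemma open_dir D z v : open D -> D z -> exists2 e : R, 0 < e & forall t, `|t| <= e -> D (z + (t%:C)%C *: v).
Proof.
move=> oD Dz; have /nbhsE_eball[r r0 rD] : nbhs z D by exact: open_nbhs_nbhs.
have n0 := nsq_ge0 v.
pose e := Num.min 1 (r ^+ 2 / (nsq v + 1) / 2).
have n1 : 0 < nsq v + 1 by lra.
have e0 : 0 < e by rewrite lt_min ltr01 !divr_gt0 // exprn_gt0.
have e1 : e <= 1 by rewrite ge_min lexx.
have e2 : e * (nsq v + 1) <= r ^+ 2 / 2.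
  by rewrite -ler_pdivlMr // mulrAC ge_min lexx orbT.
exists e => // t te; apply: rD; rewrite eballE /= addrAC subrr add0r nsqZ.
have t2 : t ^+ 2 <= e.
  rewrite -normr_id in te; rewrite -[t ^+ 2]ger0_norm ?sqr_ge0 // normrX expr2.
  apply: le_trans (_ : `|t| * 1 <= _); last by rewrite mulr1 -[`|t|]normr_id.
  by apply: ler_wpM2l => //; rewrite -[`|t|]normr_id; exact: le_trans te e1.
have r2 : 0 < r ^+ 2 by rewrite exprn_gt0.
clearbody e; nra.
Qed.

Section Domain.
Variables (D : set 'C[R]^N) (M : R).
Hypotheses (oD : open D) (D0 : D !=set0) (cD : rconv D)
  (bD : forall z, closure D z -> nsq z <= M).

Lemma pointed_body_closure p : closure D p -> pointed_body (closure D) p.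
Proof.
move=> Kp; split; [exact: closed_closure | exists M; exact: bD | exact: rconv_closure | exact: Kp].
Qed.

Lemma bd_openE p : bd D p <-> closure D p /\ ~ D p.
Proof. by rewrite /bd ((interior_id D).1 oD). Qed.

Lemma raff_open_closure z : raff (closure D) z.
Proof.
have [z0 Dz0] := D0; have [e e0 De] := open_dir (z - z0) oD Dz0.
have -> : z = ((1 - e^-1)%:C)%C *: z0 + ((e^-1)%:C)%C *: (z0 + (e%:C)%C *: (z - z0)).
  rewrite scalerDr scalerA -rmorphM /= mulVf ?gt_eqF // scale1r addrA -scalerDl.
  by rewrite -rmorphD /= subrK scale1r addrC subrK.
apply: raff_comb; apply: raff_sub; apply: subset_closure => //.
by apply: De; rewrite gtr0_norm.
Qed.

(** Otherwise a segment from a point of [D] to [p] could be prolonged beyond [p] within [closure D],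
    which would put [p] in [D]. *)
Lemma not_relint_bd p : bd D p -> ~ relint (closure D) p.
Proof.
move=> /bd_openE[Kp NDp] [_]; rewrite /within /= => /nbhsE_eball[r r0 rD].
have pp : eball p r p by rewrite eballE /= subrr nsq0 exprn_gt0.
have [z0 Dz0] := D0; have [e e0 De] := open_dir (p - z0) (@open_eball _ _ p r) pp.
have Kx : closure D (p + (e%:C)%C *: (p - z0)).
  by apply: rD (raff_open_closure _); apply: De; rewrite gtr0_norm.
apply: NDp; pose t := e / (1 + e).
have e1 : 0 < 1 + e by lra.
have t01 : 0 < t <= 1 by rewrite divr_gt0 //= ler_pdivrMr // mul1r lerDr.
have := rconv_open_segment oD cD Kx Dz0 t01; congr D.
have -> : 1 - t = (1 + e)^-1 by rewrite /t; field; rewrite gt_eqF.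
have ee : t = (1 + e)^-1 * e by rewrite mulrC.
rewrite ee rmorphM /= -scalerA -scalerDr -addrA -scalerDr subrK.
rewrite -{1}[p]scale1r -scalerDl scalerA.
have -> : (1 : C) = (1%:C)%C by [].
by rewrite -rmorphD -rmorphM /= mulVf ?gt_eqF // scale1r.
Qed.

Lemma pointed_body_face_seq p j : closure D p -> pointed_body (face_seq D p j) p.
Proof.
move=> Kp; elim: j => [|j IH]; first exact: pointed_body_closure.
by rewrite /face_seq iterS; exact: pointed_body_Fmin.
Qed.

Lemma face_seqS p i j : (i <= j)%N -> face_seq D p j `<=` face_seq D p i.
Proof.
move=> /subnK <-; elim: (j - i)%N => [|k IH] //; apply: subset_trans IH.
by rewrite addSn /face_seq iterS => z [].
Qed.

(** An endless sequence would give at each stage a supporting form that is nonzero at some point of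
    its hull and zero on all later hulls. The triangular matrix of these values, of size [2 N + 1],
    would be invertible, yet it factors through real dimension [2 N]. *)
Lemma face_seq_stop p : closure D p -> exists j, ~ relbd (face_seq D p j) p.
Proof.
move=> Kp; apply: contrapT => H.
have {}H j : relbd (face_seq D p j) p by apply: contrapT => Hj; apply: H; exists j.
have ex j : exists az : 'C[R]^N * 'C[R]^N, [/\ supports (face_seq D p j) p az.1,
    raff (face_seq D p j) az.2 & rform az.1 (az.2 - p) <> 0].
  have [a sa] := pointed_body_supp (pointed_body_face_seq j Kp) (H j).
  by have [[z rz az] _] := sa; exists (a, z).
pose w j := projT1 (cid (ex j)).
have wP j : [/\ supports (face_seq D p j) p (w j).1,
    raff (face_seq D p j) (w j).2 & rform (w j).1 ((w j).2 - p) <> 0].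
  exact: (projT2 (cid (ex j))).
pose n := (N + N).+1.
pose A : 'M[R]_n := \matrix_(i, j) rform (w i).1 ((w j).2 - p).
have trigA : is_trig_mx A.
  apply/is_trig_mxP => i j ij; rewrite mxE rformB.
  have [sa _ _] := wP i; have [_ rz _] := wP j.
  have rz' := raff_mono (face_seqS (p := p) ij) rz.
  apply/eqP; rewrite subr_eq0; apply/eqP; apply: raff_rform rz' => z.
  rewrite /face_seq iterS FminP; last by case: (pointed_body_face_seq i Kp).
  by case=> _ /(_ _ sa) /eqP; rewrite rformB subr_eq0 => /eqP.
have : A \in unitmx.
  rewrite unitmxE det_trig // unitfE; apply/prodf_neq0 => i _; rewrite mxE.
  by have [_ _ /eqP] := wP i.
rewrite -row_free_unit -row_leq_rank.
have -> : A = (\matrix_i rho (map_mx Num.conj (w i).1)) *m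
              (\matrix_j rho ((w j).2 - p))^T.
  apply/matrixP => i j; rewrite mxE rformE dotr_rho !mxE; apply: eq_bigr => k _.
  by rewrite ![_^T _ _]mxE ![(\matrix_i _) _ _]mxE.
move=> /leq_trans/(_ (mxrankM_maxl _ _))/leq_trans/(_ (rank_leq_col _)).
by rewrite /n ltnn.
Qed.

(** Resolves the choice in [face_index]. At least one step is taken, since a boundary point of [D]
    is not in the relative interior of [closure D]. *)
Lemma face_spec p : bd D p -> exists k, [/\ face D p = face_seq D p k.+1,
  forall i, (i <= k)%N -> relbd (face_seq D p i) p & relint (face D p) p].
Proof.
move=> bp; have [Kp NDp] := (bd_openE p).1 bp.
pose P j := `[< ~ relbd (face_seq D p j) p >].
have [|j /asboolP Pj jmin] := @ex_minnP P.
  by have [j Hj] := face_seq_stop Kp; exists j; apply/asboolP.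
have [H1 H2] : (forall i, (i < face_index D p)%N -> relbd (face_seq D p i) p) /\
               ~ relbd (face_seq D p (face_index D p)) p.
  apply: (@getPex _ [set j | (forall i, (i < j)%N -> relbd (face_seq D p i) p) /\
               ~ relbd (face_seq D p j) p]).
  exists j; split=> // i ij; apply: contrapT => Hi.
  by have := jmin i (asboolT Hi); rewrite leqNgt ij.
have rel0 : relbd (face_seq D p 0) p.
  by rewrite (pointed_body_relbd (pointed_body_face_seq 0 Kp)); exact: not_relint_bd.
rewrite /face; case: (face_index D p) H1 H2 => [|k] H1 H2 //.
exists k; split=> // ; apply: contrapT => H3; apply: H2.
by rewrite (pointed_body_relbd (pointed_body_face_seq _ Kp)).
Qed.

(** From a point of [D] one could move both ways along [y - p], where the form is nonzero, and so
    exceed its maximum. *)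
Lemma supp_bd p a z : supports (closure D) p a -> closure D z -> rform a (z - p) = 0 -> bd D z.
Proof.
move=> [[y _ ay] a2] Kz az; rewrite bd_openE; split=> // Dz.
have [e e0 De] := open_dir (y - p) oD Dz.
have h t : `|t| <= e -> t * rform a (y - p) <= 0.
  move=> te; have := a2 _ (subset_closure (De _ te)).
  by rewrite [X in rform a X]addrAC [LHS in LHS <= _]rformD az add0r rformZ.
have h1 := h e; have h2 := h (- e); rewrite normrN in h2; rewrite gtr0_norm // in h1 h2.
have {}h1 := h1 (lexx _); have {}h2 := h2 (lexx _).
have : e * rform a (y - p) = 0 by lra.
by move/eqP; rewrite mulf_eq0 gt_eqF //= => /eqP.
Qed.

Lemma face_sub_bd p : bd D p -> face D p `<=` bd D.
Proof.
move=> bp z; have [Kp NDp] := (bd_openE p).1 bp; have [k [-> H _]] := face_spec bp.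
have [a sa] := pointed_body_supp (pointed_body_face_seq 0 Kp) (H 0%N isT).
move=> /(face_seqS (isT : (1 <= k.+1)%N)) F1; have [Kz /(_ _ sa)] := (FminP z Kp).1 F1.
exact: supp_bd sa Kz.
Qed.

End Domain.
End BoundaryFaces.

(** * Complex directions in the minimal face *)

Section ComplexDirections.
Context {R : realType} {N : nat}.
Local Notation C := (Cplx R).
Implicit Types (F D : set 'C[R]^N) (p z u v a x y : 'C[R]^N) (s t : R).

Lemma connected_eball p (r : R) : 0 < r -> connected (eball p r).
Proof.
move=> r0; pose seg x := (fun t : R => p + (t%:C)%C *: (x - p)) @` `[0, 1].
have -> : eball p r = \bigcup_(x in eball p r) seg x.
  rewrite predeqE => z; split=> [pz|[x]].
    exists z => //; exists 1; first by rewrite /= in_itv /= ler01 lexx.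
    by rewrite scale1r addrC subrK.
  rewrite eballE /= => xr [t]; rewrite /= in_itv /= => /andP[t0 t1] <-.
  rewrite addrAC subrr add0r nsqZ; apply: le_lt_trans xr.
  by rewrite -[leRHS]mul1r ler_wpM2r ?nsq_ge0 // expr_le1.
apply: bigcup_connected => [|x _].
  exists p => x _; exists 0; first by rewrite /= in_itv /= ler01 lexx.
  by rewrite scale0r addr0.
apply: connected_continuous_connected; first exact: segment_connected.
by apply: continuous_subspaceT => t; exact: cvg_rline.
Qed.

(** The dimension of a complex plane is unique, which determines the choice in [cdim]. *)
Lemma cplane_inj k m (B : 'M[C]_(m, N)) p : row_free B ->
  cplane k [set z | (z - p <= B)%MS] -> k = m.
Proof.
move=> fB [p' [A [fA E]]].
have pp' : (p - p' <= A)%MS.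
  have : [set z | (z - p <= B)%MS] p by rewrite /= subrr sub0mx.
  by rewrite E.
have AB v : (v <= A)%MS = (v <= B)%MS.
  have : [set z | (z - p <= B)%MS] (p + v) <-> [set z | (z - p' <= A)%MS] (p + v) by rewrite E.
  rewrite /= addrAC subrr add0r addrAC => H.
  apply/idP/idP => [vA|/H h]; first by apply/H; exact: addmx_sub.
  by rewrite -[v](addKr (p - p')) addmx_sub // eqmx_opp.
have AeB : (A :=: B)%MS.
  by apply/eqmxP/andP; split; apply/rV_subP => v; rewrite AB.
by move: fA fB; rewrite /row_free AeB => /eqP h1 /eqP h2; rewrite -h1 h2.
Qed.

(** The largest complex subspace of a real subspace [V] is the intersection of [V] and [i V]. *)
Lemma rdir_complex_basis F p : raff F p ->
  exists m (B : 'M[C]_(m, N)), row_free B /\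
    forall v, (v <= B)%MS <-> rdir F p v /\ rdir F p ('i *: v).
Proof.
move=> rFp.
have zE (x : C) v : x *: v = ((complex.Re x)%:C)%C *: v + ((complex.Im x)%:C)%C *: ('i *: v).
  rewrite scalerA -scalerDl; congr (_ *: _); apply: eqCplx.
    by rewrite cReD cReZ cRe_i /=; ring.
  by rewrite cImD cImZ cIm_i /=; ring.
have [||m [B [fB BP]]] := @subspace_basis _ N [set v | rdir F p v /\ rdir F p ('i *: v)].
- by rewrite /= scaler0; split; exact: rdir0.
- move=> x u v [u1 u2] [v1 v2] /=; split.
    rewrite (zE x u); exact (rdirD rFp (rdirD rFp (rdirZ rFp _ u1) (rdirZ rFp _ u2)) v1).
  rewrite scalerDr; apply: (rdirD rFp _ v2); rewrite scalerA mulrC -scalerA.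
  rewrite (zE x ('i *: u)); apply: (rdirD rFp (rdirZ rFp _ u2)).
  apply: (rdirZ rFp); rewrite scalerA -expr2 sqrCi scaleN1r.
  by have := rdirZ rFp (-1) u1; rewrite rmorphN1 scaleN1r.
by exists m, B; split=> // v; rewrite -BP.
Qed.

Lemma ECplaneE D p m (B : 'M[C]_(m, N)) : row_free B -> 
  (forall v, (v <= B)%MS <-> rdir (face D p) p v /\ rdir (face D p) p ('i *: v)) ->
  ECplane D p = [set z | (z - p <= B)%MS].
Proof.
move=> fB BP; set pi0 := [set z | (z - p <= B)%MS].
pose inner pi := [/\ exists k, cplane k pi, pi p & pi `<=` Eplane D p].
have i0 : inner pi0.
  split; first by exists m, p, B.
    by rewrite /pi0 /= subrr sub0mx.
  by move=> z /= /BP[+ _]; rewrite /rdir /= addrC subrK.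
have max0 pi : inner pi -> pi `<=` pi0.
  move=> [[k [p' [A [fA ->]]]] /= pp' sub] z /= zp'.
  have key v : (v <= A)%MS -> rdir (face D p) p v.
    by move=> vA; apply: sub => /=; rewrite addrAC addmx_sub.
  have zA : (z - p <= A)%MS by rewrite -(subrKA p') addmx_sub // -opprB eqmx_opp.
  by apply/BP; split; apply: key => //; exact: scalemx_sub.
have [i1 max1] : inner (ECplane D p) /\ forall pi', inner pi' -> pi' `<=` ECplane D p.
  by apply: (@getPex _ [set pi | inner pi /\ forall pi', inner pi' -> pi' `<=` pi]); exists pi0.
by rewrite eqEsubset; split; [exact: max0 | exact: max1].
Qed.

(** The only access to [nu] from here on: a basis of the complex directions of the minimal face. *)
Lemma nu_spec D p : raff (face D p) p -> exists B : 'M[C]_(nu D p, N), row_free B /\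
  forall v, (v <= B)%MS <-> rdir (face D p) p v /\ rdir (face D p) p ('i *: v).
Proof.
move=> Fp; have [m [B [fB BP]]] := rdir_complex_basis Fp.
suff -> : nu D p = m by exists B.
rewrite /nu (ECplaneE fB BP); apply: (cplane_inj fB (p := p)).
apply: (@getPex _ [set k | cplane k [set z | (z - p <= B)%MS]]).
by exists m, p, B.
Qed.

(** [p] is in the relative interior of its face, so near [p] the complex plane of dimension [nu D p]
    stays in the face, and the face lies in the boundary. *)
Lemma complex_point_nu D p (M : R) : open D -> D !=set0 -> rconv D ->
  (forall z, closure D z -> nsq z <= M) -> bd D p -> (0 < nu D p)%N -> complex_point D p.
Proof.
move=> oD D0 cD bD bp nu0; split=> //.
have [k [Ek _ [Fp]]] := face_spec oD D0 cD bD bp.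
rewrite /within /= => /nbhsE_eball[r r0 rF].
have [B [fB BP]] := nu_spec (raff_sub Fp).
exists (nu D p), [set z | (z - p <= B)%MS], (eball p r).
have pr : eball p r p by rewrite eballE /= subrr nsq0 exprn_gt0.
split; [exact: nu0 | by exists p, B | | | ].
- by split; [exact: open_eball | exists p | exact: connected_eball].
- by split; [exact: pr | rewrite /= subrr sub0mx].
- move=> z [zr /BP[+ _]]; rewrite /rdir /= addrC subrK => /(rF _ zr) Fz.
  exact: (face_sub_bd oD D0 cD bD bp) Fz.
Qed.

End ComplexDirections.

(** * Peak functions *)

Section FaceCoordinates.
Context {R : realType} {N : nat}.
Local Notation C := (Cplx R).
Implicit Types (F D : set 'C[R]^N) (p z u v a x y : 'C[R]^N) (s t : R).

Lemma rdir_real_comb F p m (B : 'M[C]_(m, N)) (d : 'I_m -> R) : raff F p ->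
  (forall i, rdir F p (row i B)) -> rdir F p ((\row_i (d i)%:C)%C *m B).
Proof.
move=> Fp BF; rewrite mulmx_sum_row.
elim: (index_enum _) => [|i r IH]; first by rewrite big_nil; exact: rdir0.
rewrite big_cons; apply: (rdirD Fp _ IH); rewrite mxE; exact: (rdirZ Fp _ (BF i)).
Qed.

(** [B1] spans the complex part of [V = rdir F p] and [B2] completes it within [V]; [X] and [Y] give
    the coordinates. For [v] in [V] with [Y]-coordinates [e + i d], [e] and [d] real, both [d B2]
    and [i d B2] lie in [V]; so [d B2] lies in the span of [B1] and [d = 0]. Hence
    [Re (y.y) = |y|^2] on [V]. *)
Lemma face_coords F p q m0 (B1 : 'M[C]_(m0, N)) : raff F p -> row_free B1 ->
  (forall v, (v <= B1)%MS <-> rdir F p v /\ rdir F p ('i *: v)) -> (m0 <= q)%N -> (q <= N)%N ->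
  exists m (X : 'M[C]_(N, m0)) (Y : 'M[C]_(N, m)) (A : 'M[C]_(N - q, N)),
    [/\ row_free A, A *m X = 0 & forall v, rdir F p v -> v != 0 ->
       0 < nsq (v *m X) + complex.Re (\sum_j ((v *m Y) 0 j) ^+ 2)].
Proof.
move=> Fp fB1 B1P mq qN.
have [m [B2 [fB B2F VB]]] := free_extension (rdir F p) fB1.
pose P := pinvmx (col_mx B1 B2).
pose X : 'M[C]_(N, m0) := lsubmx P; pose Y : 'M[C]_(N, m) := rsubmx P.
have kX : (N - q <= \rank (kermx X))%N.
  by rewrite mxrank_ker leq_sub2l //; exact: leq_trans (rank_leq_col _) mq.
(* Any [N - q] independent vectors of the kernel of [X], whose dimension is at least [N - m0]. *)
pose A : 'M[C]_(N - q, N) := pid_mx (N - q) *m row_base (kermx X).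
exists m, X, Y, A; split.
- by rewrite /row_free mxrankMfree ?row_base_free // rank_pid_mx.
- apply/eqP; rewrite -sub_kermx; apply: submx_trans (submxMl _ _) _.
  by rewrite eq_row_base.
move=> v Vv v0.
have vE : v = (v *m X) *m B1 + (v *m Y) *m B2.
  rewrite -[LHS](mulmxKpV (VB v Vv)) -/P -[P]hsubmxK mul_mx_row mul_row_col //.
move: (v *m X) (v *m Y) vE => x y vE.
have yr j : complex.Im (y 0 j) = 0.
  pose d : 'rV[C]_m := (\row_i (complex.Im (y 0 i))%:C)%C.
  pose e : 'rV[C]_m := (\row_i (complex.Re (y 0 i))%:C)%C.
  have yE : y = e + 'i *: d.
    apply/rowP => i; rewrite !mxE; apply: eqCplx.
      by rewrite cReD cReM cRe_i cIm_i /=; ring.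
    by rewrite cImD cImM cRe_i cIm_i /=; ring.
  have Vd : rdir F p (d *m B2) by exact: rdir_real_comb.
  have Ve : rdir F p (e *m B2) by exact: rdir_real_comb.
  have Vx : rdir F p (x *m B1) by have [] := (B1P (x *m B1)).1 (submxMl _ _).
  have Vid : rdir F p ('i *: (d *m B2)).
    have -> : 'i *: (d *m B2) = v + ((-1 : R)%:C)%C *: (x *m B1 + e *m B2).
      rewrite vE yE mulmxDl -scalemxAl rmorphN1 scaleN1r.
      by rewrite addrA [RHS]addrAC subrr add0r.
    exact: (rdirD Fp Vv (rdirZ Fp _ (rdirD Fp Vx Ve))).
  have /submxP[c dB] : (d *m B2 <= B1)%MS by apply/B1P.
  have : row_mx c (- d) = 0.
    apply: (row_free_inj fB); rewrite mul0mx mul_row_col mulNmx dB subrr //.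
  rewrite -(row_mx0 C 1 m0 m) => /eq_row_mx [_ /rowP/(_ j)].
  by rewrite !mxE => /(congr1 (@complex.Re R)); rewrite cReN /= => /eqP; rewrite oppr_eq0 => /eqP.
have -> : complex.Re (\sum_j (y 0 j) ^+ 2) = nsq y.
  rewrite cRe_sum; apply: eq_bigr => j _.
  by rewrite expr2 cReM yr; ring.
have x0 := nsq_ge0 x; have y0 := nsq_ge0 y.
rewrite lt_def addr_ge0 // andbT; apply: contra v0 => /eqP xy.
have x1 : x = 0 by apply: nsq_eq0; lra.
have y1 : y = 0 by apply: nsq_eq0; lra.
by rewrite vE x1 y1 !mul0mx addr0.
Qed.

(** [Phi] is a cone of forms that are nonpositive on [K]. At each point a multiple of one of them
    brings the sum below 0, and finitely many do so for all of [K]; in their sum, the other forms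
    can only decrease the value. *)
Lemma strict_separation (K : set 'C[R]^N) p (phi : 'C[R]^N -> R) (Phi : set 'C[R]^N) :
  compact K -> continuous phi -> Phi 0 ->
  (forall a b, Phi a -> Phi b -> Phi (a + b)) -> (forall t a, 0 <= t -> Phi a -> Phi ((t%:C)%C *: a)) ->
  (forall a z, Phi a -> K z -> rform a (z - p) <= 0) ->
  (forall z, K z -> phi z < 0 \/ exists2 a, Phi a & rform a (z - p) < 0) ->
  exists2 a, Phi a & forall z, K z -> phi z + rform a (z - p) < 0.
Proof.
move=> cK cphi Phi0 PhiD PhiZ PhiK sep.
pose f a : set 'C[R]^N := [set z | phi z + rform a (z - p) < 0].
have of_ a : Phi a -> open (f a).
  move=> _.
  have -> : f a = (fun z => phi z + (rform a z - rform a p)) @^-1` [set x | x < 0].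
    by rewrite predeqE => z; rewrite /f /= rformB.
  apply: open_comp; last exact: open_lt.
  move=> z _; apply: (@cvgD _ _ _ (nbhs z)); first exact: cphi.
  apply: (@cvgB _ _ _ (nbhs z)); first exact: continuous_rform.
  exact: (@cvg_cst _ _ _ (nbhs z)).
have cov : K `<=` cover Phi f.
  move=> z Kz; have [z0|[a Pa az]] := sep z Kz.
    by exists 0 => //; rewrite /f /= rformE; rewrite map_mx0 dotrC dotr0 addr0.
  (* Scales the form to the value [- (|phi z| + 1)] at [z]. *)
  pose t := (`|phi z| + 1) / - rform a (z - p).
  have n0 : 0 < - rform a (z - p) by rewrite oppr_gt0.
  have t0 : 0 <= t by rewrite divr_ge0 ?addr_ge0 // ltW.
  exists ((t%:C)%C *: a); first exact: PhiZ.
  rewrite /f /= rformZl.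
  have -> : t * rform a (z - p) = - (`|phi z| + 1).
    by rewrite -[X in t * X]opprK mulrN /t divfK // gt_eqF.
  have := ler_norm (phi z); lra.
have := cK; rewrite compact_cover => /(_ _ Phi f of_ cov)[E EPhi Ecov].
have PE (r : seq 'C[R]^N) : {subset r <= Phi} -> Phi (\sum_(a <- r) a).
  elim: r => [|a r IH] rP; first by rewrite big_nil.
  rewrite big_cons; apply: PhiD; first by have := rP a (mem_head _ _); rewrite inE.
  by apply: IH => b br; apply: rP; rewrite inE br orbT.
exists (\sum_(a <- finmap.enum_fset E) a); first exact: PE.
move=> z Kz; have [a /= aE az] := Ecov z Kz.
apply: le_lt_trans az; rewrite lerD2l (big_rem a) //= rformDl gerDl.
apply: PhiK => //; apply: PE => b /mem_rem; exact: EPhi.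
Qed.

End FaceCoordinates.

Section PeakPolynomial.
Context {R : realType} {N : nat}.
Local Notation C := (Cplx R).
Implicit Types (F D : set 'C[R]^N) (p z u v a x y : 'C[R]^N) (s t : R).
Let oT : open [set: 'C[R]^N] := openT.

Lemma CkcM k (U : set 'C[R]^N) (f g : 'C[R]^N -> C) : open U -> Ckc k U f -> Ckc k U g ->
  Ckc k U (fun y => f y * g y).
Proof.
move=> oU [f1 f2] [g1 g2]; split.
  by apply: (Ck_ext oU (fun y _ => esym (cReM (f y) (g y)))); apply: CkB => //; exact: CkM.
by apply: (Ck_ext oU (fun y _ => esym (cImM (f y) (g y)))); apply: CkD => //; exact: CkM.
Qed.

Lemma Ckc_cst k (U : set 'C[R]^N) (c : C) : open U -> Ckc k U (fun=> c).
Proof. by move=> oU; split; exact: Ck_cst. Qed.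

Lemma Ckc_sum k (U : set 'C[R]^N) m (f : 'I_m -> 'C[R]^N -> C) : open U ->
  (forall i, Ckc k U (f i)) -> Ckc k U (fun y => \sum_i f i y).
Proof.
move=> oU Hf; split.
  by apply: (Ck_ext oU (fun y _ => esym (cRe_sum _ _ _))); apply: Ck_sum => // i; exact: (Hf i).1.
by apply: (Ck_ext oU (fun y _ => esym (cIm_sum _ _ _))); apply: Ck_sum => // i; exact: (Hf i).2.
Qed.

Lemma Ckc_coord k p m (M : 'M[C]_(N, m)) j : Ckc k setT (fun z => ((z - p) *m M) 0 j).
Proof.
pose c : 'C[R]^N := \row_i M i j.
have E z : ((z - p) *m M) 0 j = \sum_i c 0 i * (z - p) 0 i.
  by rewrite mxE; apply: eq_bigr => i _; rewrite [c _ _]mxE mulrC.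
split.
  have H z : setT z -> rform c z - rform c p = complex.Re (((z - p) *m M) 0 j).
    by move=> _; rewrite E -rformB.
  by apply: (Ck_ext oT H); apply: CkB => //; [exact: Ck_rform | exact: Ck_cst].
have H z : setT z -> rform (- 'i *: c) z - rform (- 'i *: c) p = complex.Im (((z - p) *m M) 0 j).
  move=> _; rewrite E -rformB /rform cRe_sum cIm_sum; apply: eq_bigr => i _.
  by rewrite [X in X * _]mxE -mulrA mulNr cReN cReM cRe_i cIm_i; ring.
by apply: (Ck_ext oT H); apply: CkB => //; [exact: Ck_rform | exact: Ck_cst].
Qed.

Variables (p a : 'C[R]^N) (m0 m : nat) (X : 'M[C]_(N, m0)) (Y : 'M[C]_(N, m)).

(** The function [g] of the overview, with [L] given by [a] and the coordinates [x], [y] by the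
    matrices [X], [Y]. *)
Definition peak_exponent z : C :=
  ((z - p) *m a^T) 0 0 - (nsq ((z - p) *m X))%:C%C - \sum_j (((z - p) *m Y) 0 j) ^+ 2.

Definition peak (e : R) z : C := 1 + (e%:C)%C * peak_exponent z.

Lemma peak_exponent_C2 : Ckc 2 setT peak_exponent.
Proof.
have n1 : Ckc 2 setT (fun z => - (nsq ((z - p) *m X))%:C%C : C).
  split.
    have H z : setT z -> - \sum_j (complex.Re (((z - p) *m X) 0 j) * complex.Re (((z - p) *m X) 0 j)
        + complex.Im (((z - p) *m X) 0 j) * complex.Im (((z - p) *m X) 0 j))
        = complex.Re (- (nsq ((z - p) *m X))%:C%C).
      by rewrite cReN.
    have h j := CkD oT (CkM oT (Ckc_coord 2 p X j).1 (Ckc_coord 2 p X j).1)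
                      (CkM oT (Ckc_coord 2 p X j).2 (Ckc_coord 2 p X j).2).
    exact (Ck_ext oT H (CkN oT (Ck_sum _ _ oT h))).
  have H z : setT z -> 0 = complex.Im (- (nsq ((z - p) *m X))%:C%C) by rewrite cImN oppr0.
  by apply: (Ck_ext oT H); exact: Ck_cst.
have n2 : Ckc 2 setT (fun z => -1 * \sum_j (((z - p) *m Y) 0 j) ^+ 2).
  have h j := CkcM oT (Ckc_coord 2 p Y j) (Ckc_coord 2 p Y j).
  exact (CkcM oT (Ckc_cst 2 (-1) oT) (Ckc_sum oT h)).
have -> : peak_exponent = fun z => (((z - p) *m a^T) 0 0 + - (nsq ((z - p) *m X))%:C%C)
    + -1 * \sum_j (((z - p) *m Y) 0 j) ^+ 2.
  by apply/funext => z; rewrite /peak_exponent mulN1r.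
exact (CkcD oT (CkcD oT (Ckc_coord 2 p a^T 0) n1) n2).
Qed.

Lemma peak_C2 e : Ckc 2 setT (peak e).
Proof.
exact (CkcD oT (Ckc_cst 2 1 oT) (CkcM oT (Ckc_cst 2 _ oT) peak_exponent_C2)).
Qed.

Lemma Re_peak_exponent z : complex.Re (peak_exponent z) =
  rform a (z - p) - (nsq ((z - p) *m X) + complex.Re (\sum_j (((z - p) *m Y) 0 j) ^+ 2)).
Proof.
rewrite /peak_exponent !cReD !cReN opprD addrA; congr (_ - _ - _).
by rewrite mxE /rform; congr (complex.Re _); apply: eq_bigr => i _; rewrite [_^T _ _]mxE mulrC.
Qed.

Lemma peak_holo_along k (A : 'M[C]_(k, N)) e : A *m X = 0 -> holo_along A setT (peak e).
Proof.
move=> AX0 p0 w _.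
have dl n (M : 'M[C]_(N, n)) j : differentiable (fun w : 'C[R]^k => ((p0 + w *m A - p) *m M) 0 j) w.
  have -> : (fun w : 'C[R]^k => ((p0 + w *m A - p) *m M) 0 j) =
      cst (((p0 - p) *m M) 0 j) + \sum_i (fun w : 'C[R]^k => w 0 i * (A *m M) i j).
    apply/funext => x; rewrite addrAC mulmxDl -mulmxA mxE /GRing.add /= fct_sumE.
    by congr (_ + _); rewrite mxE.
  apply: differentiableD; first exact: differentiable_cst.
  apply: differentiable_sum => i; apply: differentiableM; first exact: differentiable_coord.
  exact: differentiable_cst.
have -> : (fun w : 'C[R]^k => peak e (p0 + w *m A)) = cst 1 + cst (e%:C)%C *
   ((fun w : 'C[R]^k => ((p0 + w *m A - p) *m a^T) 0 0) - cst (nsq ((p0 - p) *m X))%:C%C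
     - \sum_j (fun w : 'C[R]^k => ((p0 + w *m A - p) *m Y) 0 j)
       * (fun w : 'C[R]^k => ((p0 + w *m A - p) *m Y) 0 j)).
  apply/funext => x; rewrite /peak /peak_exponent /=.
  (* The only term that is not holomorphic is constant along the rows of [A]. *)
  have -> : (p0 + x *m A - p) *m X = (p0 - p) *m X.
    by rewrite addrAC mulmxDl -mulmxA AX0 mulmx0 addr0.
  rewrite /GRing.add /GRing.mul /GRing.opp /= fct_sumE.
  by [].
apply: differentiableD; first exact: differentiable_cst.
apply: differentiableM; first exact: differentiable_cst.
apply: differentiableB; last by apply: differentiable_sum => j; exact: differentiableM.
apply: differentiableB; [exact: dl | exact: differentiable_cst].
Qed.

Lemma peak_at e : peak e p = 1.
Proof.
rewrite /peak /peak_exponent subrr !mul0mx mxE nsq0 !sub0r.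
rewrite big1 => [|j _]; last by rewrite mxE expr0n.
by rewrite oppr0 addr0 mulr0 addr0.
Qed.

End PeakPolynomial.

(** * Peak functions near boundary points with few complex directions *)

Section LowerBound.
Context {R : realType} {N : nat}.
Local Notation C := (Cplx R).
Implicit Types (F D : set 'C[R]^N) (p z u v a x y : 'C[R]^N) (s t : R).

Lemma rform0l z : rform 0 z = 0.
Proof. by rewrite rformE map_mx0 dotrC dotr0. Qed.

Lemma continuous_rformB a p : continuous (fun z => rform a (z - p)).
Proof.
have -> : (fun z => rform a (z - p)) = (fun z => rform a z - rform a p).
  by apply/funext => y; rewrite rformB.
move=> z; apply: (@cvgB _ _ _ (nbhs z)); first exact: continuous_rform.
exact: (@cvg_cst _ _ _ (nbhs z)).
Qed.

Variables (D : set 'C[R]^N) (M : R).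
Hypotheses (oD : open D) (D0 : D !=set0) (cD : rconv D)
  (bD : forall z, closure D z -> nsq z <= M).

(** The induction climbs from the minimal face back to [closure D]. A point of [F_i] outside
    [F_(i+1)] is by definition strictly negative for some form supporting [F_i], so
    [strict_separation] applies on [F_i] minus [V0] with the cone of forms nonpositive on [F_i]. *)
Lemma face_separation p (phi : 'C[R]^N -> R) (V0 : set 'C[R]^N) : bd D p -> continuous phi ->
  open V0 -> (forall z, face D p z -> ~ V0 z -> phi z < 0) ->
  exists a, forall z, closure D z -> ~ V0 z -> phi z + rform a (z - p) < 0.
Proof.
move=> bp cphi oV Fphi; have [Kp NDp] := (bd_openE oD p).1 bp.
have [k [Ek Hk _]] := face_spec oD D0 cD bD bp.
suff H j : (j <= k.+1)%N -> exists a, forall z, face_seq D p (k.+1 - j) z -> ~ V0 z ->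
    phi z + rform a (z - p) < 0.
  by have [a aP] := H k.+1 (leqnn _); exists a => z Kz; apply: aP; rewrite subnn.
elim: j => [_|j IH jk].
  exists 0 => z; rewrite subn0 -Ek => Fz Vz; rewrite rform0l addr0; exact: Fphi.
have [a aP] := IH (ltnW jk); pose i := (k.+1 - j.+1)%N.
have iE : (k.+1 - j = i.+1)%N by rewrite /i; lia.
rewrite iE in aP; rewrite -/i.
have [cFi [Mi FiM] _ Fip] := pointed_body_face_seq cD bD i Kp.
have [|||||||b Pb bP] := @strict_separation _ _ (face_seq D p i `&` ~` V0) p
  (fun z => phi z + rform a (z - p)) [set b | forall z, face_seq D p i z -> rform b (z - p) <= 0].
- apply: (@compact_bounded_closed _ _ _ Mi); last by move=> z [Fz _]; exact: FiM.
  by apply: closedI => //; exact: open_closedC.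
- move=> z; apply: (@cvgD _ _ _ (nbhs z)); first exact: cphi.
  exact: continuous_rformB.
- by move=> z _; rewrite rform0l.
- by move=> b c Pb Pc z Fz; rewrite rformDl -[0]addr0 lerD ?Pb ?Pc.
- by move=> t b t0 Pb z Fz; rewrite rformZl mulr_ge0_le0 // Pb.
- by move=> b z Pb [Fz _]; exact: Pb.
- move=> z [Fz Vz]; have [Fz1|NFz1] := pselect (face_seq D p i.+1 z); first by left; exact: aP.
  right; apply: contrapT => H; apply: NFz1; rewrite /face_seq iterS FminP //; split=> // b sb.
  apply/eqP; rewrite eq_le sb.2 //= leNgt; apply/negP => b0; apply: H; exists b => //; exact: sb.2.
- exists (a + b) => z Fz Vz; rewrite rformDl addrA; exact: bP.
Qed.

(** The maximum of [|f|] may exceed 1 and be attained elsewhere than at [p], but only inside [V0];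
    that is enough to make a closed boundary meet [V0]. *)
Lemma exists_peak q p (V0 : set 'C[R]^N) : bd D p -> (nu D p <= q)%N -> (q <= N)%N ->
  open V0 -> V0 p -> exists2 f, extends_from_nbhd (qholo_plane q) (closure D) f &
    f p = 1 /\ forall z, closure D z -> ~ V0 z -> Normc.normc (f z) < 1.
Proof.
move=> bp nuq qN oV Vp; have [k [Ek Hk [Fp _]]] := face_spec oD D0 cD bD bp.
have rFp := raff_sub Fp; have [B [fB BP]] := nu_spec rFp.
have [m [X [Y [A [fA AX0 XYP]]]]] := face_coords rFp fB BP nuq qN.
pose g a := peak_exponent p a X Y.
have cg a : continuous (g a) by move=> z; exact (Ckc_cvg (peak_exponent_C2 p a X Y) (I : setT z)).
have [a aP] : exists a, forall z, closure D z -> ~ V0 z -> complex.Re (g a z) < 0.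
  have [||a aP] := @face_separation p (fun z => complex.Re (g 0 z)) V0 bp _ oV.
  - move=> z; apply: (@cvg_comp _ _ _ (g 0) (fun x : C => complex.Re x) (nbhs z)); first exact: cg.
    exact: continuous_Re.
  - move=> z Fz Vz; rewrite /g Re_peak_exponent rform0l sub0r oppr_lt0; apply: XYP.
      by rewrite /rdir /= addrC subrK; exact: raff_sub.
    by rewrite subr_eq0; apply/eqP => zp; apply: Vz; rewrite zp.
  exists a => z Kz Vz; have := aP z Kz Vz.
  by rewrite /g !Re_peak_exponent rform0l sub0r addrC.
have [e e0 eP] : exists2 e : R, 0 < e & forall z, closure D z -> ~ V0 z ->
    Normc.normc (peak p a X Y e z) < 1.
  pose K := closure D `&` ~` V0.
  have cK : compact K.
    apply: (@compact_bounded_closed _ _ _ M); last by move=> z [Kz _]; exact: bD.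
    by apply: closedI; [exact: closed_closure | exact: open_closedC].
  have [K0|/set0P/negP] := pselect (K !=set0); last first.
    by rewrite negbK => /eqP K0; exists 1 => // z Kz Vz; have : K z by []; rewrite K0.
  have cRe : continuous (fun z => complex.Re (g a z)).
    move=> z; apply: (@cvg_comp _ _ _ (g a) (fun x : C => complex.Re x) (nbhs z)); first exact: cg.
    exact: continuous_Re.
  have cIm : continuous (fun z => complex.Im (g a z)).
    move=> z; apply: (@cvg_comp _ _ _ (g a) (fun x : C => complex.Im x) (nbhs z)); first exact: cg.
    exact: continuous_Im.
  have [d d0 H1] : exists2 d, d < 0 & forall z, z \in K -> complex.Re (g a z) <= d.
    have [z1 Kz1 H1] := compact_EVT_max K0 cK (continuous_subspaceT cRe).
    by exists (complex.Re (g a z1)); [move: Kz1; rewrite inE => -[h1 h2]; exact: aP | exact: H1].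
  have cn : continuous (fun z => complex.Re (g a z) * complex.Re (g a z) +
                                 complex.Im (g a z) * complex.Im (g a z)).
    move=> z; apply: (@cvgD _ _ _ (nbhs z)); apply: (@cvgM _ _ (nbhs z)); [exact: cRe | exact: cRe | exact: cIm | exact: cIm].
  have [c c0 H2] : exists2 c, 0 <= c & forall z, z \in K ->
      complex.Re (g a z) * complex.Re (g a z) + complex.Im (g a z) * complex.Im (g a z) <= c.
    have [z2 Kz2 H2] := compact_EVT_max K0 cK (continuous_subspaceT cn).
    by exists (complex.Re (g a z2) * complex.Re (g a z2) + complex.Im (g a z2) * complex.Im (g a z2));
      [rewrite addr_ge0 // -expr2 sqr_ge0 | exact: H2].
  have c1 : 0 < c + 1 by lra.
  (* On [K], [|1 + e g|^2 <= 1 + e (2 d + e c)], and [e c < - d] makes the bracket negative. *)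
  pose e := - d / (c + 1).
  have e0 : 0 < e by rewrite divr_gt0 // oppr_gt0.
  have ec : e * (c + 1) = - d by rewrite /e divfK // gt_eqF.
  exists e => // z Kz Vz; have Kzz : z \in K by rewrite inE.
  have h1 := H1 z Kzz; have h2 := H2 z Kzz.
  have n2 : Normc.normc (peak p a X Y e z) ^+ 2 < 1.
    rewrite normcE2 /peak cReD cImD cReZ cImZ -/(g a z) /=.
    move: (complex.Re (g a z)) (complex.Im (g a z)) h1 h2 => x y h1 h2.
    have h3 : e * (x * x + y * y) <= e * c by rewrite ler_wpM2l // ltW.
    have h4 : e * (2 * x + e * (x * x + y * y)) < 0 by rewrite pmulr_rlt0 //; lra.
    lra.
  by move: n2; rewrite -[X in _ < X](expr1n _ 2) ltr_pXn2r // nnegrE ?ler01 // normc_ge0'.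
exists (peak p a X Y e); last by split; [exact: peak_at | exact: eP].
have C2f := peak_C2 p a X Y e.
split.
  by apply: continuous_subspaceT => z; exact (Ckc_cvg C2f (I : setT z)).
exists setT, (peak p a X Y e); split=> //; first exact: openT.
split; first exact: C2f.
exists A; split; [exact: fA | exact (peak_holo_along p a Y e AX0)].
Qed.

(** A boundary point outside [Gamma] is a limit of boundary points with [nu] at most [q]: if all
    nearby ones had [nu] at least [q + 1], they would be complex points as well. Peaks at these
    points bring any closed boundary arbitrarily close. *)
Lemma shilov_qholo_plane_lower q : (q <= N)%N ->
  bd D `\` Gamma q.+1 D `<=` shilovC (closure D) (extends_from_nbhd (qholo_plane q) (closure D)).
Proof.
move=> qN p [bp NG] S [SK cS Smax]; apply: cS => V /nbhs_interior Vp.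
have oV : open (V^°) by exact: open_interior.
have [p' [bp' Vp' nup']] : exists p', [/\ bd D p', V^° p' & (nu D p' <= q)%N].
  apply: contrapT => H; apply: NG; split=> //; rewrite /within /=.
  apply: filterS (open_nbhs_nbhs (conj oV (nbhs_singleton Vp))) => z Vz bz.
  have nz : (q < nu D z)%N by rewrite ltnNge; apply/negP => nz; apply: H; exists z.
  split=> //; apply: (complex_point_nu oD D0 cD bD bz); exact: leq_ltn_trans nz.
have [f fA [fp1 flt]] := exists_peak bp' nup' qN oV Vp'.
have [|x [Sx [Kx xmax]]] := Smax (fun z => lognorm (f z)); first by exists f.
exists x; split=> //; apply: interior_subset; apply: contrapT => Vx.
have := xmax p' ((bd_openE oD p').1 bp').1.
have n1 : Normc.normc (1 : C) = 1 := Normc.normc1 R.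
by rewrite lognorm_monotone fp1 n1 => /(lt_le_trans (flt x Kx Vx)); rewrite ltxx.
Qed.

End LowerBound.

(** * Maxima of q-plurisubharmonic functions *)

Section UscMax.
Context {R : realType} {T : topologicalType}.
Implicit Types (K : set T) (u : T -> \bar R).

Lemma usc_sub K (L : set T) u : L `<=` K -> usc_on K u -> usc_on L u.
Proof.
move=> LK uK x Lx; have [h1 h2] := uK x (LK _ Lx); split=> // a ua.
by apply: (@filterS _ (nbhs x) _ _ _ _ (h2 a ua)) => y h Ly; exact: h (LK _ Ly).
Qed.

Lemma usc_lt K u x y : usc_on K u -> K x -> K y -> (u x < u y)%E ->
  \forall z \near nbhs x, K z -> (u z < u y)%E.
Proof.
move=> uK Kx Ky xy; have [_ hx] := uK x Kx; have [hy _] := uK y Ky.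
have fy : u y \is a fin_num by rewrite fin_numE -ltey hy andbT gt_eqF // (le_lt_trans (leNye (u x))).
have := hx (fine (u y)); rewrite fineK // => /(_ xy).
by rewrite /within.
Qed.

(** The superlevel sets [S y] are nested and generate a proper filter on [K]; by semi-continuity
    each of its cluster points is a maximum. *)
Lemma usc_max K u : compact K -> K !=set0 -> usc_on K u -> Defs.maxset K u !=set0.
Proof.
move=> cK [x0 Kx0] uK.
pose S y : set T := [set x | K x /\ (u y <= u x)%E].
pose F : set_system T := [set A | exists2 y, K y & S y `<=` A].
have FF : ProperFilter F.
  split; first by case=> y Ky /(_ y); apply; split.
  split; first by exists x0.
    move=> A B [y Ky yA] [z Kz zB]; have [yz|/ltW zy] := leP (u y) (u z).
      by exists z => // x [Kx zx]; split; [apply: yA; split=> //; exact: le_trans yz zx | exact: zB].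
    by exists y => // x [Kx yx]; split; [exact: yA | apply: zB; split=> //; exact: le_trans zy yx].
  by move=> A B AB [y Ky yA]; exists y => // x /yA/AB.
have [|x [Kx clx]] := cK F FF; first by exists x0 => // x [].
exists x; split=> // y Ky; rewrite leNgt; apply/negP => xy.
have [|z [[Kz yz] /(_ Kz)]] := clx (S y) _ _ (usc_lt uK Kx Ky xy); first by exists y.
by rewrite ltNge yz.
Qed.

Lemma closed_maxset K u : closed K -> usc_on K u -> closed (Defs.maxset K u).
Proof.
move=> cK uK x clx; have Kx : K x by apply: cK => A /clx[y [[Ky _] Ay]]; exists y.
split=> // y Ky; rewrite leNgt; apply/negP => xy.
have [z [[Kz zmax] /(_ Kz)]] := clx _ (usc_lt uK Kx Ky xy).
by rewrite ltNge zmax.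
Qed.

End UscMax.

Section AffineFunctions.
Context {R : realType} {N : nat}.
Local Notation C := (Cplx R).
Implicit Types (F D : set 'C[R]^N) (p z u v a x y : 'C[R]^N) (s t : R).

Lemma pluriharmonic_affine b (c : R) : pluriharmonic setT (fun z => rform b z + c).
Proof.
have oT : open [set: 'C[R]^N] := openT.
split; first by apply: CkD => //; [exact: Ck_rform | exact: Ck_cst].
move=> z _; apply/funext => vs; rewrite /ddbar big1 // => k _; rewrite big1 // => l _.
pose f : 'C[R]^N -> C := fun z => (rform b z + c)%:C%C.
have dcst v (g : R) y : rderiv v (fun=> g) y = 0 by apply: hasd_rderiv; exact: hasd_cst.
have df v y : cderiv v f y = (rform b v)%:C%C.
  rewrite /cderiv; congr Complex; last exact: dcst.
  by apply: hasd_rderiv; rewrite -[X in hasd _ _ _ X]addr0; apply: hasdD; [exact: hasd_rform | exact: hasd_cst].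
have -> : wirtbar l f = fun=> 2^-1 * ((rform b (ebasis l))%:C%C + 'i * (rform b ('i *: ebasis l))%:C%C).
  by apply/funext => y; rewrite /wirtbar !df.
have dc v (g : C) y : cderiv v (fun=> g) y = 0 by rewrite /cderiv !dcst.
by rewrite /wirt !dc mulr0 subrr mulr0 mul0r.
Qed.

Lemma dotr_adj u v : dotr u v = complex.Re ((u *m (map_mx Num.conj v^T)) 0 0).
Proof.
rewrite mxE cRe_sum; apply: eq_bigr => j _; rewrite [map_mx _ _ _ _]mxE [_^T _ _]mxE.
by rewrite cReM cRe_conj cIm_conj; ring.
Qed.

End AffineFunctions.

Section InteriorMaximum.
Context {R : realType} {N : nat}.
Local Notation C := (Cplx R).
Implicit Types (F D : set 'C[R]^N) (p z u v a x y : 'C[R]^N) (s t : R).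

Lemma nsq_unitary k (A : 'M[C]_(k, N)) (w : 'C[R]^k) : A \is unitarymx -> nsq (w *m A) = nsq w.
Proof.
move=> /unitarymxP uA; rewrite /nsq !dotr_adj trmx_mul map_mxM mulmxA -(mulmxA w) uA.
by rewrite mulmx1.
Qed.

Lemma dotr_affine_form k (A : 'M[C]_(k, N)) p : exists b : 'C[R]^k, forall w, dotr p (w *m A) = rform b w.
Proof.
exists (map_mx Num.conj p *m A^T) => w; rewrite dotr_rform /rform; congr (complex.Re _).
under eq_bigr do rewrite [(_ *m A) 0 _]mxE mulr_sumr.
rewrite exchange_big; apply: eq_bigr => i _; rewrite mxE mulr_suml.
by apply: eq_bigr => j _; rewrite [A^T _ _]mxE [w 0 i * _]mulrC mulrA.
Qed.

(* On the disc compare g with the affine function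
   w |-> g p - e (2 Re<p, w A> + r^2 / 2). On the sphere it exceeds g p where
   2 Re<p, w A> < - r^2 / 2; elsewhere |p + w A| > |p|, so g < g p there, and a
   small e suffices by compactness. *)
Lemma no_interior_max q (K U : set 'C[R]^N) (g : 'C[R]^N -> \bar R) p (A : 'M[C]_(q.+1, N)) (r : R) :
  open U -> K `<=` U -> qpsh q U g -> A \is unitarymx -> 0 < r ->
  (forall w, nsq w <= r ^+ 2 -> K (p + w *m A)) -> 
  Defs.maxset K g p -> (forall z, Defs.maxset K g z -> nsq z <= nsq p) -> False.
Proof.
move=> oU KU [ug gq] uA r0 Kw [Kp pmax] far.
have [uv sub] := gq p A uA; set v := fun w => g (p + w *m A) in uv sub.
set U' := [set w | U (p + w *m A)] in uv sub.
pose S := [set w : 'C[R]^q.+1 | nsq w = r ^+ 2].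
have SU' : [set w | nsq w <= r ^+ 2] `<=` U' by move=> w /Kw/KU.
have vp : v 0 = g p by rewrite /v mul0mx addr0.
have nsqA w : nsq (p + w *m A) = nsq p + 2 * dotr p (w *m A) + nsq w.
  by rewrite nsqD nsq_unitary.
have [b bE] := dotr_affine_form A p.
have vmax w : nsq w <= r ^+ 2 -> (v w <= v 0%R)%E by move=> wr; rewrite vp; apply: pmax; exact: Kw.
have vfar w : nsq w <= r ^+ 2 -> v w = v 0 -> 2 * rform b w + nsq w <= 0.
  move=> wr vw; have := far (p + w *m A); rewrite nsqA bE => H.
  suff : nsq p + 2 * rform b w + nsq w <= nsq p by lra.
  apply: H; split; first exact: Kw.
  by move=> y Ky; move: vw; rewrite /v mul0mx addr0 => ->; exact: pmax.
have rr : 0 < r ^+ 2 by rewrite exprn_gt0.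
have cont : continuous (rform b) by exact: continuous_rform.
have clE : closure (eball (0 : 'C[R]^q.+1) r) = [set w | nsq w <= r ^+ 2].
  by rewrite closure_eballE //; apply/seteqP; split=> w /=; rewrite subr0.
pose T := S `&` [set w | - r ^+ 2 / 2 <= 2 * rform b w].
have cS : compact S.
  apply: (@compact_bounded_closed _ _ _ (r ^+ 2)); last by move=> w /= ->.
  by apply: (@closed_comp _ _ nsq [set x | x = r ^+ 2]); [move=> w _; exact: continuous_nsq | exact: closed_eq].
have cT : compact T.
  apply: (@compact_bounded_closed _ _ _ (r ^+ 2)); last by move=> w [/= -> _].
  apply: closedI; first by apply: compact_closed => //; exact: norm_hausdorff.
  apply: (@closed_comp _ _ (fun w => 2 * rform b w) [set x | - r ^+ 2 / 2 <= x]); last exact: closed_ge.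
  move=> w _; apply: (@cvgM _ _ (nbhs w)); [exact: (@cvg_cst _ _ _ (nbhs w)) | exact: cont].
have TE w : T w -> (v w < v 0%R)%E.
  move=> [Sw Tw]; rewrite lt_neqAle vmax ?Sw // andbT; apply/eqP => vw.
  have := vfar w; rewrite Sw /= in Tw *; move=> /(_ (lexx _) vw) H.
  by move: Tw; rewrite /=; lra.
have [w1 Tw1] : T !=set0.
  (* One of [w0] and [- w0] lies in the half space [rform b >= 0]. *)
  pose w0 : 'C[R]^q.+1 := (r%:C)%C *: delta_mx 0 0.
  have n0 : nsq w0 = r ^+ 2.
    rewrite nsqZ nsq_sum (bigD1 0) //= big1 => [|j j0].
      by rewrite !mxE eqxx Normc.normc1 expr1n addr0 mulr1.
    by rewrite !mxE (negbTE j0) Normc.normc0 expr0n.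
  have [w0b|w0b] := leP 0 (rform b w0).
    by exists w0; split=> //=; lra.
  by exists (- w0); split; rewrite /S /= ?nsqN // rformN; lra.
(* The value at the center is not [-oo], since [v w1] is strictly smaller. *)
have [m vm] : exists m : R, v 0 = m%:E.
  have U0 : U' 0 by apply: SU'; rewrite /= nsq0 ltW.
  have v0oo := (uv 0 U0).1; have vw1 := TE w1 Tw1; move: v0oo vw1.
  by case: (v 0) => [m _ _||]; [exists m | rewrite ltxx | move=> _; rewrite ltNge leNye].
rewrite vm in TE vmax.
have uT : usc_on T v by apply: usc_sub uv => w [Sw _]; apply: SU'; rewrite /= Sw.
have [d d0 vd] : exists2 d : R, 0 < d & forall w, T w -> (v w <= (m - d)%:E)%E.
  have [w2 [Tw2 w2max]] := usc_max cT (ex_intro _ w1 Tw1) uT.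
  have := TE w2 Tw2; case E : (v w2) => [x||] //.
    rewrite lte_fin => xm; exists (m - x); first by rewrite subr_gt0.
    by move=> w Tw; rewrite subKr -E; exact: w2max.
  move=> _; exists 1 => // w Tw; apply: le_trans (leNye _); rewrite -E; exact: w2max.
have [w2 Tw2 w2max] := compact_EVT_max (ex_intro _ w1 Tw1) cT (continuous_subspaceT cont).
pose c := 2 * rform b w2 + r ^+ 2 / 2.
have c0 : 0 <= c by move: Tw2; rewrite inE /c => -[_ /=]; lra.
have c1 : 0 < c + 1 by lra.
(* On [T] the affine function is at least [m - e * c >= m - d], which bounds [v] there. *)
pose e := d / (c + 1); have e0 : 0 < e by rewrite divr_gt0.
have ec : e * (c + 1) = d by rewrite /e divfK // gt_eqF.
pose h w := rform (((- 2 * e)%:C)%C *: b) w + (m - e * (r ^+ 2 / 2)).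
have hE w : h w = m - e * (2 * rform b w + r ^+ 2 / 2) by rewrite /h rformZl; ring.
have := sub 0 r h setT r0; rewrite clE.
move=> /(_ SU' openT (fun _ _ => I) (pluriharmonic_affine _ _)) H.
have b0 : eball (0 : 'C[R]^q.+1) r 0 by rewrite eballE /= subrr nsq0.
have {H}H := H _ 0 b0.
have : (v 0%R <= (h 0%R)%:E)%E.
  apply: H => w; rewrite bd_eballE //= subr0 => Sw.
  have [Tw|NTw] := pselect (T w).
    apply: le_trans (vd w Tw) _; rewrite lee_fin hE lerD2l lerN2.
    rewrite -ec ler_wpM2l // ?ltW // /c.
    by have := w2max w; rewrite inE => /(_ Tw); lra.
  have wr : nsq w <= r ^+ 2 by rewrite Sw.
  apply: le_trans (vmax w wr) _; rewrite lee_fin hE lerBrDr gerDl.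
  rewrite mulr_ge0_le0 ?ltW //; have : ~ (- r ^+ 2 / 2 <= 2 * rform b w) by move=> h1; apply: NTw; split.
  by move=> /negP; rewrite -ltNge; lra.
rewrite vm lee_fin hE rformE dotr0 mulr0 add0r lerBrDr gerDl.
by rewrite leNgt mulr_gt0 // divr_gt0.
Qed.

End InteriorMaximum.

(** * The upper bound for q-plurisubharmonic functions *)

Section ShilovUpperBound.
Context {R : realType} {N : nat}.
Local Notation C := (Cplx R).
Implicit Types (F D : set 'C[R]^N) (p z u v a x y : 'C[R]^N) (s t : R).

(** Gram-Schmidt makes the parametrization isometric; halving the radius passes from an open ball to
    a closed one inside it. *)
Lemma unitary_disc k (B : 'M[C]_(k, N)) p (K : set 'C[R]^N) (r : R) : row_free B -> (k <= N)%N ->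
  0 < r -> (forall v, (v <= B)%MS -> nsq v < r ^+ 2 -> K (p + v)) ->
  exists2 A : 'M[C]_(k, N), A \is unitarymx &
    forall w : 'C[R]^k, nsq w <= (r / 2) ^+ 2 -> K (p + w *m A).
Proof.
move=> fB kN r0 KB; have uA := schmidt_unitarymx B kN.
exists (schmidt B) => // w wr; apply: KB.
  by rewrite -(eqmx_schmidt_free fB) submxMl.
rewrite nsq_unitary //; apply: le_lt_trans wr _; rewrite ltr_pXn2r ?nnegrE ?divr_ge0 ?ltW //.
by rewrite ltr_pdivrMr // ltr_pMr // ltr1n.
Qed.

Variables (D : set 'C[R]^N) (M : R).
Hypotheses (oD : open D) (D0 : D !=set0) (cD : rconv D)
  (bD : forall z, closure D z -> nsq z <= M).

(** [Gamma], being defined by neighborhoods in the boundary, is relatively open in it. *)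
Lemma closed_bd_Gamma k : closed (bd D `\` Gamma k D).
Proof.
have cbd : closed (bd D) by rewrite /bd setDE; apply: closedI; [exact: closed_closure | exact: (open_closedC (open_interior _))].
move=> z clz; have bz : bd D z by apply: cbd => A /clz[y [[by_ _] Ay]]; exists y.
split=> // -[_ nz0]; have nz := nbhs_interior nz0.
have [y [[by_ NG] Vy]] := clz _ nz; apply: NG; split.
exact: by_.
exact: Vy.
Qed.

(** A point of [D] has room in all directions; a point of [Gamma] has a complex disc inside its own
    minimal face. *)
Lemma disc_in_closure q p : (q.+1 <= N)%N -> closure D p -> ~ (bd D `\` Gamma q.+1 D) p ->
  exists2 A : 'M[C]_(q.+1, N), A \is unitarymx & exists2 r : R, 0 < r &
    forall w : 'C[R]^q.+1, nsq w <= r ^+ 2 -> closure D (p + w *m A).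
Proof.
move=> qN Kp NB; suff [B [fB [r r0 BK]]] : exists B : 'M[C]_(q.+1, N), row_free B /\
    exists2 r : R, 0 < r & forall v, (v <= B)%MS -> nsq v < r ^+ 2 -> closure D (p + v).
  have [A uA AK] := unitary_disc fB qN r0 BK.
  by exists A; [exact: uA | exists (r / 2); [rewrite divr_gt0 | exact: AK]].
have [Dp|NDp] := pselect (D p).
  exists (pid_mx q.+1); split; first by rewrite /row_free rank_pid_mx.
  have /nbhsE_eball[r r0 rD] : nbhs p D by exact: open_nbhs_nbhs.
  exists r; first exact: r0.
  move=> v _ vr; apply: subset_closure; apply: rD.
  by rewrite eballE /= addrAC subrr add0r.
have bp : bd D p by exact: (bd_openE oD p).2 (conj Kp NDp).
have [_ nu_p] : qcomplex q.+1 D p.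
  have [_ H] : Gamma q.+1 D p by apply: contrapT => NG; exact: NB.
  exact: (nbhs_singleton H).
have [k [Ek _ [Fp]]] := face_spec oD D0 cD bD bp.
rewrite /within /= => /nbhsE_eball[r r0 rF].
have [B [fB BP]] := nu_spec (raff_sub Fp).
exists (pid_mx q.+1 *m B); split; first by rewrite /row_free mxrankMfree // rank_pid_mx.
exists r; first exact: r0.
move=> v vB vr.
have [Vv _] := (BP v).1 (submx_trans vB (submxMl _ _)).
have Fv : face D p (p + v) by apply: (rF _ _ Vv); rewrite eballE /= addrAC subrr add0r.
exact: (face_sub_bd oD D0 cD bD bp Fv).1.
Qed.

Lemma shilov_PSH_upper q : (q.+1 <= N)%N ->
  shilov (closure D) (PSH q (closure D)) `<=` bd D `\` Gamma q.+1 D.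
Proof.
(* It suffices that the right-hand side is itself a closed boundary. *)
move=> qN x; apply; split; first by move=> z [[Kz _] _].
  exact: closed_bd_Gamma.
move=> u [uK [U [g [oU KU gU ug]]]].
have cK : compact (closure D) by exact: (compact_bounded_closed (@closed_closure _ D) bD).
have K0 : closure D !=set0 by have [z Dz] := D0; exists z; exact: subset_closure.
have gK : usc_on (closure D) g by apply: usc_sub KU gU.1.
have uE : Defs.maxset (closure D) u = Defs.maxset (closure D) g.
  by rewrite predeqE => z; split=> -[Kz zmax]; split=> // y Ky; have := zmax y Ky; rewrite !ug.
rewrite uE; have [z0 z0max] := usc_max cK K0 gK.
have cM : compact (Defs.maxset (closure D) g).
  apply: (@compact_bounded_closed _ _ _ M); last by move=> z [Kz _]; exact: bD.
  apply: closed_maxset => //; exact: closed_closure.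
have [p pM pfar] := compact_EVT_max (ex_intro _ z0 z0max) cM (continuous_subspaceT (@continuous_nsq R N)).
rewrite inE in pM; exists p; split=> //; apply: contrapT => NB.
have [A uA [r r0 AK]] := disc_in_closure qN pM.1 NB.
apply: (no_interior_max oU KU gU uA r0 AK pM) => z zM; apply: pfar; rewrite inE; exact: zM.
Qed.

End ShilovUpperBound.

Section Inclusions.
Context {R : realType}.

(** A larger family has fewer closed boundaries, hence a larger intersection of them. *)
Lemma shilov_mono (T : topologicalType) (K : set T) (A B : set (T -> \bar R)) :
  A `<=` B -> shilov K A `<=` shilov K B.
Proof. by move=> AB x Ax S [SK cS SB]; apply: Ax; split=> // f /AB; exact: SB. Qed.

Lemma shilovC_plane_qholo n q (K : set 'C[R]^n.+1) : (q <= n.+1)%N ->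
  shilovC K (extends_from_nbhd (qholo_plane q) K) `<=`
  shilovC K (extends_from_nbhd (qholo q) K).
Proof.
move=> qn; apply: shilov_mono => _ [f [cf [U [g [oU KU gU fg]]]] <-].
exists f => //; split=> //; exists U, g; split=> //; exact: qholo_plane_qholo.
Qed.

Lemma shilovC_qholo_PSH N q (K : set 'C[R]^N) :
  shilovC K (extends_from_nbhd (qholo q) K) `<=` shilov K (PSH q K).
Proof.
apply: shilov_mono => _ [f [cf [U [g [oU KU gU fg]]]] <-].
split; first exact: usc_lognorm.
exists U, (fun z => lognorm (g z)); split=> //; last by move=> z Kz; rewrite fg.
split.
  apply: usc_lognorm; apply: continuous_in_subspaceT => z; rewrite inE => Uz.
  exact: (Ckc_cvg (gU.1 : Ckc 2 U g) Uz).
move=> p A _; have h := qholo_affine p A oU gU.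
exact (subpluriharmonic_lognorm (open_affine (p := p) (A := A) oU) h).
Qed.

End Inclusions.

Theorem theorem6p19 (R : realType) (N q : nat) (D : set 'C[R]^N) :
  (q + 2 <= N)%N ->
  domain D -> convex_set D -> bounded_set D ->
  [/\ shilovC (closure D) (extends_from_nbhd (qholo_plane q) (closure D))
        = shilovC (closure D) (extends_from_nbhd (qholo q) (closure D)),
      shilovC (closure D) (extends_from_nbhd (qholo q) (closure D))
        = shilov (closure D) (PSH q (closure D))
    & shilov (closure D) (PSH q (closure D))
        = bd D `\` Gamma q.+1 D].
Proof.
(* The algebra of forms is set up in dimension [n.+1]; [N = 0] contradicts the bound on [q]. *)
case: N D => [|n] D qN [oD D0 _] /convex_set_rconv cD /bounded_nsq[M DM]; first by lia.
have bD z : closure D z -> nsq z <= M.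
  move=> Kz; have cl : closed [set z : 'C[R]^n.+1 | nsq z <= M].
    apply: (@closed_comp _ _ nsq [set x | x <= M]); last exact: closed_le.
    by move=> y _; exact: continuous_nsq.
  by apply: cl; move=> A /Kz[y [Dy Ay]]; exists y; split=> //; exact: DM.
have h1 := shilov_qholo_plane_lower oD D0 cD bD (_ : (q <= n.+1)%N).
have h2 := @shilovC_plane_qholo R n q (closure D) (_ : (q <= n.+1)%N).
have h3 := @shilovC_qholo_PSH R n.+1 q (closure D).
have h4 := shilov_PSH_upper oD D0 cD bD (_ : (q.+1 <= n.+1)%N).
have q1 : (q <= n.+1)%N by lia.
have q2 : (q.+1 <= n.+1)%N by lia.
move: (h1 q1) (h2 q1) (h4 q2) => {h1 h2 h4} h1 h2 h4.
(* Each remaining inclusion is reached by going round the cycle. *)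
split; apply/seteqP; split=> //.
- by move=> z /h3/h4/h1.
- by move=> z /h4/h1/h2.
- by move=> z /h1/h2/h3.
Qed.
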